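(* Let $\sigma_1,\sigma_2$ be density matrices in $\mathbb{C}^n$ and let $f := \|\sigma_1-\sigma_2\|_F$. (1) There is a universal constant $K_0$ such that for every $K\geq K_0$ the following holds. Let $m \geq \frac{4nK^2}{f^2}$, let $\widehat{\mathcal{B}}$ be a uniformly random orthonormal basis of $\mathbb{C}^n\otimes\mathbb{C}^m$, and let $\mathcal{M}$ be the POVM on $\mathbb{C}^n$ obtained by mapping a state $\sigma$ to $\sigma\otimes|0\rangle\langle 0|$ (with $|0\rangle$ a fixed unit vector of $\mathbb{C}^m$) and measuring in the basis $\widehat{\mathcal{B}}$. Then with probability at least $1-\exp(-\Omega(Kn))$ over the choice of $\widehat{\mathcal{B}}$, $\|\mathcal{M}(\sigma_1)-\mathcal{M}(\sigma_2)\|_1 > \Omega(f)$. (2) Let $K\geq 1$ be an integer and $m := Kn$. Let $b_1,\ldots,b_m$ be independent random vectors in $\mathbb{C}^n\otimes\mathbb{C}^K\cong\mathbb{C}^m$, each obtained by choosing $m$ independent complex coordinates whose real and imaginary parts are independent standard real Gaussians. Let $\ell := \|\sum_{i=1}^m b_ib_i^\dagger\|$ (operator norm) and $\nu := I_{\mathbb{C}^n\otimes\mathbb{C}^K} - \frac1\ell\sum_{i=1}^m b_ib_i^\dagger$. Let $\overline{\mathcal{M}}$ be the POVM on $\mathbb{C}^n\otimes\mathbb{C}^K$ with elements $\frac{b_ib_i^\dagger}{\ell}$ ($1\le i\le m$) and $\nu$, and let $\mathcal{M}$ be the POVM on $\mathbb{C}^n$ obtained by mapping $\sigma$ to $\sigma\otimes|0\rangle\langle0|$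 (with $|0\rangle$ a fixed unit vector of $\mathbb{C}^K$) and applying $\overline{\mathcal{M}}$. Then with probability at least $1-\exp(-\Omega(m))$ over the choice of $b_1,\ldots,b_m$, \[ \|\mathcal{M}(\sigma_1)-\mathcal{M}(\sigma_2)\|_1 > \Omega\!\left(\frac{f}{\log m}\right). \]
   Context: For a matrix $A$, $\|A\|_F := \sqrt{\mathrm{Tr}A^\dagger A}$. A uniformly random orthonormal basis is the set of columns of a Haar-random unitary. For a POVM $\mathcal{M}$ with elements $E_k$, $\mathcal{M}(\sigma) := (\mathrm{Tr}(\sigma E_k))_k$, and $\|p-q\|_1 := \sum_k|p_k-q_k|$. $O(\cdot),\Omega(\cdot)$ hide positive universal constants independent of $n$, $m$, $K$, $\sigma_1,\sigma_2$.
   Formalization: In part (2) the assumption σ1 ≠ σ2 is added, since for σ1 = σ2 one has f = 0 and both sides vanish, so the strict inequality fails; it also forces n ≥ 2, hence log m > 0. *)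

(* Defs.v *)
From HB Require Import structures.
From mathcomp Require Import all_boot all_order all_algebra.
From mathcomp Require Import all_classical all_reals all_analysis.
From mathcomp.real_closed Require Import complex mxtens.

Set Implicit Arguments.
Unset Strict Implicit.
Unset Printing Implicit Defensive.

Import Order.TTheory GRing.Theory Num.Theory.
Import numFieldNormedType.Exports.

Local Open Scope classical_set_scope.
Local Open Scope ring_scope.

Section QuantumDefs.
Variable R : realType.
Local Notation C := R[i].

Definition adj {p q : nat} (A : 'M[C]_(p, q)) : 'M[C]_(q, p) :=
  (map_mx (@conjc R) A)^T.

(** density matrix: positive semidefinite (v^dagger A v is a nonnegative
    real for every v; the order on R[i] is "y - x is a nonnegative real"),
    Hermitian, trace one *)
Definition density_matrix {p : nat} (A : 'M[C]_p) : Prop :=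
  [/\ adj A = A,
      (forall v : 'cV[C]_p, 0 <= (adj v *m A *m v) 0 0)
    & \tr A = 1].

Definition unitary {p : nat} (U : 'M[C]_p) : Prop := adj U *m U = 1%:M.

Definition frob {p q : nat} (A : 'M[C]_(p, q)) : R :=
  Num.sqrt (complex.Re (\tr (adj A *m A))).

Definition vnorm {p : nat} (v : 'cV[C]_p) : R :=
  Num.sqrt (\sum_(i < p) Normc.normc (v i 0) ^+ 2).

Definition unit_vector {p : nat} (v : 'cV[C]_p) : Prop := vnorm v = 1.

Definition opnorm {p : nat} (A : 'M[C]_p) : R :=
  sup [set r : R | exists v : 'cV[C]_p, vnorm v = 1 /\ r = vnorm (A *m v)].

Definition ketbra {p : nat} (v : 'cV[C]_p) : 'M[C]_p := v *m adj v.

(** Outcome probability Tr(rho E) of a POVM element E on state rho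
    (a real number for Hermitian rho, E; we take its real part) *)
Definition outcome {p : nat} (rho E : 'M[C]_p) : R := complex.Re (\tr (rho *m E)).

Definition l1dist {I : finType} (p q : I -> R) : R := \sum_(k : I) `|p k - q k|.

(** Part (1): the POVM on C^n obtained by sigma |-> sigma (x) |e0><e0| and
    measuring in the orthonormal basis given by the columns of the unitary
    U of C^n (x) C^m. *)
Definition basis_povm {n m : nat} (U : 'M[C]_(n * m)) (e0 : 'cV[C]_m)
    (sigma : 'M[C]_n) : 'I_(n * m) -> R :=
  fun k => outcome (sigma *t ketbra e0) (ketbra (col k U)).

Definition gram {N m : nat} (b : 'I_m -> 'cV[C]_N) : 'M[C]_N :=
  \sum_(i < m) ketbra (b i).

Definition gauss_povm_elem {N m : nat} (b : 'I_m -> 'cV[C]_N)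
    (k : option 'I_m) : 'M[C]_N :=
  let l := ((opnorm (gram b))%:C)%C in
  match k with
  | Some i => l^-1 *: ketbra (b i)
  | None => 1%:M - l^-1 *: gram b
  end.

Definition gauss_povm {n K m : nat} (b : 'I_m -> 'cV[C]_(n * K))
    (e0 : 'cV[C]_K) (sigma : 'M[C]_n) : option 'I_m -> R :=
  fun k => outcome (sigma *t ketbra e0) (gauss_povm_elem b k).

Definition mx_continuous {p : nat} (g : 'M[C]_p -> R) : Prop :=
  forall (A : 'M[C]_p) (e : R), 0 < e -> exists2 d : R, 0 < d &
    forall B : 'M[C]_p, (forall i j, Normc.normc (B i j - A i j) < d) ->
      `|g B - g A| < e.

Definition mx_bounded {p : nat} (g : 'M[C]_p -> R) : Prop :=
  exists M : R, forall A, `|g A| <= M.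

End QuantumDefs.

Section RandomDefs.
Local Open Scope ereal_scope.
Context {R : realType} {d : measure_display} {T : measurableType d}.
Variable P : probability T R.

(** U is a Haar-distributed (uniformly random) unitary: it takes values in
    the unitary group, is Borel measurable (tested against all bounded
    continuous functions, which generate the Borel sigma-algebra), and its
    law is invariant under left multiplication by any fixed unitary.  The
    Haar measure is the unique such probability law on U(p). *)
Definition haar_unitary {p : nat} (U : T -> 'M[R[i]]_p) : Prop :=
  [/\ forall t, unitary (U t),
      forall g : 'M[R[i]]_p -> R, mx_continuous g -> mx_bounded g ->
        measurable_fun setT (fun t => g (U t))
    & forall (g : 'M[R[i]]_p -> R) (V : 'M[R[i]]_p),
        mx_continuous g -> mx_bounded g -> unitary V ->
        \int[P]_t (g (U t))%:E = \int[P]_t (g (V *m U t))%:E].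

Definition mutually_independent {I : finType} (X : I -> T -> R) : Prop :=
  (forall k, measurable_fun setT (X k)) /\
  forall A : I -> set R, (forall k, measurable (A k)) ->
    P (\bigcap_(k in [set: I]) (X k @^-1` A k)) =
    \prod_(k : I) P (X k @^-1` A k).

Definition std_gaussian (X : T -> R) : Prop :=
  measurable_fun setT X /\
  forall A : set R, measurable A -> P (X @^-1` A) = normal_prob 0 1 A.

Definition complex_gaussian_vectors {N m : nat}
    (b : T -> 'I_m -> 'cV[R[i]]_N) : Prop :=
  let X := fun (k : 'I_m * 'I_N * bool) t =>
    if k.2 then complex.Re (b t k.1.1 k.1.2 ord0) else complex.Im (b t k.1.1 k.1.2 ord0) in
  mutually_independent X /\ forall k, std_gaussian (X k).

End RandomDefs.

(* Main.v *)
(** Up to normalization, each outcome contributes |Z| for a quadratic form Z with a traceless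
    Hermitian matrix M in a Gaussian vector.  A quartic polynomial majorant of
    exp(-|Z|) together with the second and fourth moments of Z, all of them consequences of the
    Gaussian integration by parts formula for polynomials, bounds the Laplace transform of the
    sum of the |Z|, and Markov's inequality makes it at least a constant times the number of
    outcomes times the Frobenius norm of M, up to exponentially small probability.

    For the Gaussian POVM it remains to bound the operator norm of the Gram matrix by O(m),
    which follows from its moments tested against an independent Gaussian vector.

    For the Haar basis, an independent n x N complex Gaussian matrix G, N = nm, is with high
    probability close to sqrt(2N) (1 + H) J V, where H is small, J is the coisometry
    1 (x) <e0| and V is unitary.  Left invariance of the law of U replaces V U by U, while for
    fixed U the matrix G U is again Gaussian; averaging over both G and U thus transfers the
    Gaussian Laplace transform bound to J U.  Since f^2 <= 4, the hypothesis on m gives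
    N >= (K n)^2, which leaves room for the error terms. *)
Require Import Defs.
From HB Require Import structures.
From mathcomp Require Import all_boot all_order all_algebra.
From mathcomp Require Import all_classical all_reals all_analysis.
From mathcomp.real_closed Require Import complex mxtens.
From mathcomp Require Import measurable_realfun.
From mathcomp Require spectral.
From mathcomp Require Import zify ring lra.

Set Implicit Arguments.
Unset Strict Implicit.
Unset Printing Implicit Defensive.

Import Order.TTheory GRing.Theory Num.Theory.
Import numFieldNormedType.Exports.
Local Open Scope classical_set_scope.
Local Open Scope ring_scope.

(** * Moments of the normal distribution *)

(** Gaussian variables are integrated only against polynomials. The integration by parts identity is
    carried by the chain rule to orthonormal linear combinations, and weighting by factors in other
    variables leaves it intact; this does the work of rotation invariance and of conditioning. It is
    also why the majorant of exp(-|z|) is a polynomial. A normalized form has second moment 2 and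
    fourth moment at most 108, so the majorant has mean at most 1 - 2/54 + 1/54.

    In the Haar case the columns of J U are dependent, and the closeness of G to a multiple of a
    coisometry rests on a second moment bound, whose failure probability is not exponentially small.
    The exponential rate survives because G and U are independent: for each fixed G the deviation
    enters as an additive term proportional to the very Laplace transform being bounded, and after
    averaging over G at most half of that transform is lost and can be moved to the other side.

    For the Gram matrix, the moment of order m, equal to the dimension, costs only a constant factor
    once m-th roots are taken. *)

Section density.
Local Open Scope ereal_scope.
Context d1 d2 (T : measurableType d1) (Y : measurableType d2) (R : realType).
Variables (mu : {measure set T -> \bar R}) (nu : {measure set Y -> \bar R}).
Import HBNNSimple.

(** Both sides are monotone limits over simple functions, so the identity on indicators propagates
    to [phi]. With [X = id] it says that [nu] has density [psi]; with [psi] a product of other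
    factors it integrates out one coordinate at a time. *)
Lemma ge0_integral_density (X : T -> Y) (psi : T -> R) (c : R)
    (phi : Y -> R) :
  measurable_fun setT X -> measurable_fun setT psi ->
  (forall t, (0 <= psi t)%R) -> (0 <= c)%R ->
  (forall A, measurable A ->
    \int[mu]_t (\1_A (X t) * psi t)%:E = c%:E * nu A) ->
  measurable_fun setT phi -> (forall y, (0 <= phi y)%R) ->
  \int[mu]_t (phi (X t) * psi t)%:E = c%:E * \int[nu]_y (phi y)%:E.
Proof.
move=> mX mpsi psi0 c0 hA mphi phi0.
have mphiE : measurable_fun setT (fun y => (phi y)%:E) by exact/measurable_EFinP.
pose g := nnsfun_approx measurableT mphiE.
have gcvg y : EFin \o g^~ y @ \oo --> (phi y)%:E.
  by apply: (@cvg_nnsfun_approx _ _ _ setT) => // x _; rewrite /= lee_fin.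
have gnd y m n : (m <= n)%N -> (g m y <= g n y)%R.
  by move=> mn; exact/lefP/nd_nnsfun_approx.
have g0 n y : (0 <= g n y)%R by [].
have mg n : measurable_fun setT (g n) by exact: measurable_funP.
have mgX n : measurable_fun setT (fun t => (g n (X t) * psi t)%:E).
  apply/measurable_EFinP/measurable_funM => //.
  exact: (measurableT_comp (mg n) mX).
have mpre n k : measurable (g n @^-1` [set k]).
  by rewrite -[_ @^-1` _]setTI; exact: mg.
have mind n k : measurable_fun setT (fun t => \1_(g n @^-1` [set k]) (X t) : R).
  by apply: (measurableT_comp _ mX); exact: measurable_indic.
have step n : \int[mu]_t (g n (X t) * psi t)%:E = c%:E * \int[nu]_y (g n y)%:E.
  transitivity (\sum_(k \in range (g n)) k%:E * (c%:E * nu (g n @^-1` [set k]))).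
    under eq_integral => t _ do rewrite fimfunE mulr_fsuml -fsumEFin//.
    rewrite ge0_integral_fsum//; first last.
    - move=> k t _; rewrite lee_fin mulr_ge0//.
      by have := nnfun_muleindic_ge0 (g n) k (X t); rewrite -EFinM lee_fin.
    - move=> k; apply/measurable_EFinP/measurable_funM => //.
      by apply: measurable_funM; [exact: measurable_cst|exact: mind].
    apply: eq_fsbigr => k; rewrite inE => -[y _ <-].
    rewrite -hA// -ge0_integralZl//.
    - by apply: eq_integral => t _; rewrite -EFinM mulrA.
    - by apply/measurable_EFinP/measurable_funM.
    - by move=> t _; rewrite lee_fin mulr_ge0.
    - by rewrite lee_fin.
  have -> : \int[nu]_y (g n y)%:E = sintegral nu (g n) by exact: integralT_nnsfun.
  rewrite sintegralE ge0_mule_fsumr.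
    by apply: eq_fsbigr => k _; rewrite muleCA.
  by move=> k; exact: nnsfun_mulemu_ge0.
transitivity (limn (fun n => \int[mu]_t (g n (X t) * psi t)%:E)).
  rewrite -monotone_convergence//.
  - apply: eq_integral => t _; apply/esym/cvg_lim => //.
    under eq_fun do rewrite EFinM muleC.
    by rewrite EFinM muleC; apply: cvgeZl => //; exact: gcvg.
  - by move=> n t _; rewrite lee_fin mulr_ge0.
  - by move=> t _ m n mn; rewrite lee_fin ler_wpM2r// gnd.
under eq_fun do rewrite step.
apply/cvg_lim => //; apply: cvgeZl => //.
have -> : \int[nu]_y (phi y)%:E = \int[nu]_y limn ((fun n y => (g n y)%:E)^~ y).
  by apply: eq_integral => y _; apply/esym/cvg_lim => //; exact: gcvg.
apply: cvg_monotone_convergence => //.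
- by move=> n; exact/measurable_EFinP.
- by move=> n y _; rewrite lee_fin.
- by move=> y _ m n mn; rewrite lee_fin gnd.
Qed.
End density.

Section normal_moments.
Context {R : realType}.
Local Notation mu := (@lebesgue_measure R).
Local Notation pdf := (@normal_pdf R 0 1).
Local Notation N01 := (@normal_prob R 0 1).

(** The moments of N(0,1), zero in odd degree and double factorials in even degree, in the form of
    the recursion that integration by parts produces. *)
Fixpoint gmom (k : nat) : R :=
  match k with
  | 0%N => 1
  | 1%N => 0
  | k'.+2 => k'.+1%:R * gmom k'
  end.

Lemma gmomS k : gmom k.+1 = k%:R * gmom k.-1.
Proof. by case: k => [|k] /=; rewrite ?mul0r. Qed.

Lemma ge0_integral_normal_prob (f : R -> R) :
  measurable_fun setT f -> (forall x, 0 <= f x) ->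
  (\int[N01]_x (f x)%:E = \int[mu]_x (f x * pdf x)%:E)%E.
Proof.
move=> mf f0; apply/esym.
rewrite (@ge0_integral_density _ _ _ _ _ mu N01 id pdf 1 f) ?mul1e//.
- exact: measurable_normal_pdf.
- by move=> x; exact: normal_pdf_ge0.
- move=> A mA; rewrite mul1e /normal_prob [RHS]integral_mkcond.
  apply: eq_integral => x _; rewrite patchE indicE; case: ifPn => xA.
    by rewrite mul1r.
  by rewrite mul0r.
Qed.

Lemma integral_normal_prob (f : R -> R) :
  measurable_fun setT f ->
  (\int[N01]_x (f x)%:E = \int[mu]_x (f x * pdf x)%:E)%E.
Proof.
move=> mf; rewrite integralE [RHS]integralE.
have maxE (g : R -> R) (x : R) : (maxe (g x)%:E 0 = (Num.max (g x) 0)%:E)%E.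
  by rewrite EFin_max.
have pdfM (g : R -> R) x : Num.max (g x * pdf x) 0 = Num.max (g x) 0 * pdf x.
  by rewrite maxr_pMl ?mul0r// normal_pdf_ge0.
congr (_ - _)%E.
- under eq_integral do rewrite funeposE maxE.
  under [RHS]eq_integral do rewrite funeposE maxE pdfM.
  apply: ge0_integral_normal_prob => [|x]; last by rewrite le_max lexx orbT.
  exact: measurable_maxr.
- under eq_integral do rewrite funenegE -EFinN (maxE (fun x => - f x)).
  under [RHS]eq_integral do rewrite funenegE -EFinN -mulNr
    (maxE (fun x => - f x * pdf x)) (pdfM (fun x => - f x)).
  apply: ge0_integral_normal_prob => [|x]; last by rewrite le_max lexx orbT.
  by apply: measurable_maxr => //; exact: measurableT_comp.
Qed.

Lemma integrable_normal_prob (f : R -> R) :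
  measurable_fun setT f ->
  mu.-integrable setT (fun x => (f x * pdf x)%:E) ->
  N01.-integrable setT (fun x => (f x)%:E).
Proof.
move=> mf /integrableP[_ fi]; apply/integrableP; split; first exact/measurable_EFinP.
under eq_integral do rewrite abse_EFin.
rewrite ge0_integral_normal_prob//; last exact: measurableT_comp.
congr (_ < _)%E: fi; apply: eq_integral => x _.
by rewrite abse_EFin normrM [X in _ * X]ger0_norm// normal_pdf_ge0.
Qed.

Let c0 : R := normal_peak 1.

Lemma std_normal_pdfE x : pdf x = c0 * expR (- (x ^+ 2 / 2)).
Proof.
rewrite normal_pdfE ?oner_neq0///normal_fun subr0 expr1n.
by rewrite mulNr mulr2n.
Qed.

(** Half of the Gaussian decay absorbs the power, by y^(k+1) <= (k+1)! exp y at y = x^2/4; the other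
    half is kept, being integrable by [expRNsqr4E]. *)
Lemma powR_normal_bound k (x : R) :
  `|x| ^+ k * expR (- (x ^+ 2 / 2)) <=
  (1 + 4 ^+ k.+1 * (k.+1)`!%:R) * expR (- (x ^+ 2 / 4)).
Proof.
have -> : - (x ^+ 2 / 2) = - (x ^+ 2 / 4) + - (x ^+ 2 / 4) by field.
rewrite expRD mulrA ler_pM2r ?expR_gt0// expRN ler_pdivrMr ?expR_gt0//.
have x0 : 0 <= x ^+ 2 / 4 by rewrite divr_ge0 ?sqr_ge0.
have e1 := expR_ge1Dxn k x0; set E := expR _ in e1 *.
have E1 : 1 <= E by rewrite -expR0 ler_expR.
apply: (@le_trans _ _ (1 + (x ^+ 2) ^+ k.+1)).
  have -> : (x ^+ 2) ^+ k.+1 = `|x| ^+ (2 * k.+1).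
    by rewrite exprM real_normK ?num_real.
  have [xle1|xgt1] := leP `|x| 1.
    by rewrite ler_wpDr// ?exprn_ge0// exprn_ile1.
  rewrite ler_wpDl// ler_weXn2l 1?ltW//.
  by rewrite mul2n -addnn addSn leqW// leq_addr.
rewrite mulrDl mul1r lerD//.
move: e1; rewrite expr_div_n => e1.
have p4 : 0 < 4 ^+ k.+1 * (k.+1)`!%:R :> R by rewrite mulr_gt0// ltr0n fact_gt0.
rewrite mulrC -ler_pdivrMr// invfM mulrA.
by rewrite (le_trans _ e1)// ler_wpDl.
Qed.

Lemma expRNsqr4E : exists2 c : R, 0 < c &
  forall x : R, expR (- (x ^+ 2 / 4)) = c * normal_pdf 0 (Num.sqrt 2) x.
Proof.
have s2 : Num.sqrt 2 != 0 :> R by rewrite gt_eqF// sqrtr_gt0.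
exists (normal_peak (Num.sqrt 2))^-1; first by rewrite invr_gt0 normal_peak_gt0.
move=> x; rewrite normal_pdfE// mulKf ?gt_eqF ?normal_peak_gt0//.
rewrite /normal_fun subr0 sqr_sqrtr// mulNr; congr (expR (- (_ / _))).
by ring.
Qed.

Lemma integrable_pow_normal_pdf k :
  mu.-integrable setT (fun x : R => (x ^+ k * pdf x)%:E).
Proof.
have [c c_gt0 cE] := expRNsqr4E.
pose C : R := c0 * (1 + 4 ^+ k.+1 * (k.+1)`!%:R) * c.
have Cint := integrableZl measurableT C (integrable_normal_pdf 0 (Num.sqrt 2 : R)).
apply: (le_integrable measurableT _ _ Cint).
  apply/measurable_EFinP; apply: measurable_funM; first exact: exprn_measurable.
  exact: measurable_normal_pdf.
move=> x _; rewrite -EFinM !abse_EFin lee_fin std_normal_pdfE.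
have c00 : 0 <= c0 by exact: normal_peak_ge0.
rewrite [leRHS]ger0_norm; last first.
  rewrite mulr_ge0 ?normal_pdf_ge0// /C !mulr_ge0 ?(ltW c_gt0)// addr_ge0//.
rewrite !normrM normrX (ger0_norm c00) (ger0_norm (expR_ge0 _)) mulrCA.
rewrite /C -!mulrA ler_wpM2l// mulrA -cE.
exact: powR_normal_bound.
Qed.

Lemma integrable_pow_normal_prob k :
  N01.-integrable setT (fun x : R => (x ^+ k)%:E).
Proof.
apply: integrable_normal_prob; last exact: integrable_pow_normal_pdf.
exact: exprn_measurable.
Qed.

Lemma is_derive_std_normal_pdf (x : R) : is_derive x (1 : R) pdf (- x * pdf x).
Proof.
pose q : {poly R} := (- 2^-1)%:P * 'X^2.
have -> : pdf = c0 \*: (expR \o horner q).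
  apply/funext => y; rewrite std_normal_pdfE /= /q !hornerE.
  by congr (_ * expR _); rewrite /=; field.
apply: is_derive_eq; rewrite /= /q derivM derivC mul0r add0r derivXn.
rewrite !(hornerM, hornerC, hornerXn, hornerMn) /GRing.scale/=.
by field.
Qed.

Lemma is_derive_pow_normal_pdf k (x : R) :
  is_derive x (1 : R) (fun x : R => x ^+ k * pdf x)
    (k%:R * x ^+ k.-1 * pdf x - x ^+ k.+1 * pdf x).
Proof.
have dp := is_derive_std_normal_pdf x.
have -> : (fun x : R => x ^+ k * pdf x) = (id ^+ k) * pdf.
  by apply/funext => y; rewrite !fctE.
apply: is_derive_eq; rewrite !fctE /GRing.scale/= exprS; ring.
Qed.

(** [powR_normal_bound] with one more power gives a decay of order 1/(n+1). The sign [s] treats both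
    ends of [-n-1, n+1] at once. *)
Lemma cvg_pow_normal_pdf k (s : R) : `|s| = 1 ->
  ((s * n.+1%:R) ^+ k * pdf (s * n.+1%:R)) @[n --> \oo] --> (0 : R).
Proof.
move=> s1; have c00 : 0 <= c0 by exact: normal_peak_ge0.
pose C : R := c0 * (1 + 4 ^+ k.+2 * (k.+2)`!%:R).
have C0 : 0 <= C by rewrite mulr_ge0// addr_ge0.
have bnd n : `|(s * n.+1%:R) ^+ k * pdf (s * n.+1%:R)| <= C * harmonic n.
  set x := s * n.+1%:R; have xE : `|x| = n.+1%:R by rewrite normrM s1 mul1r normr_nat.
  have pE : `|pdf x| = c0 * expR (- (x ^+ 2 / 2)).
    by rewrite std_normal_pdfE ger0_norm// mulr_ge0// expR_ge0.
  rewrite ler_pdivlMr ?ltr0n// normrM normrX pE mulrAC -xE -exprSr mulrCA.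
  rewrite /C ler_wpM2l//; apply: le_trans (powR_normal_bound _ _) _.
  rewrite ler_piMr// ?addr_ge0// -expR0 ler_expR oppr_le0.
  by rewrite divr_ge0 ?sqr_ge0.
apply/cvgr0Pnorm_le => e e0.
have : (C * harmonic n) @[n --> \oo] --> C * 0 by apply: cvgMr; exact: cvg_harmonic.
rewrite mulr0 => /cvgr0Pnorm_le/(_ _ e0); apply: filterS => n.
apply: le_trans; rewrite [leRHS]ger0_norm ?bnd//.
by rewrite mulr_ge0// harmonic_ge0.
Qed.

(** The integrand is the derivative of x^k times the density, so its integral over [-n-1, n+1] is a
    difference of boundary terms that vanish in the limit. *)
Lemma integral_pow_normal_deriv k :
  (\int[mu]_x (k%:R * x ^+ k.-1 * pdf x - x ^+ k.+1 * pdf x)%:E = 0)%E.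
Proof.
set f := fun x : R => k%:R * x ^+ k.-1 * pdf x - x ^+ k.+1 * pdf x.
pose F := fun x : R => x ^+ k * pdf x.
have if_ : mu.-integrable setT (fun x => (f x)%:E).
  rewrite (_ : (fun x => (f x)%:E) =
    (fun x => k%:R%:E * (x ^+ k.-1 * pdf x)%:E - (x ^+ k.+1 * pdf x)%:E)%E).
    apply: integrableB => //; last exact: integrable_pow_normal_pdf.
    by apply: integrableZl => //; exact: integrable_pow_normal_pdf.
  by apply/funext => x; rewrite -EFinM -EFinB mulrA.
have cf : continuous f.
  move=> x; apply: cvgB; apply: cvgM; try exact: continuous_normal_pdf.
    by apply: cvgMr; exact: exprn_continuous.
  exact: exprn_continuous.
pose A n : set R := `[- 1 * n.+1%:R, 1 * n.+1%:R]%classic.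
have intA n : (\int[mu]_(x in A n) (f x)%:E =
               (F (1 * n.+1%:R))%:E - (F (- 1 * n.+1%:R))%:E)%E.
  apply: continuous_FTC2.
  - by rewrite mulN1r mul1r gtrN// ltr0n.
  - by apply: continuous_subspaceT => x; exact: cf.
  - have dF x : derivable F x 1 by have [] := is_derive_pow_normal_pdf k x.
    have cF x : F y @[y --> x] --> F x.
      by apply: differentiable_continuous; exact/derivable1_diffP.
    by split => //; [exact: cvg_at_right_filter|exact: cvg_at_left_filter].
  - by move=> x _; rewrite derive1E; have [] := is_derive_pow_normal_pdf k x.
have lim0 : (\int[mu]_(x in A n) (f x)%:E)%E @[n --> \oo] --> (0 : R)%:E.
  under eq_fun do rewrite intA -EFinB.
  apply: cvg_EFin; first exact: nearW.
  have n1 : `|- 1 : R| = 1 by rewrite normrN normr1.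
  have := cvgB (@cvg_pow_normal_pdf k 1 (normr1 _)) (@cvg_pow_normal_pdf k _ n1).
  by rewrite subr0; apply.
have /integrableP[mf _] := if_.
have mA n : measurable (A n) by exact: measurable_itv.
have [] := @dominated_convergence _ _ R mu setT measurableT
  (fun n => (fun x => (f x)%:E) \_ (A n)) (fun x => (f x)%:E)
  (fun x => `|(f x)%:E|%E).
- by move=> n; apply: (measurable_restrictT _ (mA n)).1; exact: measurable_funTS.
- exact: mf.
- apply: aeW => x _; apply: cvg_near_cst.
  near=> n; rewrite patchE ifT// inE /A/= in_itv/= mulN1r mul1r -ler_norml.
  near: n; exists (Num.truncn `|x|).+1 => // m /= xm.
  rewrite (le_trans (ltW (truncnS_gt _)))// ler_nat leqW//.
- exact: integrable_abse.
- apply: aeW => x n _; rewrite patchE; case: ifPn => // _.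
  by rewrite abse0 abse_ge0.
move=> _ _ h; apply: (cvg_unique _ _ lim0); first exact: ereal_hausdorff.
by rewrite (_ : (fun n => _) = (fun n => (\int[mu]_x ((EFin \o f) \_ (A n)) x)%E))//;
  apply/funext => n; rewrite integral_mkcond.
Unshelve. all: by end_near. Qed.

Lemma integral_pow_normal_prob k : (\int[N01]_x (x ^+ k)%:E = (gmom k)%:E)%E.
Proof.
have fin j : exists r : R, (\int[mu]_x (x ^+ j * pdf x)%:E = r%:E)%E.
  have := integrable_fin_num measurableT (integrable_pow_normal_pdf j).
  by move=> /fineK <-; eexists.
rewrite integral_normal_prob; last exact: exprn_measurable.
(* The recursion moves by two degrees, hence an induction on pairs of consecutive moments. *)
suff : (\int[mu]_x (x ^+ k * pdf x)%:E = (gmom k)%:E)%E /\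
       (\int[mu]_x (x ^+ k.+1 * pdf x)%:E = (gmom k.+1)%:E)%E by case.
have rec j : (\int[mu]_x (x ^+ j.+1 * pdf x)%:E =
    j%:R%:E * \int[mu]_x (x ^+ j.-1 * pdf x)%:E)%E.
  have := integral_pow_normal_deriv j.
  under eq_integral do rewrite EFinB.
  rewrite integralB_EFin//; last exact: integrable_pow_normal_pdf.
  - under eq_integral do rewrite -mulrA EFinM.
    rewrite integralZl//; last exact: integrable_pow_normal_pdf.
    have [a ->] := fin j.-1; have [b ->] := fin j.+1.
    by rewrite -EFinM -EFinB => -[/subr0_eq ->].
  - have := integrableZl measurableT j%:R (integrable_pow_normal_pdf j.-1).
    by apply: eq_integrable => // x _ /=; rewrite -EFinM mulrA.
elim: k => [|k [IH1 IH2]].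
  split; last by rewrite rec mul0e.
  by under eq_integral do rewrite expr0 mul1r; exact: integral_normal_pdf.
by split => //; rewrite rec IH1 -EFinM.
Qed.

End normal_moments.

(** * Joint moments of independent standard Gaussians *)

Section gauss_family.
Context {R : realType} {d : measure_display} {T : measurableType d}.
Variable P : probability T R.
Local Notation N01 := (@normal_prob R 0 1).

(** Beyond measurability, independence and normality are retained only through joint monomial
    moments. This form passes easily to product spaces and reindexed families, and is all that
    polynomial test functions see. *)
Definition gauss_family (I : finType) (X : I -> T -> R) : Prop :=
  (forall i, measurable_fun setT (X i)) /\
  forall a : I -> nat,
    P.-integrable setT (fun t => (\prod_i X i t ^+ a i)%:E) /\
    (\int[P]_t (\prod_i X i t ^+ a i)%:E = (\prod_i gmom (a i))%:E)%E.

Section independent.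
Variables (I : finType) (X : I -> T -> R).
Hypothesis indepX : mutually_independent P X.
Hypothesis gaussX : forall k, std_gaussian P (X k).

Let mX k : measurable_fun setT (X k). Proof. exact: indepX.1. Qed.

Let upd (phi : I -> R -> R) i f : I -> R -> R := fun j => if j == i then f else phi j.

Let prod_upd (G : I -> (R -> R) -> R) phi i f :
  \prod_j G j (upd phi i f j) = G i f * \prod_(j | j != i) G j (phi j).
Proof.
rewrite (bigD1 i)//= /upd eqxx; congr (_ * _).
by apply: eq_bigr => j /negbTE ->.
Qed.

Let nint (f : R -> R) : R := fine (\int[N01]_x (f x)%:E)%E.

Let nintE f : N01.-integrable setT (EFin \o f) ->
  (\int[N01]_x (f x)%:E)%E = (nint f)%:E.
Proof. by move=> fi; rewrite fineK//; exact: integrable_fin_num. Qed.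

Let integral_prod_ge0 (phi : I -> R -> R) :
  (forall i, measurable_fun setT (phi i)) ->
  (forall i x, 0 <= phi i x) ->
  (forall i, N01.-integrable setT (EFin \o phi i)) ->
  (\int[P]_t (\prod_i phi i (X i t))%:E = (\prod_i nint (phi i))%:E)%E.
Proof.
(* [s] lists the coordinates with a general factor, the others carry indicators: the base case is
   the definition of independence, and [ge0_integral_density] turns one indicator into a general
   factor. *)
suff H (s : seq I) (phi' : I -> R -> R) : (forall i, measurable_fun setT (phi' i)) ->
    (forall i x, 0 <= phi' i x) ->
    (forall i, N01.-integrable setT (EFin \o phi' i)) ->
    (forall i, i \notin s -> exists2 A : set R, measurable A & phi' i = \1_A) ->
    (\int[P]_t (\prod_i phi' i (X i t))%:E = (\prod_i nint (phi' i))%:E)%E.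
  move=> m0 p0 i0; apply: (H (enum I)) => // i; by rewrite mem_enum.
elim: s phi' => [|i s IH] phi0 m0 p0 i0 ind0.
  have /choice[A AP] : forall i, exists A : set R, measurable A /\ phi0 i = \1_A.
    by move=> i; have [A mA e] := ind0 i isT; exists A.
  have E t : \prod_i phi0 i (X i t) = \1_(\bigcap_(k in [set: I]) (X k @^-1` A k)) t.
    rewrite indicE; have [/set_mem h|/negP h] := boolP (t \in _).
      rewrite big1// => k _; rewrite (AP k).2 indicE mem_set//; exact: h.
    have [k kA] : exists k, ~ A k (X k t).
      apply/existsNP => h'; apply: h; apply/mem_set => k _; exact: h'.
    by rewrite (bigD1 k)//= (AP k).2 indicE memNset// mul0r.
  under eq_integral do rewrite E.
  rewrite integral_indic//=; last first.
    apply: fin_bigcap_measurable => //.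
    by move=> k _; rewrite -[_ @^-1` _]setTI; apply: mX => //; exact: (AP k).1.
  rewrite setIT indepX.2; last by move=> k; exact: (AP k).1.
  rewrite -prodEFin; apply: eq_bigr => k _.
  rewrite (gaussX k).2; last exact: (AP k).1.
  rewrite -nintE// (AP k).2 integral_indic ?setIT//.
  exact: (AP k).1.
have mP (phi1 : I -> R -> R) : (forall i, measurable_fun setT (phi1 i)) ->
   measurable_fun setT (fun t => \prod_(j | j != i) phi1 j (X j t)).
  move=> m1; rewrite (_ : (fun t => _) =
    fun t => \prod_j if j != i then phi1 j (X j t) else 1); last first.
    by apply/funext => t; exact: big_mkcond.
  apply: measurable_prod => j _; case: (j != i) => //.
  exact: (measurableT_comp (m1 j) (mX j)).
transitivity (\int[P]_t (phi0 i (X i t) * \prod_(j | j != i) phi0 j (X j t))%:E)%E.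
  by apply: eq_integral => t _; rewrite (bigD1 i).
rewrite (@ge0_integral_density _ _ _ _ _ P N01 (X i) _ (\prod_(j | j != i) nint (phi0 j)))//.
- by rewrite nintE// -EFinM mulrC [in RHS](bigD1 i).
- exact: mX.
- exact: mP.
- by move=> t; apply: prodr_ge0.
- by apply: prodr_ge0 => j _; apply: fine_ge0; apply: integral_ge0 => x _; rewrite lee_fin.
- move=> A mA.
  have iA : N01.-integrable setT (EFin \o (\1_A : R -> R)).
    exact: integrable_indic.
  transitivity (\int[P]_t (\prod_j upd phi0 i \1_A j (X j t))%:E)%E.
    by apply: eq_integral => t _; rewrite (prod_upd (fun j f => f (X j t))).
  rewrite IH.
  + rewrite (prod_upd (fun j f => nint f)) EFinM muleC; congr (_ * _)%E.
    by rewrite -nintE// integral_indic ?setIT.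
  + by move=> j; rewrite /upd; case: ifP.
  + by move=> j x; rewrite /upd; case: ifP.
  + by move=> j; rewrite /upd; case: ifP.
  + move=> j js; rewrite /upd; case: ifPn => [_|ji]; first by exists A.
    by apply: ind0; rewrite inE negb_or ji.
- exact: m0.
Qed.

Let integrable_prod (phi : I -> R -> R) :
  (forall i, measurable_fun setT (phi i)) ->
  (forall i, N01.-integrable setT (EFin \o phi i)) ->
  P.-integrable setT (fun t => (\prod_i phi i (X i t))%:E).
Proof.
move=> m0 i0; apply/integrableP; split.
  apply/measurable_EFinP; apply: measurable_prod => j _.
  exact: (measurableT_comp (m0 j) (mX j)).
under eq_integral do rewrite abse_EFin normr_prod.
rewrite (@integral_prod_ge0 (fun i x => `|phi i x|)) ?ltry//.
- by move=> i; exact: measurableT_comp.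
- by move=> i; have := integrable_abse (i0 i).
Qed.

Let integral_prod (phi : I -> R -> R) :
  (forall i, measurable_fun setT (phi i)) ->
  (forall i, N01.-integrable setT (EFin \o phi i)) ->
  (\int[P]_t (\prod_i phi i (X i t))%:E = (\prod_i nint (phi i))%:E)%E.
Proof.
(* Here [s] lists the coordinates whose factor may change sign; each factor is split into its
   positive and negative parts. *)
suff H (s : seq I) (phi' : I -> R -> R) : (forall i, measurable_fun setT (phi' i)) ->
    (forall i, N01.-integrable setT (EFin \o phi' i)) ->
    (forall i x, i \notin s -> 0 <= phi' i x) ->
    (\int[P]_t (\prod_i phi' i (X i t))%:E = (\prod_i nint (phi' i))%:E)%E.
  by move=> m0 i0; apply: (H (enum I)) => // i x; rewrite mem_enum.
elim: s phi' => [|i s IH] phi0 m0 i0 p0.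
  by apply: integral_prod_ge0 => // i x; exact: p0.
pose p x := Num.max (phi0 i x) 0; pose n x := Num.max (- phi0 i x) 0.
have pn x : phi0 i x = p x - n x.
  rewrite /p /n; case: (leP 0 (phi0 i x)) => h.
    by rewrite (max_idPr _) ?oppr_le0// subr0.
  by rewrite (max_idPl _) ?opprK ?add0r// oppr_ge0 ltW.
have mp : measurable_fun setT p by exact: measurable_maxr.
have mn : measurable_fun setT n.
  by apply: measurable_maxr => //; exact: measurableT_comp.
have le_int (f : R -> R) : measurable_fun setT f ->
    (forall x, `|f x| <= `|phi0 i x|) -> N01.-integrable setT (EFin \o f).
  move=> mf fle; apply: le_integrable (i0 i) => //; first exact/measurable_EFinP.
  by move=> x _; rewrite /= lee_fin.
have ip : N01.-integrable setT (EFin \o p).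
  apply: le_int => // x; rewrite /p; case: (leP 0 (phi0 i x)) => // _.
  by rewrite normr0.
have in_ : N01.-integrable setT (EFin \o n).
  apply: le_int => // x; rewrite /n; case: (leP 0 (- phi0 i x)) => _.
    by rewrite normrN.
  by rewrite normr0.
have updm f : measurable_fun setT f -> forall j, measurable_fun setT (upd phi0 i f j).
  by move=> mf j; rewrite /upd; case: ifP.
have updi f : N01.-integrable setT (EFin \o f) ->
   forall j, N01.-integrable setT (EFin \o upd phi0 i f j).
  by move=> if_ j; rewrite /upd; case: ifP.
have updp f : (forall x, 0 <= f x) -> forall j x, j \notin s -> 0 <= upd phi0 i f j x.
  move=> f0 j x js; rewrite /upd; case: ifPn => // ji.
  by apply: p0; rewrite inE negb_or ji.
have Hp := IH _ (updm _ mp) (updi _ ip) (updp p _).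
have Hn := IH _ (updm _ mn) (updi _ in_) (updp n _).
transitivity (\int[P]_t ((\prod_j upd phi0 i p j (X j t))%:E -
                        (\prod_j upd phi0 i n j (X j t))%:E))%E.
  apply: eq_integral => t _; rewrite -EFinB (bigD1 i)//= pn.
  by rewrite !(prod_upd (fun j f => f (X j t))) mulrBl.
rewrite integralB_EFin//; [|exact: integrable_prod (updm _ _) (updi _ _)..].
rewrite Hp ?Hn//; [|by move=> x; rewrite le_max lexx orbT..].
rewrite -EFinB !(prod_upd (fun j f => nint f)) -mulrBl [in RHS](bigD1 i)//=.
congr (EFin (_ * _)); apply: EFin_inj; rewrite EFinB -!nintE//.
rewrite -integralB_EFin//.
by apply: eq_integral => x _; rewrite pn EFinB.
Qed.

Lemma indep_gauss_family : gauss_family X.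
Proof.
split=> // a; pose phi i (x : R) := x ^+ a i.
have m0 i : measurable_fun setT (phi i) by exact: exprn_measurable.
have i0 i : N01.-integrable setT (EFin \o phi i) by exact: integrable_pow_normal_prob.
split; first exact: (integrable_prod m0 i0).
rewrite (integral_prod m0 i0); congr (_%:E); apply: eq_bigr => i _.
by rewrite /nint integral_pow_normal_prob.
Qed.
End independent.
End gauss_family.

(** * Auxiliary Gaussian families on product spaces *)

Section gauss_family_exists.
Context {R : realType}.
Local Notation N01 := (@normal_prob R 0 1).

Section product_probability.
Context d1 d2 (T1 : measurableType d1) (T2 : measurableType d2).
Variables (P1 : probability T1 R) (P2 : probability T2 R).

Definition product_prob : set (T1 * T2) -> \bar R := (P1 \x P2)%E.

HB.instance Definition _ := Measure.on product_prob.

Let product_prob_setT : product_prob setT = 1%E.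
Proof.
rewrite -setXTT; transitivity (P1 setT * P2 setT)%E; first exact: product_measure1E.
by rewrite !probability_setT mule1.
Qed.

HB.instance Definition _ :=
  Measure_isProbability.Build _ _ _ product_prob product_prob_setT.

Lemma product_prob_integralM (f : T1 -> R) (g : T2 -> R) (a b : R) :
  P1.-integrable setT (EFin \o f) -> P2.-integrable setT (EFin \o g) ->
  (\int[P1]_x (f x)%:E = a%:E)%E -> (\int[P2]_y (g y)%:E = b%:E)%E ->
  product_prob.-integrable setT (fun z => (f z.1 * g z.2)%:E) /\
  (\int[product_prob]_z (f z.1 * g z.2)%:E = (a * b)%:E)%E.
Proof.
move=> if_ ig fa gb.
have /integrableP[/measurable_EFinP mf _] := if_.
have /integrableP[/measurable_EFinP mg _] := ig.
have mfg : measurable_fun setT (fun z : T1 * T2 => (f z.1 * g z.2)%:E).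
  apply/measurable_EFinP/measurable_funM.
    exact: (measurableT_comp mf measurable_fst).
  exact: (measurableT_comp mg measurable_snd).
have ifg : product_prob.-integrable setT (fun z => (f z.1 * g z.2)%:E).
  apply/(integrable12ltyP P1 P2 mfg) => /=.
  have gfin : (\int[P2]_y `|g y|%:E)%E \is a fin_num.
    apply: integrable_fin_num => //.
    by have := integrable_abse ig.
  have ffin : (\int[P1]_x `|f x|%:E)%E \is a fin_num.
    apply: integrable_fin_num => //.
    by have := integrable_abse if_.
  have E x : (\int[P2]_y `|(f x * g y)%:E| = (fine (\int[P2]_y `|g y|%:E) * `|f x|)%:E)%E.
    transitivity (\int[P2]_y (`|f x|%:E * `|g y|%:E))%E.
      by apply: eq_integral => y _; rewrite abse_EFin normrM EFinM.
    rewrite ge0_integralZl//.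
      by rewrite -[in LHS](fineK gfin) -EFinM mulrC.
    by apply/measurable_EFinP; exact: measurableT_comp.
  rewrite (eq_integral _ _ (fun x _ => E x)).
  under eq_integral do rewrite EFinM.
  rewrite ge0_integralZl//.
  - by rewrite -(fineK ffin) -EFinM ltry.
  - by apply/measurable_EFinP; exact: measurableT_comp.
  - by rewrite fineK// integral_ge0.
split => //; rewrite -(integral12_prod_meas1 ifg) /fubini_F /=.
have E x : (\int[P2]_y (f x * g y)%:E = b%:E * (f x)%:E)%E.
  under eq_integral => y _ do rewrite EFinM.
  by rewrite integralZl// gb muleC.
rewrite (eq_integral _ _ (fun x _ => E x)).
by rewrite integralZl//= fa -EFinM mulrC.
Qed.
End product_probability.

Lemma gauss_family_reindex (I J : finType) d (T : measurableType d)
    (P : probability T R) (X : I -> T -> R) (h : J -> I) :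
  bijective h -> gauss_family P X -> gauss_family P (fun j => X (h j)).
Proof.
move=> [h' hK h'K] [mX mom]; split=> [j|a]; first exact: mX.
have hb : {on [pred j | true], bijective h}.
  by exists h' => *; rewrite ?hK ?h'K.
have E t : \prod_j X (h j) t ^+ a j = \prod_i X i t ^+ a (h' i).
  by rewrite (reindex h)//; apply: eq_bigr => j _; rewrite hK.
have [ia Ea] := mom (a \o h'); split.
  by apply: eq_integrable ia => // t _; rewrite /= E.
under eq_integral do rewrite E.
rewrite Ea [in LHS](reindex h)//; congr (_%:E).
by apply: eq_bigr => j _; rewrite /= hK.
Qed.

(** Provides Gaussian variables independent of the given randomness: they live on their own space
    and are combined with it by Fubini. *)
Lemma gauss_family_exists (I : finType) :
  exists (d : measure_display) (T : measurableType d) (P : probability T R)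
    (X : I -> T -> R), gauss_family P X.
Proof.
suff [d [T [P [X gX]]]] : exists (d : measure_display) (T : measurableType d)
    (P : probability T R) (X : 'I_#|I| -> T -> R), gauss_family P X.
  exists d, T, P, (fun i => X (enum_rank i)).
  apply: gauss_family_reindex => //; exact: enum_rank_bij.
elim: #|I| => [|n [d [T [P [X [mX mom]]]]]].
  (* An empty family has only the empty monomial, so any probability space serves. *)
  exists _, _, (normal_prob 0 1 : probability _ R), (fun _ _ => 0).
  split=> // a.
  split.
    have := finite_measure_integrable_cst N01 1 measurableT.
    apply: eq_integrable => //.
    by move=> t _; rewrite /= big_ord0.
  transitivity (\int[N01]_t (cst 1%:E t))%E.
    by apply: eq_integral => t _; rewrite big_ord0.
  by rewrite integral_cst// mul1e big_ord0; exact: probability_setT.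
exists _, _, (product_prob N01 P).
exists (fun i z => if unlift ord0 i is Some j then X j z.2 else z.1).
split=> [i|a].
  case: unlift => [j|]; last exact: measurable_fst.
  exact: (measurableT_comp (mX j) measurable_snd).
have E (z : R * T) : \prod_(i < n.+1) (if unlift ord0 i is Some j then X j z.2 else z.1) ^+ a i
   = z.1 ^+ a ord0 * \prod_(j < n) X j z.2 ^+ a (lift ord0 j).
  rewrite big_ord_recl unlift_none; congr (_ * _).
  by apply: eq_bigr => j _; rewrite liftK.
have [ia Ea] := mom (fun j => a (lift ord0 j)).
have [ip Ep] := product_prob_integralM (integrable_pow_normal_prob (a ord0)) ia
  (integral_pow_normal_prob (a ord0)) Ea.
split; first by apply: eq_integrable ip => // z _; rewrite E.
by under eq_integral do rewrite E; rewrite Ep big_ord_recl.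
Qed.
End gauss_family_exists.

(** * Gaussian integration by parts for polynomials *)

Section formal_derivatives.
Context {R : realType} {T : Type} {J : finType}.
Variables (h : J -> T -> R) (s : R).

(* [pd F DF]: [F] is a polynomial in the [h j] and [DF j] is [s] times its formal partial
   derivative in [h j]; the factor [s] is the variance of [h j]. *)
Inductive pd : (T -> R) -> (J -> T -> R) -> Prop :=
| pd_cst c : pd (fun=> c) (fun _ _ => 0)
| pd_gen j : pd (h j) (fun k _ => if k == j then s else 0)
| pd_add F DF G DG : pd F DF -> pd G DG ->
    pd (fun t => F t + G t) (fun j t => DF j t + DG j t)
| pd_mul F DF G DG : pd F DF -> pd G DG ->
    pd (fun t => F t * G t) (fun j t => DF j t * G t + F t * DG j t).

Definition polyf (F : T -> R) := exists D, pd F D.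

Lemma pd_eq F D F' D' : pd F D -> F =1 F' -> D =2 D' -> pd F' D'.
Proof.
by move=> pF /funext <- DD'; rewrite (_ : D' = D)//; apply/funext => j; apply/funext => t.
Qed.

Lemma pd_sum (K : Type) (r : seq K) (F : K -> T -> R) (D : K -> J -> T -> R) :
  (forall k, pd (F k) (D k)) ->
  pd (fun t => \sum_(k <- r) F k t) (fun j t => \sum_(k <- r) D k j t).
Proof.
move=> pF; elim: r => [|k r IH].
  by apply: (pd_eq (pd_cst 0)) => [t|j t]; rewrite big_nil.
by apply: (pd_eq (pd_add (pF k) IH)) => [t|j t]; rewrite big_cons.
Qed.

Lemma pd_scale c F D : pd F D -> pd (fun t => c * F t) (fun j t => c * D j t).
Proof.
by move=> pF; apply: (pd_eq (pd_mul (pd_cst c) pF)) => // j t; rewrite mul0r add0r.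
Qed.

Lemma pd_exp F D n : pd F D ->
  pd (fun t => F t ^+ n) (fun j t => n%:R * F t ^+ n.-1 * D j t).
Proof.
move=> pF; elim: n => [|n IH].
  by apply: (pd_eq (pd_cst 1)) => // j t; rewrite !mul0r.
apply: (pd_eq (pd_mul pF IH)) => [t|j t]; first by rewrite exprS.
case: n {IH} => [|n] /=; first by rewrite !mul0r !expr0 mulr0 addr0 !mul1r mulr1.
by rewrite exprS -[n.+2%:R]natr1; ring.
Qed.

Lemma polyf_cst c : polyf (fun=> c). Proof. by eexists; exact: pd_cst. Qed.
Lemma polyf_gen j : polyf (h j). Proof. by eexists; exact: pd_gen. Qed.
Lemma polyfD F G : polyf F -> polyf G -> polyf (fun t => F t + G t).
Proof. by move=> [? ?] [? ?]; eexists; apply: pd_add; eassumption. Qed.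
Lemma polyfM F G : polyf F -> polyf G -> polyf (fun t => F t * G t).
Proof. by move=> [? ?] [? ?]; eexists; apply: pd_mul; eassumption. Qed.
Lemma polyfZ c F : polyf F -> polyf (fun t => c * F t).
Proof. by move=> pF; apply: polyfM => //; exact: polyf_cst. Qed.
Lemma polyfX F n : polyf F -> polyf (fun t => F t ^+ n).
Proof. by move=> [D pF]; eexists; exact: pd_exp pF. Qed.
Lemma polyf_sum (K : Type) (r : seq K) (F : K -> T -> R) :
  (forall k, polyf (F k)) -> polyf (fun t => \sum_(k <- r) F k t).
Proof. by move=> /choice[D pF]; eexists; apply: pd_sum pF. Qed.
Lemma polyf_eq F G : polyf F -> F =1 G -> polyf G.
Proof. by move=> pF /funext <-. Qed.

Lemma polyf_pd F D j : pd F D -> polyf (D j).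
Proof.
elim=> [c|k|F1 D1 G1 E1 p1 q1 p2 q2|F1 D1 G1 E1 p1 q1 p2 q2].
- exact: polyf_cst.
- exact: polyf_cst.
- exact: polyfD.
- by apply: polyfD; apply: polyfM => //; eexists; eassumption.
Qed.

(** An expectation as seen by polynomials: linear, positive, and satisfying Gaussian integration by
    parts with variance [s]. The value at 1 is left free, so that weighting by a nonnegative
    polynomial can stay in the class; estimates are therefore relative to [L (fun=> 1)]. *)
Record stein_functional (L : (T -> R) -> R) : Prop := SteinFunctional {
  steinD : forall F G, polyf F -> polyf G -> L (fun t => F t + G t) = L F + L G;
  steinZ : forall c F, polyf F -> L (fun t => c * F t) = c * L F;
  stein_ge0 : forall F, polyf F -> (forall t, 0 <= F t) -> 0 <= L F;
  stein_ibp : forall F D j, pd F D -> L (fun t => h j t * F t) = L (D j) }.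

Section functional.
Variables (L : (T -> R) -> R) (sL : stein_functional L).

Lemma stein_sum (K : Type) (r : seq K) (F : K -> T -> R) :
  (forall k, polyf (F k)) ->
  L (fun t => \sum_(k <- r) F k t) = \sum_(k <- r) L (F k).
Proof.
move=> pF; elim: r => [|k r IH].
  transitivity (L (fun=> 0 * 0)).
    by congr (L _); apply/funext => t; rewrite big_nil mulr0.
  by rewrite (steinZ sL 0 (polyf_cst 0)) mul0r big_nil.
rewrite big_cons -IH -(steinD sL)//; last exact: polyf_sum.
by congr (L _); apply/funext => t; rewrite big_cons.
Qed.

Lemma stein_le F G : polyf F -> polyf G -> (forall t, F t <= G t) -> L F <= L G.
Proof.
move=> pF pG FG; rewrite -subr_ge0 -mulN1r -(steinZ sL)// -(steinD sL)//; last exact: polyfZ.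
apply: (stein_ge0 sL); first by apply: polyfD => //; exact: polyfZ.
by move=> t; rewrite mulN1r subr_ge0.
Qed.

Lemma stein_comb3 b c F G H : polyf F -> polyf G -> polyf H ->
  L (fun t => F t + b * G t + c * H t) = L F + b * L G + c * L H.
Proof.
move=> pF pG pH; rewrite (steinD sL) ?(steinD sL) ?(steinZ sL)//; try exact: polyfZ.
by apply: polyfD => //; exact: polyfZ.
Qed.

Lemma stein_lin (u : J -> R) F D : pd F D ->
  L (fun t => (\sum_j u j * h j t) * F t) = L (fun t => \sum_j u j * D j t).
Proof.
move=> pF; have pF' : polyf F by exists D.
rewrite stein_sum; last by move=> j; apply: polyfZ; exact: polyf_pd pF.
transitivity (L (fun t => \sum_j u j * (h j t * F t))).
  by congr (L _); apply/funext => t; rewrite mulr_suml; apply: eq_bigr => j _; rewrite mulrA.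
rewrite stein_sum; last first.
  by move=> j; apply: polyfZ; apply: polyfM => //; exact: polyf_gen.
apply: eq_bigr => j _; rewrite (steinZ sL _ (polyf_pd j pF)).
by rewrite (steinZ sL _ (polyfM (polyf_gen j) pF')) (stein_ibp sL j pF).
Qed.

End functional.
End formal_derivatives.

Section change_of_family.
Context {R : realType} {T : Type} {I J : finType}.
Variables (X : I -> T -> R) (h : J -> T -> R) (s : R).

(** Chain rule: a polynomial in [h] is one in [X], and its [h]-derivatives are obtained by applying
    [O] to its [X]-derivatives, the Gram condition supplying the factor [s]. The matrix [O] may be
    rectangular. *)
Lemma stein_functional_rotate (O : J -> I -> R) (L : (T -> R) -> R) :
  (forall j t, h j t = \sum_i O j i * X i t) ->
  (forall j k, \sum_i O j i * O k i = if j == k then s else 0) ->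
  stein_functional X 1 L -> stein_functional h s L.
Proof.
move=> hE OO sL.
have lift F D : pd h s F D -> exists2 D', pd X 1 F D' &
    forall j t, D j t = \sum_i O j i * D' i t.
  elim=> [c|k|F1 D1 G1 E1 p1 [D1' q1 e1] p2 [E1' q2 e2]
         |F1 D1 G1 E1 p1 [D1' q1 e1] p2 [E1' q2 e2]].
  - exists (fun _ _ => 0); first exact: pd_cst.
    by move=> j t; rewrite big1// => i _; rewrite mulr0.
  - exists (fun i _ => O k i).
      apply: (pd_eq (pd_sum (index_enum I) (fun i => pd_scale (O k i) (pd_gen X 1 i)))).
        by move=> t; rewrite hE.
      move=> i t; rewrite (bigD1 i)//= eqxx mulr1 big1 ?addr0// => i' i'i.
      by rewrite eq_sym (negbTE i'i) mulr0.
    by move=> j t; rewrite OO.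
  - exists (fun i t => D1' i t + E1' i t); first exact: pd_add.
    move=> j t; rewrite e1 e2 -big_split/=; apply: eq_bigr => i _.
    by rewrite mulrDr.
  - exists (fun i t => D1' i t * G1 t + F1 t * E1' i t); first exact: pd_mul.
    move=> j t; rewrite e1 e2 mulr_suml mulr_sumr -big_split/=.
    by apply: eq_bigr => i _; ring.
have plift F : polyf h s F -> polyf X 1 F.
  by move=> [D /lift[D' pD' _]]; exists D'.
split=> [F G /plift pF /plift pG|c F /plift pF|F /plift pF|F D j /lift[D' pF DE]].
- exact: (steinD sL).
- exact: (steinZ sL).
- exact: (stein_ge0 sL).
- transitivity (L (fun t => (\sum_i O j i * X i t) * F t)).
    by congr (L _); apply/funext => t; rewrite hE.
  by rewrite (stein_lin sL _ pF); congr (L _); apply/funext => t; rewrite DE.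
Qed.

(** By the product rule the weight [Q] enters integration by parts only through its own derivatives,
    which vanish in the selected variables. *)
Lemma stein_functional_weight (g : J -> I) (Q : T -> R) (DQ : I -> T -> R)
    (L : (T -> R) -> R) :
  injective g -> (forall j t, h j t = X (g j) t) ->
  pd X s Q DQ -> (forall j t, DQ (g j) t = 0) -> (forall t, 0 <= Q t) ->
  stein_functional X s L -> stein_functional h s (fun F => L (fun t => F t * Q t)).
Proof.
move=> ginj hE pQ DQ0 Q0 sL.
have lift F D : pd h s F D -> exists2 D', pd X s F D' &
    forall j t, D j t = D' (g j) t.
  elim=> [c|k|F1 D1 G1 E1 p1 [D1' q1 e1] p2 [E1' q2 e2]
         |F1 D1 G1 E1 p1 [D1' q1 e1] p2 [E1' q2 e2]].
  - by exists (fun _ _ => 0); first exact: pd_cst.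
  - exists (fun i _ => if i == g k then s else 0).
      by apply: (pd_eq (pd_gen X s (g k))) => // t; rewrite hE.
    by move=> j t; rewrite (inj_eq ginj).
  - exists (fun i t => D1' i t + E1' i t); first exact: pd_add.
    by move=> j t; rewrite e1 e2.
  - exists (fun i t => D1' i t * G1 t + F1 t * E1' i t); first exact: pd_mul.
    by move=> j t; rewrite e1 e2.
have pQ' : polyf X s Q by exists DQ.
have plift F : polyf h s F -> polyf X s F.
  by move=> [D /lift[D' pD' _]]; exists D'.
split=> [F G /plift pF /plift pG|c F /plift pF|F /plift pF F0|F D j /lift[D' pF DE]].
- rewrite -(steinD sL); [|exact: polyfM..].
  by congr (L _); apply/funext => t; rewrite mulrDl.
- rewrite -(steinZ sL); last exact: polyfM.
  by congr (L _); apply/funext => t; rewrite mulrA.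
- by apply: (stein_ge0 sL) => [|t]; [exact: polyfM|rewrite mulr_ge0].
- transitivity (L (fun t => X (g j) t * (F t * Q t))).
    by congr (L _); apply/funext => t; rewrite hE mulrA.
  rewrite (stein_ibp sL (g j) (pd_mul pF pQ)); congr (L _); apply/funext => t.
  by rewrite DQ0 mulr0 addr0 DE.
Qed.
End change_of_family.

Section gauss_stein.
Context {R : realType} {d : measure_display} {T : measurableType d}.
Variables (P : probability T R) (I : finType) (X : I -> T -> R).
Hypothesis gX : gauss_family P X.

Let mono (a : I -> nat) t := \prod_i X i t ^+ a i.
Let dmono (a : I -> nat) i t :=
  (a i)%:R * X i t ^+ (a i).-1 * \prod_(j | j != i) X j t ^+ a j.

Let monoD a b t : mono (fun i => a i + b i)%N t = mono a t * mono b t.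
Proof. by rewrite -big_split/=; apply: eq_bigr => i _; rewrite exprD. Qed.

Let dmonoD a b i t :
  dmono (fun i => a i + b i)%N i t = dmono a i t * mono b t + mono a t * dmono b i t.
Proof.
rewrite /dmono /mono !(bigD1 (P := xpredT) i)//=.
have -> : \prod_(j | j != i) X j t ^+ (a j + b j) =
    \prod_(j | j != i) X j t ^+ a j * \prod_(j | j != i) X j t ^+ b j.
  by rewrite -big_split/=; apply: eq_bigr => j _; rewrite exprD.
set A := \prod_(j | _) X j t ^+ a j; set B := \prod_(j | _) X j t ^+ b j.
case: (a i) => [|k]; case: (b i) => [|l] /=; rewrite ?expr0 ?mul0r ?add0r ?addr0.
- by rewrite mulr0.
- by rewrite add0n /=; ring.
- by rewrite !addn0 /=; ring.
- by rewrite natrD addnS !exprS exprD -!natr1; ring.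
Qed.

(** Expanding a function and its formal derivatives over the same list of monomials reduces
    integration by parts to a single monomial. *)
Let pd_mono F D : pd X 1 F D -> exists r : seq (R * (I -> nat)),
  (forall t, F t = \sum_(p <- r) p.1 * mono p.2 t) /\
  (forall i t, D i t = \sum_(p <- r) p.1 * dmono p.2 i t).
Proof.
elim=> [c|k|F1 D1 G1 E1 p1 [r1 [e1 f1]] p2 [r2 [e2 f2]]
       |F1 D1 G1 E1 p1 [r1 [e1 f1]] p2 [r2 [e2 f2]]].
- exists [:: (c, fun=> 0%N)]; split => [t|i t]; rewrite big_seq1 /=.
    by rewrite /mono big1 ?mulr1// => i _; rewrite expr0.
  by rewrite /dmono !mul0r mulr0.
- exists [:: (1, fun i => nat_of_bool (i == k))]; split => [t|i t]; rewrite big_seq1 mul1r /=.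
    rewrite /mono (bigD1 k)//= eqxx expr1 big1 ?mulr1// => i /negbTE ->.
    by rewrite expr0.
  rewrite /dmono; case: eqP => [->|_]; last by rewrite !mul0r.
  rewrite /= expr0 !mul1r big1// => j /negbTE jk.
  by rewrite jk expr0.
- exists (r1 ++ r2); split => [t|i t]; rewrite big_cat/=; first by rewrite e1 e2.
  by rewrite f1 f2.
- exists [seq (p.1 * q.1, (fun i => p.2 i + q.2 i)%N) | p <- r1, q <- r2].
  split => [t|i t]; rewrite big_allpairs_dep/=.
    rewrite e1 e2 mulr_suml; apply: eq_bigr => p _; rewrite mulr_sumr.
    by apply: eq_bigr => q _; rewrite monoD; ring.
  rewrite e1 e2 f1 f2 mulr_suml mulr_suml -big_split/=; apply: eq_bigr => p _.
  rewrite !mulr_sumr -big_split/=; apply: eq_bigr => q _.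
  by rewrite dmonoD; ring.
Qed.

Definition Ex (F : T -> R) : R := fine (\int[P]_t (F t)%:E)%E.

Let integrable_lin (K : Type) (r : seq K) (c : K -> R) (F : K -> T -> R) :
  (forall k, P.-integrable setT (EFin \o F k)) ->
  P.-integrable setT (EFin \o (fun t => \sum_(k <- r) c k * F k t)) /\
  (\int[P]_t (\sum_(k <- r) c k * F k t)%:E =
   (\sum_(k <- r) c k * Ex (F k))%:E)%E.
Proof.
move=> iF.
have iF' k : P.-integrable setT (fun t => (c k)%:E * (F k t)%:E)%E.
  exact: (integrableZl measurableT (c k) (iF k)).
have E t : (\sum_(k <- r) c k * F k t)%:E = (\sum_(k <- r) ((c k)%:E * (F k t)%:E))%E.
  by rewrite -sumEFin; apply: eq_bigr => k _; rewrite EFinM.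
split.
  have : P.-integrable setT (fun t => \sum_(k <- r) ((c k)%:E * (F k t)%:E))%E.
    by apply: integrable_sum => // k _; exact: iF'.
  by apply: eq_integrable => // t _; rewrite /= E.
under eq_integral do rewrite E.
rewrite integral_sum// -sumEFin; apply: eq_bigr => k _.
rewrite integralZl//; last exact: iF.
by rewrite EFinM fineK//; exact: integrable_fin_num (iF k).
Qed.

Let upd (a : I -> nat) i n j := if j == i then n else a j.

Let mono_upd a i n t : mono (upd a i n) t = X i t ^+ n * \prod_(j | j != i) X j t ^+ a j.
Proof.
rewrite /mono (bigD1 i)//= /upd eqxx; congr (_ * _).
by apply: eq_bigr => j /negbTE ->.
Qed.

Let integrable_mono a : P.-integrable setT (EFin \o mono a).
Proof. by have [] := gX.2 a. Qed.

Let Ex_mono a : Ex (mono a) = \prod_i gmom (a i).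
Proof. by rewrite /Ex (gX.2 a).2. Qed.

Let ExZ_mono c a : Ex (fun t => c * mono a t) = c * Ex (mono a).
Proof.
have [_ e] := @integrable_lin nat [:: 0%N] (fun=> c) (fun=> mono a) (fun=> integrable_mono a).
rewrite big_seq1 in e; transitivity
  (fine (\int[P]_t (\sum_(k <- [:: 0%N]) c * mono a t)%:E)%E); last by rewrite e.
by congr fine; apply: eq_integral => t _; rewrite big_seq1.
Qed.

Let dmonoE a i : dmono a i = (fun t => (a i)%:R * mono (upd a i (a i).-1) t).
Proof. by apply/funext => t; rewrite mono_upd mulrA. Qed.

Let integrable_dmono a i : P.-integrable setT (EFin \o dmono a i).
Proof.
have := integrableZl measurableT (a i)%:R (integrable_mono (upd a i (a i).-1)).
by apply: eq_integrable => // t _; rewrite /= dmonoE EFinM.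
Qed.

(** In the variable [i] this is the recursion [gmomS]; the other factors are the same on both
    sides. *)
Let Ex_dmono a i : Ex (fun t => X i t * mono a t) = Ex (dmono a i).
Proof.
have -> : (fun t => X i t * mono a t) = mono (upd a i (a i).+1).
  apply/funext => t; rewrite mono_upd exprS -mulrA; congr (_ * _).
  by rewrite /mono (bigD1 i).
rewrite dmonoE ExZ_mono !Ex_mono !(bigD1 (P := xpredT) i)//= /upd eqxx gmomS mulrA.
by congr (_ * _); apply: eq_bigr => j /negbTE ->.
Qed.

Lemma polyf_integrable F : polyf X 1 F -> P.-integrable setT (EFin \o F).
Proof.
move=> [D /pd_mono[r [FE _]]].
have [i _] := integrable_lin r fst (fun p => integrable_mono p.2).
by apply: eq_integrable i => // t _; rewrite /= FE.
Qed.

Lemma polyf_ExE F : polyf X 1 F -> (\int[P]_t (F t)%:E)%E = (Ex F)%:E.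
Proof.
move=> /polyf_integrable iF; rewrite fineK//; exact: integrable_fin_num.
Qed.

Lemma stein_functional_Ex : stein_functional X 1 Ex.
Proof.
split=> [F G pF pG|c F pF|F pF F0|F D i pF].
- apply: EFin_inj; rewrite EFinD -!polyf_ExE//; last exact: polyfD.
  by rewrite -integralD_EFin//; exact: polyf_integrable.
- apply: EFin_inj; rewrite EFinM -!polyf_ExE//; last exact: polyfZ.
  by rewrite -integralZl//; exact: polyf_integrable.
- by apply: fine_ge0; apply: integral_ge0 => t _; rewrite lee_fin.
- have [r [FE DE]] := pd_mono pF.
  have E1 : (\int[P]_t (X i t * F t)%:E =
      \int[P]_t (\sum_(p <- r) p.1 * (X i t * mono p.2 t))%:E)%E.
    apply: eq_integral => t _; rewrite FE mulr_sumr; congr (_%:E).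
    by apply: eq_bigr => p _; rewrite mulrCA.
  have iX (p : R * (I -> nat)) : P.-integrable setT (EFin \o (fun t => X i t * mono p.2 t)).
    have := integrable_mono (upd p.2 i (p.2 i).+1).
    apply: eq_integrable => // t _; rewrite /= mono_upd exprS -mulrA.
    by congr (EFin (_ * _)); rewrite /mono [RHS](bigD1 i).
  rewrite /Ex E1 (integrable_lin r fst iX).2.
  have E2 : (\int[P]_t (D i t)%:E = \int[P]_t (\sum_(p <- r) p.1 * dmono p.2 i t)%:E)%E.
    by apply: eq_integral => t _; rewrite DE.
  rewrite E2 (integrable_lin r fst (fun p => integrable_dmono p.2 i)).2.
  by congr fine; congr (_%:E); apply: eq_bigr => p _; rewrite Ex_dmono.
Qed.

Lemma Ex1 : Ex (fun=> 1) = 1.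
Proof.
rewrite /Ex (_ : (fun=> 1%:E) = cst 1%:E)// integral_cst// mul1e.
have e : P setT = 1%E by exact: probability_setT.
by transitivity (fine (P setT)) => //; rewrite e.
Qed.
End gauss_stein.

Lemma sum_cauchy_schwarz (R : realType) (I : finType) (a b : I -> R) :
  (\sum_i a i * b i) ^+ 2 <= (\sum_i a i ^+ 2) * (\sum_i b i ^+ 2).
Proof.
set A := \sum_i a i ^+ 2; set B := \sum_i b i ^+ 2; set S := \sum_i _.
have A0 : 0 <= A by apply: sumr_ge0 => i _; exact: sqr_ge0.
have q t : 0 <= A - 2 * t * S + t ^+ 2 * B.
  have -> : A - 2 * t * S + t ^+ 2 * B = \sum_i (a i - t * b i) ^+ 2.
    rewrite /A /B /S mulr_sumr mulr_sumr -sumrN -!big_split/=.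
    by apply: eq_bigr => i _; ring.
  by apply: sumr_ge0 => i _; exact: sqr_ge0.
have B0 : 0 <= B by apply: sumr_ge0 => i _; exact: sqr_ge0.
have [B00|BN0] := eqVneq B 0.
  have b0 i : b i = 0.
    apply/eqP; rewrite -sqrf_eq0; move/eqP: B00.
    by rewrite psumr_eq0 => [/allP/(_ i (mem_index_enum i))//|j _]; exact: sqr_ge0.
  by rewrite /S big1 ?expr0n/= ?mulr_ge0// => i _; rewrite b0 mulr0.
have Bp : 0 < B by rewrite lt_def BN0.
have := q (S / B); rewrite -(pmulr_lge0 _ Bp).
have -> : (A - 2 * (S / B) * S + (S / B) ^+ 2 * B) * B = A * B - S ^+ 2.
  by field.
by rewrite subr_ge0.
Qed.

(** * Exponential bounds for traceless quadratic forms *)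

Section quadratic_chaos.
Context {R : realType}.

(* An even quartic majorant of [expR (- `|z|)]: its mean only involves the second and fourth
   moments; 108 is the bound on the fourth moment of a normalized quadratic form. *)
Definition qf (z : R) : R := 1 - (z ^+ 2 - z ^+ 4 / 108) / 54.

(** Since exp(-t) <= 1/(1+t), it suffices that (1+t) qf(t) >= 1, which after removing a factor t
    reads (1+t)(t - t^3/108) <= 54; completing squares proves this for t >= 0. *)
Lemma expR_le_qf z : expR (- `|z|) <= qf z.
Proof.
have -> : qf z = qf `|z|.
  rewrite /qf -!normrX (ger0_norm (sqr_ge0 z)) ger0_norm//.
  by rewrite (exprM z 2 2) sqr_ge0.
have: 0 <= `|z| by []. move: `|z| => t t0.
apply: (@le_trans _ _ (1 + t)^-1).
  by rewrite expRN lef_pV2 ?posrE ?expR_gt0 ?expR_ge1Dx// ltr_wpDr.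
have t1 : 0 < 1 + t by lra.
rewrite -div1r ler_pdivrMr// /qf.
have h : (1 + t) * (t - t ^+ 3 / 108) <= 54.
  have e1 : 0 <= t ^+ 3 by rewrite exprn_ge0.
  have e2 := sqr_ge0 (t ^+ 2 - 60); have e3 := sqr_ge0 (t - 9 / 2).
  have -> : (1 + t) * (t - t ^+ 3 / 108) = 54 - (t ^+ 3 / 108 +
    (t ^+ 2 - 60) ^+ 2 / 108 + (t - 9 / 2) ^+ 2 / 9 + (54 - 3600 / 108 - 81 / 36)) by field.
  lra.
have := ler_wpM2l t0 h.
have -> : t * ((1 + t) * (t - t ^+ 3 / 108)) = (1 + t) * (t ^+ 2 - t ^+ 4 / 108).
  by field.
set Y := _ - _ => h'; have := t0; lra.
Qed.

Lemma qf_gt0 z : 0 < qf z.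
Proof. exact: lt_le_trans (expR_gt0 _) (expR_le_qf z). Qed.

Section moments.
Context {T : Type} {J : finType}.
Variables (h : J -> T -> R) (L : (T -> R) -> R).
Hypothesis sL : stein_functional h 1 L.
Variable A : J -> J -> R.
Hypothesis symA : forall j k, A j k = A k j.
Hypothesis trA : \sum_j A j j = 0.

(** [r] is A h, half the gradient of the form [Z]; [dot] is A A^T, the covariance of [r]; [s2] is
    the squared Frobenius norm of A. *)
Let r j t := \sum_k A j k * h k t.
Let Z t := \sum_j h j t * r j t.
Let rr t := \sum_j r j t ^+ 2.
Let s2 := \sum_j \sum_k A j k ^+ 2.
Let dot i j := \sum_k A i k * A j k.

Let pd_r j : pd h 1 (r j) (fun k _ => A j k).
Proof.
apply: (pd_eq (pd_sum (index_enum J) (fun k => pd_scale (A j k) (pd_gen h 1 k)))) => // k t.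
rewrite (bigD1 k)//= eqxx mulr1 big1 ?addr0// => i ik.
by rewrite eq_sym (negbTE ik) mulr0.
Qed.

Let pd_Z : pd h 1 Z (fun k t => 2 * r k t).
Proof.
apply: (pd_eq (pd_sum (index_enum J) (fun j => pd_mul (pd_gen h 1 j) (pd_r j)))) => // k t.
rewrite big_split/= mulr2n mulrDl mul1r; congr (_ + _).
  rewrite (bigD1 k)//= eqxx mul1r big1 ?addr0// => i ik.
  by rewrite eq_sym (negbTE ik) mul0r.
by apply: eq_bigr => j _; rewrite mulrC symA.
Qed.

Let pr j : polyf h 1 (r j). Proof. by eexists; exact: pd_r. Qed.
Let pZ : polyf h 1 Z. Proof. by eexists; exact: pd_Z. Qed.
Let prr : polyf h 1 rr. Proof. by apply: polyf_sum => j; exact: polyfX. Qed.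

Let L_r i F D : pd h 1 F D ->
  L (fun t => r i t * F t) = L (fun t => \sum_k A i k * D k t).
Proof. by move=> pF; rewrite -(stein_lin sL _ pF). Qed.

(** Integration by parts in the outer factor h_j of [Z]: the derivatives of the r_j contribute the
    trace of A, which vanishes. *)
Let L_Z F D : pd h 1 F D -> L (fun t => Z t * F t) = L (fun t => \sum_j r j t * D j t).
Proof.
move=> pF; have pF' : polyf h 1 F by exists D.
transitivity (L (fun t => \sum_j h j t * (r j t * F t))).
  by congr (L _); apply/funext => t; rewrite mulr_suml; apply: eq_bigr => j _; rewrite mulrA.
rewrite (stein_sum sL); last first.
  by move=> j; apply: polyfM; [exact: polyf_gen|exact: polyfM].
rewrite (stein_sum sL); last by move=> j; apply: polyfM => //; exact: polyf_pd pF.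
transitivity (\sum_j (A j j * L F + L (fun t => r j t * D j t))).
  apply: eq_bigr => j _; rewrite (stein_ibp sL j (pd_mul (pd_r j) pF)).
  rewrite (steinD sL); first by rewrite (steinZ sL).
  - exact: polyfZ.
  - by apply: polyfM => //; exact: polyf_pd pF.
by rewrite big_split/= -mulr_suml trA mul0r add0r.
Qed.

Let L_rr i j : L (fun t => r i t * r j t) = dot i j * L (fun=> 1).
Proof.
rewrite (L_r i (pd_r j)) -(steinZ sL); last exact: polyf_cst.
by congr (L _); apply/funext => t; rewrite mulr1.
Qed.

Let L_sumr : L rr = s2 * L (fun=> 1).
Proof.
rewrite (stein_sum sL) => [|j]; last exact: polyfX.
rewrite mulr_suml; apply: eq_bigr => j _.
have -> : (fun t => r j t ^+ 2) = (fun t => r j t * r j t) by apply/funext => t; rewrite expr2.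
by rewrite L_rr; congr (_ * _); apply: eq_bigr => k _; rewrite expr2.
Qed.

(** By Wick's formula the mean of r_i^2 r_j^2 is dot_ii dot_jj + 2 dot_ij^2, at most 3 dot_ii dot_jj
    by Cauchy-Schwarz, and the dot_ii sum to [s2]. *)
Let L_rr2 : L (fun t => rr t ^+ 2) <= 3 * s2 ^+ 2 * L (fun=> 1).
Proof.
have E i j : L (fun t => r i t ^+ 2 * r j t ^+ 2) =
    (dot i i * dot j j + 2 * dot i j ^+ 2) * L (fun=> 1).
  transitivity (L (fun t => r i t * (r i t * r j t ^+ 2))).
    by congr (L _); apply/funext => t; rewrite expr2 mulrA.
  rewrite (L_r i (pd_mul (pd_r i) (pd_exp 2 (pd_r j)))).
  transitivity (L (fun t => dot i i * (r j t * r j t) + 2 * dot i j * (r i t * r j t))).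
    congr (L _); apply/funext => t; rewrite /dot mulr_suml.
    rewrite [X in _ = _ + X * _]mulr_sumr [X in _ = _ + X]mulr_suml -big_split/=.
    by apply: eq_bigr => k _; rewrite expr1 expr2; ring.
  rewrite (steinD sL); [|by apply: polyfZ; exact: polyfM..].
  rewrite !(steinZ sL); [|exact: polyfM..].
  by rewrite !L_rr; ring.
have -> : L (fun t => rr t ^+ 2) =
    \sum_i \sum_j L (fun t => r i t ^+ 2 * r j t ^+ 2).
  transitivity (L (fun t => \sum_i \sum_j r i t ^+ 2 * r j t ^+ 2)).
    congr (L _); apply/funext => t; rewrite expr2 {1}/rr mulr_suml.
    by apply: eq_bigr => i _; rewrite mulr_sumr.
  have pij i j : polyf h 1 (fun t => r i t ^+ 2 * r j t ^+ 2).
    by apply: polyfM; exact: polyfX.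
  rewrite (stein_sum sL); last by move=> i; exact: polyf_sum.
  by apply: eq_bigr => i _; rewrite (stein_sum sL).
have L1 : 0 <= L (fun=> 1) by apply: (stein_ge0 sL) => //; exact: polyf_cst.
have -> : 3 * s2 ^+ 2 * L (fun=> 1) =
    \sum_i \sum_j 3 * (dot i i * dot j j) * L (fun=> 1).
  have s2E : s2 = \sum_i dot i i.
    by apply: eq_bigr => i _; apply: eq_bigr => k _; rewrite expr2.
  rewrite s2E expr2 mulr_suml mulr_sumr mulr_suml; apply: eq_bigr => i _.
  by rewrite mulr_sumr mulr_sumr mulr_suml.
apply: ler_sum => i _; apply: ler_sum => j _; rewrite E ler_wpM2r//.
have := sum_cauchy_schwarz (A i) (A j); rewrite -/(dot i j).
have -> : \sum_k A i k ^+ 2 = dot i i by apply: eq_bigr => k _; rewrite expr2.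
have -> : \sum_k A j k ^+ 2 = dot j j by apply: eq_bigr => k _; rewrite expr2.
by lra.
Qed.

Let L_Z2 : L (fun t => Z t ^+ 2) = 2 * s2 * L (fun=> 1).
Proof.
transitivity (L (fun t => Z t * Z t)); first by congr (L _); apply/funext => t; rewrite expr2.
rewrite (L_Z pd_Z) -mulrA -L_sumr -(steinZ sL)//; congr (L _); apply/funext => t.
by rewrite mulr_sumr; apply: eq_bigr => j _; ring.
Qed.

(** Integration by parts gives E Z^4 = 6 E(Z^2 rr). Expanding E(Z^2 - 6 rr)^2 >= 0 then yields E Z^4
    <= 36 E rr^2, and 36 times the 3 of [L_rr2] is 108. *)
Let L_Z4 : L (fun t => Z t ^+ 4) <= 108 * s2 ^+ 2 * L (fun=> 1).
Proof.
pose W t := Z t ^+ 2 * rr t.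
have pW : polyf h 1 W by apply: polyfM => //; exact: polyfX.
have E4 : L (fun t => Z t ^+ 4) = 6 * L W.
  transitivity (L (fun t => Z t * Z t ^+ 3)).
    by congr (L _); apply/funext => t; rewrite -exprS.
  rewrite (L_Z (pd_exp 3 pd_Z)) -(steinZ sL)//; congr (L _); apply/funext => t.
  by rewrite /W !mulr_sumr; apply: eq_bigr => j _ /=; ring.
have pZ4 : polyf h 1 (fun t => Z t ^+ 4) by exact: polyfX.
have prr2 : polyf h 1 (fun t => rr t ^+ 2) by exact: polyfX.
have : 0 <= L (fun t => (Z t ^+ 2 - 6 * rr t) ^+ 2).
  apply: (stein_ge0 sL) => [|t]; last exact: sqr_ge0.
  apply: polyfX; apply: (polyf_eq (polyfD (polyfX 2 pZ) (polyfZ (-6) prr))) => t.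
  by rewrite mulNr.
have -> : (fun t => (Z t ^+ 2 - 6 * rr t) ^+ 2) =
    (fun t => (Z t ^+ 4 + -12 * W t) + 36 * rr t ^+ 2).
  by apply/funext => t; rewrite /W; ring.
rewrite (stein_comb3 sL)//.
by have := L_rr2; lra.
Qed.

Lemma stein_quadratic_qf (sg : R) : 0 < sg -> sg ^+ 2 = s2 ->
  L (fun t => qf (Z t / sg)) <= (1 - 54^-1) * L (fun=> 1).
Proof.
move=> sg0 sgE.
have E : (fun t => qf (Z t / sg)) = (fun t => (1 + (- (54 * s2)^-1) * Z t ^+ 2) +
    (54 * 108 * s2 ^+ 2)^-1 * Z t ^+ 4).
  apply/funext => t; rewrite /qf -sgE; field.
  by rewrite gt_eqF.
have s20 : 0 < s2 by rewrite -sgE exprn_gt0.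
have p4 : polyf h 1 (fun t => Z t ^+ 4) by exact: polyfX.
rewrite E (stein_comb3 sL)//; [|exact: polyf_cst|exact: polyfX].
rewrite L_Z2; have := L_Z4; set l := L (fun=> 1); set l4 := L _ => Z4.
have -> : l + - (54 * s2)^-1 * (2 * s2 * l) = (1 - 2 / 54) * l.
  by field; rewrite gt_eqF.
have : (54 * 108 * s2 ^+ 2)^-1 * l4 <= 54^-1 * l.
  rewrite mulrC ler_pdivrMr; last by rewrite mulr_gt0 ?exprn_gt0// mulr_gt0// ltr0n.
  by rewrite [leRHS](_ : _ = 108 * s2 ^+ 2 * l); [exact: Z4|field].
by lra.
Qed.
End moments.

Section product.
Context {T : Type} {K J : finType}.
Variables (h : K * J -> T -> R) (L : (T -> R) -> R).
Hypothesis sL : stein_functional h 1 L.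
Variable A : J -> J -> R.
Hypothesis symA : forall j k, A j k = A k j.
Hypothesis trA : \sum_j A j j = 0.
Variable sg : R.
Hypothesis sg_gt0 : 0 < sg.
Hypothesis sgE : sg ^+ 2 = \sum_j \sum_k A j k ^+ 2.

Let Z k t := \sum_j h (k, j) t * \sum_l A j l * h (k, l) t.

(** A function of block [k] has formal derivatives vanishing in all other blocks; [local] is closed
    under the polynomial operations that build [qf]. *)
Let pd_Z k : exists2 D, pd h 1 (fun t => qf (Z k t / sg)) D &
  forall k' j t, k' != k -> D (k', j) t = 0.
Proof.
pose local (F : T -> R) := exists2 D, pd h 1 F D &
  forall k' j t, k' != k -> D (k', j) t = 0.
have lcst c : local (fun=> c) by exists (fun _ _ => 0) => //; exact: pd_cst.
have lgen j : local (h (k, j)).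
  exists (fun i _ => if i == (k, j) then 1 else 0); first exact: pd_gen.
  by move=> k' j' t kk'; rewrite xpair_eqE (negbTE kk').
have ladd F G : local F -> local G -> local (fun t => F t + G t).
  move=> [D pF F0] [E pG G0]; exists (fun j t => D j t + E j t); first exact: pd_add.
  by move=> k' j t kk'; rewrite F0// G0// addr0.
have lmul F G : local F -> local G -> local (fun t => F t * G t).
  move=> [D pF F0] [E pG G0]; exists (fun j t => D j t * G t + F t * E j t); first exact: pd_mul.
  by move=> k' j t kk'; rewrite F0// G0// mul0r mulr0 addr0.
have lsum (r : seq J) (F : J -> T -> R) : (forall j, local (F j)) ->
    local (fun t => \sum_(j <- r) F j t).
  move=> lF; elim: r => [|j r IH].
    by rewrite (_ : (fun t => _) = fun=> 0)//; apply/funext => t; rewrite big_nil.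
  rewrite (_ : (fun t => _) = fun t => F j t + \sum_(i <- r) F i t); first exact: ladd.
  by apply/funext => t; rewrite big_cons.
have lZ : local (fun t => Z k t / sg).
  apply: (lmul _ (fun=> sg^-1)) => //; apply: (lsum) => j; apply: (lmul (h (k, j))) => //.
  by apply: (lsum) => l; exact: (lmul (fun=> A j l)).
have lX n F : local F -> local (fun t => F t ^+ n).
  move=> lF; elim: n => [|n IH]; first exact: lcst.
  rewrite (_ : (fun t => _) = fun t => F t * F t ^+ n); first exact: lmul.
  by apply/funext => t; rewrite exprS.
apply: (ladd (fun=> 1)) => //.
rewrite (_ : (fun t => _) = fun t => -54^-1 * ((Z k t / sg) ^+ 2 + - 108^-1 * (Z k t / sg) ^+ 4)).
  apply: (lmul (fun=> -54^-1)) => //; apply: (ladd); first exact: lX.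
  by apply: (lmul (fun=> -108^-1)) => //; exact: lX.
by apply/funext => t; field; rewrite gt_eqF.
Qed.

Let pd_prod (r : seq K) :
  exists2 D, pd h 1 (fun t => \prod_(k <- r) qf (Z k t / sg)) D &
  forall k j t, k \notin r -> D (k, j) t = 0.
Proof.
elim: r => [|k r [D pD D0]].
  exists (fun _ _ => 0) => //; apply: (pd_eq (pd_cst h 1 1)) => // t.
  by rewrite big_nil.
have [E pE E0] := pd_Z k.
eexists; first apply: (pd_eq (pd_mul pE pD)) => [t|j t]; [by rewrite big_cons|reflexivity|].
move=> k' j t; rewrite inE negb_or => /andP[k'k k'r].
by rewrite E0// D0// mul0r mulr0 addr0.
Qed.

Lemma polyf_prod_qf (r : seq K) :
  polyf h 1 (fun t => \prod_(k <- r) qf (Z k t / sg)).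
Proof. by have [D pD _] := pd_prod r; exists D. Qed.

(* Weighting by the remaining factors leaves the Stein identity in the variables
   of one block intact, so the factors can be peeled off one at a time. *)
Lemma stein_prod_qf (r : seq K) : uniq r ->
  L (fun t => \prod_(k <- r) qf (Z k t / sg)) <= (1 - 54^-1) ^+ size r * L (fun=> 1).
Proof.
elim: r => [_|k r IH /= /andP[kr ur]].
  rewrite expr0 mul1r le_eqVlt; apply/orP; left; apply/eqP.
  by congr (L _); apply/funext => t; rewrite big_nil.
have [D pD D0] := pd_prod r.
have sQ := @stein_functional_weight R T _ _ h (fun j => h (k, j)) 1
   (fun j => (k, j)) _ D L _ _ pD _ _ sL.
have {}sQ : stein_functional (fun j => h (k, j)) 1
    (fun F => L (fun t => F t * \prod_(k <- r) qf (Z k t / sg))).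
  apply: sQ => //; first by move=> j j' [].
    by move=> j t; exact: D0.
  by move=> t; apply: prodr_ge0 => i _; exact/ltW/qf_gt0.
have := stein_quadratic_qf sQ symA trA sg_gt0 sgE.
have -> : (fun t => \prod_(i <- k :: r) qf (Z i t / sg)) =
    (fun t => qf (Z k t / sg) * \prod_(i <- r) qf (Z i t / sg)).
  by apply/funext => t; rewrite big_cons.
move=> /le_trans; apply; rewrite exprS -mulrA ler_wpM2l//; first by lra.
by rewrite (_ : (fun t => 1 * _) = (fun t => \prod_(i <- r) qf (Z i t / sg)));
  [exact: IH|apply/funext => t; rewrite mul1r].
Qed.
End product.

Section chi_moments.
Context {T : Type} {J : finType}.
Variables (h : J -> T -> R) (s : R) (L : (T -> R) -> R).
Hypothesis sL : stein_functional h s L.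

Lemma stein_gen_even j q :
  L (fun t => h j t ^+ (2 * q)) = (\prod_(i < q) ((2 * i + 1)%:R * s)) * L (fun=> 1).
Proof.
elim: q => [|q IH]; first by rewrite big_ord0 mul1r; congr (L _).
rewrite big_ord_recr/= mulrAC -IH mulrC -(steinZ sL); last first.
  by apply: polyfX; exact: polyf_gen.
transitivity (L (fun t => h j t * h j t ^+ (2 * q + 1))).
  by congr (L _); apply/funext => t; rewrite mulnS add2n addn1 exprS.
rewrite (stein_ibp sL j (pd_exp _ (pd_gen h s j))); congr (L _); apply/funext => t.
by rewrite eqxx addn1 /= mulrAC.
Qed.

(** Chi-square moments. When integration by parts is summed over j, each h_j contributes 1 and, by
    Euler's identity, the remaining power S^q contributes 2q in total, whence the factor (|J| + 2q)
    s. *)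
Lemma stein_sumsqr q :
  L (fun t => (\sum_j h j t ^+ 2) ^+ q) =
  (\prod_(i < q) ((#|J| + 2 * i)%:R * s)) * L (fun=> 1).
Proof.
pose S t := \sum_j h j t ^+ 2.
have pdS : pd h s S (fun j t => 2 * s * h j t).
  apply: (pd_eq (pd_sum (index_enum J) (fun j => pd_exp 2 (pd_gen h s j)))) => // j t.
  rewrite (bigD1 j)//= eqxx big1 ?addr0; first by rewrite expr1; ring.
  by move=> i ij; rewrite eq_sym (negbTE ij) mulr0.
have pS n : polyf h s (fun t => S t ^+ n) by apply: polyfX; eexists; exact: pdS.
elim: q => [|q IH]; first by rewrite big_ord0 mul1r; congr (L _).
rewrite big_ord_recr/= mulrAC -IH.
transitivity (L (fun t => \sum_j h j t * (h j t * S t ^+ q))).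
  congr (L _); apply/funext => t; rewrite exprS {1}/S mulr_suml.
  by apply: eq_bigr => j _; rewrite expr2 mulrA.
have pg j : polyf h s (h j) by exact: polyf_gen.
rewrite (stein_sum sL); last by move=> j; do 2 (apply: polyfM => //).
transitivity (\sum_j (s * L (fun t => S t ^+ q) +
    q%:R * (2 * s) * L (fun t => h j t ^+ 2 * S t ^+ q.-1))).
  apply: eq_bigr => j _.
  rewrite (stein_ibp sL j (pd_mul (pd_gen h s j) (pd_exp q pdS))).
  rewrite -!(steinZ sL)//; last by apply: polyfM => //; exact: polyfX.
  rewrite -(steinD sL); [|exact: polyfZ|by apply: polyfZ; apply: polyfM => //; exact: polyfX].
  by congr (L _); apply/funext => t; rewrite eqxx; ring.
rewrite big_split/= sumr_const -mulr_sumr -(stein_sum sL); last first.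
  by move=> j; apply: polyfM => //; exact: polyfX.
have -> : (fun t => \sum_k h k t ^+ 2 * S t ^+ q.-1) = (fun t => S t * S t ^+ q.-1).
  by apply/funext => t; rewrite -mulr_suml.
case: q {IH} => [|q] /=; first by rewrite !mul0r addr0 muln0 addn0 -mulr_natl; ring.
rewrite (_ : (fun t => S t * _) = (fun t => S t ^+ q.+1)); last first.
  by apply/funext => t; rewrite exprS.
by rewrite -mulr_natl natrD natrM; ring.
Qed.
End chi_moments.
End quadratic_chaos.

(** * Complex matrices *)

Section complex_matrices.
Context {R : realType}.
Local Notation C := R[i].
Implicit Types (x y z : C).

Lemma cReD x y : complex.Re (x + y) = complex.Re x + complex.Re y.
Proof. by case: x y => [a b] [c e]. Qed.
Lemma cImD x y : complex.Im (x + y) = complex.Im x + complex.Im y.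
Proof. by case: x y => [a b] [c e]. Qed.
Lemma cReN x : complex.Re (- x) = - complex.Re x. Proof. by case: x. Qed.
Lemma cImN x : complex.Im (- x) = - complex.Im x. Proof. by case: x. Qed.
Lemma cReM x y : complex.Re (x * y) =
  complex.Re x * complex.Re y - complex.Im x * complex.Im y.
Proof. by case: x y => [a b] [c e]. Qed.
Lemma cImM x y : complex.Im (x * y) =
  complex.Re x * complex.Im y + complex.Im x * complex.Re y.
Proof. by case: x y => [a b] [c e]. Qed.
Lemma cReJ x : complex.Re (conjc x) = complex.Re x. Proof. by case: x. Qed.
Lemma cImJ x : complex.Im (conjc x) = - complex.Im x. Proof. by case: x. Qed.
Lemma cReR (a : R) : complex.Re (a%:C)%C = a. Proof. by []. Qed.
Lemma cImR (a : R) : complex.Im (a%:C)%C = 0. Proof. by []. Qed.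

Lemma Re_sum (I : Type) (r : seq I) (P : pred I) (F : I -> C) :
  complex.Re (\sum_(i <- r | P i) F i) = \sum_(i <- r | P i) complex.Re (F i).
Proof. exact: (big_morph (@complex.Re R) cReD (erefl _)). Qed.
Lemma Im_sum (I : Type) (r : seq I) (P : pred I) (F : I -> C) :
  complex.Im (\sum_(i <- r | P i) F i) = \sum_(i <- r | P i) complex.Im (F i).
Proof. exact: (big_morph (@complex.Im R) cImD (erefl _)). Qed.

Lemma complex_eq x y : complex.Re x = complex.Re y -> complex.Im x = complex.Im y ->
  x = y.
Proof. by case: x y => [a b] [c e] /= -> ->. Qed.

Definition cn2 x : R := complex.Re x ^+ 2 + complex.Im x ^+ 2.

Lemma cn2_ge0 x : 0 <= cn2 x. Proof. by rewrite addr_ge0 ?sqr_ge0. Qed.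
Lemma cn2M x y : cn2 (x * y) = cn2 x * cn2 y.
Proof. by rewrite /cn2 cReM cImM; ring. Qed.
Lemma cn2J x : cn2 (conjc x) = cn2 x.
Proof. by rewrite /cn2 cReJ cImJ sqrrN. Qed.
Lemma cn2_R (a : R) : cn2 (a%:C)%C = a ^+ 2.
Proof. by rewrite /cn2 cReR cImR expr0n addr0. Qed.
Lemma cn2_eq0 x : cn2 x = 0 -> x = 0.
Proof.
move/eqP; rewrite paddr_eq0 ?sqr_ge0// !sqrf_eq0 => /andP[/eqP a /eqP b].
exact: complex_eq.
Qed.
Lemma mulJc x : conjc x * x = ((cn2 x)%:C)%C.
Proof. by apply: complex_eq; rewrite ?cReM ?cImM cReJ cImJ /= /cn2; ring. Qed.
Lemma normc_sqr x : Normc.normc x ^+ 2 = cn2 x.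
Proof. by case: x => a b; rewrite /Normc.normc sqr_sqrtr// addr_ge0 ?sqr_ge0. Qed.
Lemma Re_le_cn2 x : complex.Re x ^+ 2 <= cn2 x.
Proof. by rewrite lerDl sqr_ge0. Qed.

Lemma adjK p q (A : 'M[C]_(p, q)) : adj (adj A) = A.
Proof. by apply/matrixP => i j; rewrite !mxE conjcK. Qed.
Lemma adjM p q r (A : 'M[C]_(p, q)) (B : 'M[C]_(q, r)) : adj (A *m B) = adj B *m adj A.
Proof. by rewrite /adj map_mxM trmx_mul. Qed.
Lemma adjD p q (A B : 'M[C]_(p, q)) : adj (A + B) = adj A + adj B.
Proof. by rewrite /adj map_mxD linearD. Qed.
Lemma adjB p q (A B : 'M[C]_(p, q)) : adj (A - B) = adj A - adj B.
Proof. by rewrite /adj map_mxB linearB. Qed.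
Lemma adj1 p : adj (1%:M : 'M[C]_p) = 1%:M.
Proof. by rewrite /adj map_mx1 trmx1. Qed.
Lemma adjZR p q (a : R) (A : 'M[C]_(p, q)) : adj ((a%:C)%C *: A) = (a%:C)%C *: adj A.
Proof.
apply/matrixP => i j; rewrite !mxE.
by apply: complex_eq; rewrite ?cReJ ?cImJ ?cReM ?cImM ?cReJ ?cImJ cReR cImR; ring.
Qed.
Lemma adjE p q (A : 'M[C]_(p, q)) i j : adj A i j = conjc (A j i).
Proof. by rewrite !mxE. Qed.
Lemma adj_tens p q r s (A : 'M[C]_(p, q)) (B : 'M[C]_(r, s)) :
  adj (A *t B) = adj A *t adj B.
Proof. by rewrite /adj map_mxT trmx_tens. Qed.

(** Coordinates under C^r = R^(2r); [true] selects real parts, as in [complex_gaussian_vectors]. *)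
Definition crd r (v : 'cV[C]_r) (j : 'I_r * bool) : R :=
  if j.2 then complex.Re (v j.1 0) else complex.Im (v j.1 0).

Definition vn2 r (v : 'cV[C]_r) : R := \sum_a cn2 (v a 0).

Definition fn2 p q (A : 'M[C]_(p, q)) : R := \sum_i \sum_j cn2 (A i j).

Lemma sum_bool2 (r : nat) (F : 'I_r * bool -> R) :
  \sum_j F j = \sum_a (F (a, true) + F (a, false)).
Proof.
transitivity (\sum_(p : 'I_r * bool) F (p.1, p.2)); first by apply: eq_bigr => -[].
rewrite -(pair_bigA _ (fun a b => F (a, b)))/=; apply: eq_bigr => a _.
by rewrite big_bool.
Qed.

Lemma vn2_crd r (v : 'cV[C]_r) : vn2 v = \sum_j crd v j ^+ 2.
Proof. by rewrite sum_bool2. Qed.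
Lemma vn2_ge0 r (v : 'cV[C]_r) : 0 <= vn2 v.
Proof. by apply: sumr_ge0 => i _; exact: cn2_ge0. Qed.
Lemma fn2_ge0 p q (A : 'M[C]_(p, q)) : 0 <= fn2 A.
Proof. by apply: sumr_ge0 => i _; apply: sumr_ge0 => j _; exact: cn2_ge0. Qed.
Lemma vnorm_sqr r (v : 'cV[C]_r) : vnorm v ^+ 2 = vn2 v.
Proof.
rewrite /vnorm sqr_sqrtr; last by apply: sumr_ge0 => i _; exact: sqr_ge0.
by apply: eq_bigr => i _; rewrite normc_sqr.
Qed.
Lemma vnorm_ge0 r (v : 'cV[C]_r) : 0 <= vnorm v. Proof. exact: sqrtr_ge0. Qed.
Lemma fn2_tr p q (A : 'M[C]_(p, q)) : \tr (adj A *m A) = ((fn2 A)%:C)%C.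
Proof.
rewrite /mxtrace; under eq_bigr do rewrite mxE.
rewrite exchange_big/= /fn2 rmorph_sum/=; apply: eq_bigr => i _.
by rewrite rmorph_sum/=; apply: eq_bigr => j _; rewrite adjE mulJc.
Qed.
Lemma frob_sqr p q (A : 'M[C]_(p, q)) : frob A ^+ 2 = fn2 A.
Proof. by rewrite /frob fn2_tr/= sqr_sqrtr// fn2_ge0. Qed.
Lemma frob_ge0 p q (A : 'M[C]_(p, q)) : 0 <= frob A. Proof. exact: sqrtr_ge0. Qed.
Lemma fn2_adj p q (A : 'M[C]_(p, q)) : fn2 (adj A) = fn2 A.
Proof.
rewrite /fn2 exchange_big/=; apply: eq_bigr => i _; apply: eq_bigr => j _.
by rewrite adjE cn2J.
Qed.

Lemma adj_mul_vec r (u v : 'cV[C]_r) : (adj u *m v) 0 0 = \sum_a conjc (u a 0) * v a 0.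
Proof. by rewrite mxE; apply: eq_bigr => a _; rewrite adjE. Qed.
Lemma adj_mul_self r (v : 'cV[C]_r) : (adj v *m v) 0 0 = ((vn2 v)%:C)%C.
Proof. by rewrite adj_mul_vec rmorph_sum/=; apply: eq_bigr => a _; rewrite mulJc. Qed.

Lemma Re_dot r (u v : 'cV[C]_r) :
  complex.Re ((adj u *m v) 0 0) = \sum_j crd u j * crd v j.
Proof.
rewrite adj_mul_vec Re_sum sum_bool2; apply: eq_bigr => a _.
by rewrite cReM cReJ cImJ /crd/=; ring.
Qed.

(** Multiplying [u] by the scalar product c itself turns the product into the real number |c|^2, to
    which the real inequality applies without loss. *)
Lemma complex_cauchy_schwarz r (u v : 'cV[C]_r) :
  cn2 ((adj u *m v) 0 0) <= vn2 u * vn2 v.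
Proof.
set c := (adj u *m v) 0 0.
have [->|cN0] := eqVneq (cn2 c) 0; first by rewrite mulr_ge0 ?vn2_ge0.
have c0 : 0 < cn2 c by rewrite lt_def cN0 cn2_ge0.
have vc : vn2 (c *: u) = cn2 c * vn2 u.
  by rewrite /vn2 mulr_sumr; apply: eq_bigr => a _; rewrite mxE cn2M.
have e : complex.Re ((adj (c *: u) *m v) 0 0) = cn2 c.
  rewrite adj_mul_vec.
  have -> : \sum_a conjc ((c *: u) a 0) * v a 0 = conjc c * c.
    rewrite /c adj_mul_vec mulr_sumr; apply: eq_bigr => a _.
    by rewrite mxE rmorphM/= mulrA.
  by rewrite mulJc.
have := sum_cauchy_schwarz (crd (c *: u)) (crd v).
by rewrite -Re_dot e -!vn2_crd vc expr2 -mulrA ler_pM2l.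
Qed.

(** The real matrix of size 2r of the map z -> M z. It has twice the squared Frobenius norm of M,
    which is the origin of the normalization [Num.sqrt 2 * frob M]. *)
Definition qmx r (M : 'M[C]_r) (j l : 'I_r * bool) : R :=
  match j.2, l.2 with
  | true, false => - complex.Im (M j.1 l.1)
  | false, true => complex.Im (M j.1 l.1)
  | _, _ => complex.Re (M j.1 l.1)
  end.

Lemma qmxE r (M : 'M[C]_r) (z : 'cV[C]_r) :
  complex.Re ((adj z *m M *m z) 0 0) = \sum_j crd z j * \sum_l qmx M j l * crd z l.
Proof.
rewrite -mulmxA Re_dot; apply: eq_bigr => -[a b] _; congr (_ * _).
rewrite sum_bool2 /crd /=.
by case: b; rewrite mxE ?Re_sum ?Im_sum; apply: eq_bigr => c _;
  rewrite /qmx/= ?cReM ?cImM; ring.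
Qed.

Lemma qmx_sym r (M : 'M[C]_r) j l : adj M = M -> qmx M j l = qmx M l j.
Proof.
move=> hM; case: j l => [a b] [c e].
have E : M c a = conjc (M a c) by rewrite -adjE hM.
by case: b; case: e; rewrite /qmx/= E ?cReJ ?cImJ ?opprK.
Qed.

Lemma qmx_tr r (M : 'M[C]_r) : \tr M = 0 -> \sum_j qmx M j j = 0.
Proof.
move=> tM; rewrite sum_bool2 /qmx/=.
under eq_bigr do rewrite -mulr2n -mulr_natl.
by rewrite -mulr_sumr -Re_sum -/(\tr M) tM mulr0.
Qed.

Lemma qmx_fn2 r (M : 'M[C]_r) : \sum_j \sum_l qmx M j l ^+ 2 = 2 * fn2 M.
Proof.
rewrite sum_bool2 mulr_sumr; apply: eq_bigr => a _.
rewrite !sum_bool2 /qmx/= -big_split/= mulr_sumr; apply: eq_bigr => c _.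
by rewrite /cn2 sqrrN; ring.
Qed.

Lemma outcome_ketbra r (M : 'M[C]_r) (v : 'cV[C]_r) :
  outcome M (ketbra v) = complex.Re ((adj v *m M *m v) 0 0).
Proof.
rewrite /outcome /ketbra mulmxA mxtrace_mulC mulmxA; congr complex.Re.
by rewrite /mxtrace big_ord1.
Qed.

Lemma outcomeB r (A B E : 'M[C]_r) : outcome A E - outcome B E = outcome (A - B) E.
Proof. by rewrite /outcome mulmxBl raddfB/= cReD cReN. Qed.

Lemma outcomeZ r (a : R) (M E : 'M[C]_r) :
  outcome M ((a%:C)%C *: E) = a * outcome M E.
Proof. by rewrite /outcome -scalemxAr mxtraceZ cReM cReR cImR mul0r subr0. Qed.

Lemma tensmxBl p q (A B : 'M[C]_p) (E : 'M[C]_q) : A *t E - B *t E = (A - B) *t E.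
Proof. by apply/matrixP => i j; rewrite !mxE mulrBl. Qed.

Lemma tens_tr p q (A : 'M[C]_p) (B : 'M[C]_q) : \tr (A *t B) = \tr A * \tr B.
Proof.
rewrite /mxtrace mulr_sum; apply: eq_bigr => k _.
by rewrite mxE.
Qed.

Lemma fn2_tens p q (A : 'M[C]_p) (B : 'M[C]_q) : fn2 (A *t B) = fn2 A * fn2 B.
Proof.
apply: complexI; rewrite -fn2_tr adj_tens tensmx_mul tens_tr !fn2_tr.
by rewrite -rmorphM.
Qed.

Lemma fn2_ketbra r (v : 'cV[C]_r) : fn2 (ketbra v) = vn2 v ^+ 2.
Proof.
rewrite expr2 /fn2 /vn2 mulr_suml; apply: eq_bigr => i _.
rewrite mulr_sumr; apply: eq_bigr => j _.
by rewrite /ketbra mxE big_ord1 adjE cn2M cn2J.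
Qed.

Lemma adj_ketbra r (v : 'cV[C]_r) : adj (ketbra v) = ketbra v.
Proof. by rewrite /ketbra adjM adjK. Qed.

Lemma density_diff r (A B : 'M[C]_r) : density_matrix A -> density_matrix B ->
  adj (A - B) = A - B /\ \tr (A - B) = 0.
Proof. by move=> [hA _ tA] [hB _ tB]; rewrite adjB hA hB raddfB/= tA tB subrr. Qed.

Lemma fn2_eq0 p q (A : 'M[C]_(p, q)) : fn2 A = 0 -> A = 0.
Proof.
move=> A0; apply/matrixP => i j; rewrite mxE; apply: cn2_eq0; move/eqP: A0.
rewrite psumr_eq0 => [/allP/(_ i (mem_index_enum i))/=|k _]; last first.
  by apply: sumr_ge0 => l _; exact: cn2_ge0.
by rewrite psumr_eq0 => [/allP/(_ j (mem_index_enum j))/= /eqP|l _]; last exact: cn2_ge0.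
Qed.
End complex_matrices.

(** * Lower tail for quadratic forms in Gaussian columns *)

Section markov.
Context {R : realType} {d : measure_display} {T : measurableType d}.
Variable P : probability T R.

Lemma markov_set (F : T -> R) (A : set T) (c : R) :
  measurable_fun setT F -> (forall t, 0 <= F t) -> measurable A -> 0 <= c ->
  (forall t, A t -> c <= F t) ->
  (c%:E * P A <= \int[P]_t (F t)%:E)%E.
Proof.
move=> mF F0 mA c0 cF.
have -> : (c%:E * P A = \int[P]_t (c * \1_A t)%:E)%E.
  transitivity (\int[P]_t (c%:E * (\1_A t)%:E))%E.
    rewrite ge0_integralZl//; first by rewrite integral_indic// setIT.
    by apply/measurable_EFinP; exact: measurable_indic.
  by apply: eq_integral => t _; rewrite EFinM.
apply: ge0_le_integral => //.
- by move=> t _; rewrite lee_fin mulr_ge0.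
- by apply/measurable_EFinP/measurable_funM => //; exact: measurable_indic.
- exact/measurable_EFinP.
- move=> t _; rewrite lee_fin indicE; case: (boolP (t \in A)) => [/set_mem tA|_].
    by rewrite mulr1 cF.
  by rewrite mulr0.
Qed.

Lemma prob_setC_ge (A : set T) (e : R) : measurable A ->
  (P A <= e%:E)%E -> ((1 - e)%:E <= P (~` A))%E.
Proof.
move=> mA Pe; by rewrite probability_setC// EFinB leeB.
Qed.
End markov.

Section gaussian_columns.
Context {R : realType} {d : measure_display} {T : measurableType d}.
Variable P : probability T R.
Variables (N m : nat) (b : T -> 'I_m -> 'cV[R[i]]_N).
Hypothesis gb : complex_gaussian_vectors P b.

Let X (k : 'I_m * ('I_N * bool)) t := crd (b t k.1) k.2.

Lemma complex_gaussian_family : gauss_family P X.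
Proof.
case: gb => ind std; have := indep_gauss_family ind std.
pose g (k : 'I_m * ('I_N * bool)) := ((k.1, k.2.1), k.2.2).
move=> gX; apply: (gauss_family_reindex (h := g) _ gX).
by exists (fun k => (k.1.1, (k.1.2, k.2))) => [[k [a c]]|[[k a] c]].
Qed.

(** The product of the majorants has mean at most (1 - 1/54)^m <= exp(-m/54), while outside the
    event it is at least exp(-m/108); Markov's inequality leaves exp(-m/108). *)
Lemma gauss_quadratic_lower_tail (M : 'M[R[i]]_N) : adj M = M -> \tr M = 0 ->
  0 < frob M ->
  exists2 A : set T, measurable A &
    (forall t, A t -> m%:R / 108 * (Num.sqrt 2 * frob M) <
       \sum_k `|complex.Re ((adj (b t k) *m M *m b t k) 0 0)|) /\
    ((P (~` A)) <= (expR (- (m%:R / 108)))%:E)%E.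
Proof.
move=> hM tM fM.
have gX := complex_gaussian_family; have sL := stein_functional_Ex gX.
pose sg := Num.sqrt 2 * frob M.
have sg0 : 0 < sg by rewrite mulr_gt0// sqrtr_gt0.
have sgE : sg ^+ 2 = \sum_j \sum_k qmx M j k ^+ 2.
  by rewrite qmx_fn2 exprMn sqr_sqrtr// frob_sqr.
have sym j k : qmx M j k = qmx M k j by exact: qmx_sym.
pose Z k t := complex.Re ((adj (b t k) *m M *m b t k) 0 0).
have ZE k t : Z k t = \sum_j X (k, j) t * \sum_l qmx M j l * X (k, l) t.
  by rewrite /Z qmxE.
have pZ k : polyf X 1 (Z k).
  apply: (polyf_eq _ (fun t => esym (ZE k t))).
  apply: polyf_sum => j; apply: polyfM; first exact: polyf_gen.
  by apply: polyf_sum => l; apply: polyfZ; exact: polyf_gen.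
have mpoly F : polyf X 1 F -> measurable_fun setT F.
  by move=> /(polyf_integrable gX)/integrableP[/measurable_EFinP].
pose S t := \sum_k `|Z k t|.
have mS : measurable_fun setT S.
  apply: measurable_sum => k; apply: measurableT_comp => //; exact: mpoly.
pose Q t := \prod_(k <- enum 'I_m) qf (Z k t / sg).
have Qeq : Q = (fun t => \prod_(k <- enum 'I_m)
    qf ((\sum_j X (k, j) t * \sum_l qmx M j l * X (k, l) t) / sg)).
  by apply/funext => t; apply: eq_bigr => k _; rewrite ZE.
have pQ : polyf X 1 Q by rewrite Qeq; exact: polyf_prod_qf.
have Q0 t : 0 <= Q t by apply: prodr_ge0 => k _; exact/ltW/qf_gt0.
have EQ : Ex P Q <= (1 - 54^-1) ^+ m.
  have := stein_prod_qf sL sym (qmx_tr tM) sg0 sgE (enum_uniq 'I_m).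
  by rewrite -Qeq Ex1 mulr1 size_enum_ord.
pose A := [set t | m%:R / 108 * sg < S t].
have mA : measurable A.
  rewrite (_ : A = S @^-1` `]m%:R / 108 * sg, +oo[%classic).
    by rewrite -[_ @^-1` _]setTI; exact: mS.
  by apply/seteqP; split => t /=; rewrite in_itv/= andbT.
exists A => //; split => //.
have low t : (~` A) t -> expR (- (m%:R / 108)) <= Q t.
  move=> /= /negP; rewrite -leNgt => St.
  apply: (@le_trans _ _ (\prod_(k <- enum 'I_m) expR (- `|Z k t / sg|))).
    rewrite -expR_sum ler_expR sumrN lerN2 big_enum/=.
    under eq_bigr do rewrite normrM [X in _ * X]gtr0_norm ?invr_gt0//.
    by rewrite -mulr_suml ler_pdivrMr.
  by apply: ler_prod => k _; rewrite expR_ge0 expR_le_qf.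
have := markov_set P (mpoly _ pQ) Q0 (measurableC mA) (expR_ge0 _) low.
rewrite (polyf_ExE gX pQ).
set p := P _ => pE.
have pfin : p \is a fin_num by exact: fin_num_measure (measurableC mA).
rewrite -(fineK pfin) -EFinM lee_fin in pE; rewrite -(fineK pfin) lee_fin.
have {}pE := le_trans pE EQ.
have e1 : (1 - 54^-1) ^+ m <= expR (- (m%:R / 54)) :> R.
  rewrite -mulrN expRM_natl lerXn2r ?nnegrE ?expR_ge0//; first by lra.
  exact: expR_ge1Dx.
have {pE e1} := le_trans pE e1.
have -> : - (m%:R / 54) = - (m%:R / 108) + - (m%:R / 108) :> R by lra.
by rewrite expRD ler_pM2l// expR_gt0.
Qed.
End gaussian_columns.

(** * Operator norm of the Gaussian Gram matrix *)

Section double_factorial.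
Context {R : realType}.

(** The factors dominate those of m!, and m^m/m! is a term of the series of exp m. *)
Lemma prod_odd_ge m :
  (m%:R / expR 1) ^+ m <= \prod_(i < m) ((2 * i + 1)%:R : R).
Proof.
have fact_le : (m`!)%:R <= \prod_(i < m) ((2 * i + 1)%:R : R).
  elim: m => [|m IH]; first by rewrite big_ord0.
  rewrite big_ord_recr/= factS mulnC natrM ler_pM// ler_nat.
  by rewrite addn1 ltnS leq_pmull.
apply: le_trans fact_le; rewrite expr_div_n ler_pdivrMr ?exprn_gt0 ?expR_gt0//.
case: m => [|m]; first by rewrite !expr0 mulr1.
have := @expR_ge1Dxn R m.+1%:R m (ler0n _ _).
have -> : expR m.+1%:R = expR 1 ^+ m.+1 :> R by rewrite -expRM_natl mulr1.
move=> h.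
rewrite mulrC -ler_pdivrMr ?ltr0n ?fact_gt0//.
by apply: le_trans h; rewrite ler_wpDl.
Qed.

Lemma prod_even_le m : \prod_(i < m) ((m * 2 + 2 * i)%:R : R) <= (4 * m%:R) ^+ m.
Proof.
rewrite -[X in _ ^+ X](card_ord m) -prodr_const; apply: ler_prod => i _.
rewrite ler0n -natrM ler_nat; have := ltn_ord i; lia.
Qed.
End double_factorial.

Section gram_bound.
Context {R : realType}.

(** [v] or -i v, whose real scalar products with u are the real and imaginary parts of the complex
    one. The two are orthogonal of equal length, so |<u,v>|^2 is a sum of squares of two orthogonal
    real forms in u. *)
Definition rotJ N (c : bool) (v : 'cV[R[i]]_N) : 'cV[R[i]]_N :=
  if c then v else (0 -i* 1)%C *: v.

Lemma cn2_dot N (u v : 'cV[R[i]]_N) :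
  cn2 ((adj u *m v) 0 0) = \sum_(c : bool) (\sum_j crd u j * crd (rotJ c v) j) ^+ 2.
Proof.
rewrite big_bool -!Re_dot /rotJ /cn2; congr (_ + _ ^+ 2).
by rewrite -scalemxAr [in RHS]mxE cReM /= mul0r sub0r mulN1r opprK.
Qed.

Lemma rotJ_dot N (v : 'cV[R[i]]_N) c e :
  \sum_j crd (rotJ c v) j * crd (rotJ e v) j = if c == e then vn2 v else 0.
Proof.
have vv : vn2 v = \sum_j crd v j * crd v j.
  by rewrite vn2_crd; apply: eq_bigr => j _; rewrite expr2.
rewrite !sum_bool2 in vv *.
case: c e => [] [] /=; rewrite ?vv; [by []| | | ].
- by rewrite big1// => a _; rewrite /crd/= !mxE cReM cImM /=; ring.
- by rewrite big1// => a _; rewrite /crd/= !mxE cReM cImM /=; ring.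
- by apply: eq_bigr => a _; rewrite /crd/= !mxE cReM cImM /=; ring.
Qed.

Context {d : measure_display} {T : measurableType d}.
Variable P : probability T R.
Variables (N m : nat) (b : T -> 'I_m -> 'cV[R[i]]_N).
Hypothesis gb : complex_gaussian_vectors P b.
Hypothesis Nm : N = m.
Hypothesis m_gt0 : (0 < m)%N.
Variable eta : R.
Hypothesis eta_gt0 : 0 < eta.

Let X (k : 'I_m * ('I_N * bool)) t := crd (b t k.1) k.2.
Let tau t (w : 'cV[R[i]]_N) := \sum_k cn2 ((adj (b t k) *m w) 0 0).
(** Chosen so that (Lam m)(m/e) eta = 16 m^2, the comparison that concludes
    [gram_bound_of_second_family]. *)
Let Lam : R := 16 * expR 1 / eta.

Let tauE t w : tau t w =
  \sum_(p : 'I_m * bool) (\sum_j X (p.1, j) t * crd (rotJ p.2 w) j) ^+ 2.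
Proof.
rewrite sum_bool2; apply: eq_bigr => k _.
by rewrite cn2_dot big_bool.
Qed.

Let sX : stein_functional X 1 (Ex P).
Proof. exact: stein_functional_Ex (complex_gaussian_family gb). Qed.

(** The 2m real forms making up [tau] have Gram matrix [vn2 w] times the identity, so [tau] has the
    moments of [vn2 w] times a chi-square variable with 2m degrees of freedom. *)
Let Ex_tau w q : Ex P (fun t => tau t w ^+ q) =
  \prod_(i < q) ((m * 2 + 2 * i)%:R * vn2 w).
Proof.
pose h (p : 'I_m * bool) t := \sum_j X (p.1, j) t * crd (rotJ p.2 w) j.
pose O (p : 'I_m * bool) (k : 'I_m * ('I_N * bool)) : R :=
  if p.1 == k.1 then crd (rotJ p.2 w) k.2 else 0.
have sh : stein_functional h (vn2 w) (Ex P).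
  apply: (stein_functional_rotate (O := O) _ _ sX).
  - move=> [k c] t; rewrite /h /O /=.
    transitivity (\sum_(k' : 'I_m) \sum_j
        (if k == k' then crd (rotJ c w) j else 0) * X (k', j) t); last first.
      by rewrite pair_big/=; apply: eq_bigr => -[].
    rewrite [RHS](bigD1 k)//= eqxx [X in _ = _ + X]big1 ?addr0; last first.
      by move=> k' kk'; rewrite big1// => j _; rewrite eq_sym (negbTE kk') mul0r.
    by apply: eq_bigr => j _; rewrite mulrC.
  - move=> [k c] [l e]; rewrite /O /=.
    transitivity (\sum_(k' : 'I_m) \sum_j
        (if k == k' then crd (rotJ c w) j else 0) *
        (if l == k' then crd (rotJ e w) j else 0)).
      by rewrite pair_big/=; apply: eq_bigr => -[].
    rewrite (bigD1 k)//= eqxx [X in _ + X = _]big1 ?addr0; last first.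
      by move=> k' kk'; rewrite big1// => j _; rewrite eq_sym (negbTE kk') mul0r.
    rewrite xpair_eqE eq_sym; case: eqP => [_|_] /=; first exact: rotJ_dot.
    by rewrite big1// => j _; rewrite mulr0.
have := stein_sumsqr sh q; rewrite Ex1 mulr1 card_prod card_ord card_bool => <-.
by congr (Ex P _); apply/funext => t; rewrite tauE.
Qed.

Section second_family.
Context {d' : measure_display} {T' : measurableType d'}.
Variables (P' : probability T' R) (Y : 'I_N * bool -> T' -> R).
Hypothesis gY : gauss_family P' Y.

Let v w : 'cV[R[i]]_N := \col_a (Y (a, true) w +i* Y (a, false) w)%C.

Let crd_v w j : crd (v w) j = Y j w.
Proof. by case: j => a []; rewrite /crd/= mxE. Qed.

Let crd_rotJv c j : exists e k, forall w, crd (rotJ c (v w)) j = e * Y k w.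
Proof.
case: j c => a c [] /=.
  by exists 1, (a, c) => w; rewrite /rotJ crd_v mul1r.
case: c.
  by exists 1, (a, false) => w; rewrite /crd/= !mxE cReM /=; ring.
by exists (-1), (a, true) => w; rewrite /crd/= !mxE cImM /=; ring.
Qed.

Let polyf_tau t q : polyf Y 1 (fun w => tau t (v w) ^+ q).
Proof.
apply: polyfX; apply: (polyf_eq _ (fun w => esym (tauE t (v w)))).
apply: polyf_sum => p; apply: polyfX; apply: polyf_sum => j; apply: polyfZ.
have [e [k E]] := crd_rotJv p.2 j.
by apply: (polyf_eq (polyfZ e (@polyf_gen _ _ _ Y 1 k))) => w; rewrite E.
Qed.

Let avg q t := Ex P' (fun w => tau t (v w) ^+ q).

Let tau_ge0 t w : 0 <= tau t w.
Proof. by apply: sumr_ge0 => k _; exact: cn2_ge0. Qed.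

Let measurable_tau q :
  measurable_fun setT (fun z : T * T' => (tau z.1 (v z.2) ^+ q)%:E).
Proof.
apply/measurable_EFinP; apply: measurable_funX.
rewrite (_ : (fun z => _) = (fun z : T * T' => \sum_(p : 'I_m * bool)
   (\sum_j X (p.1, j) z.1 * crd (rotJ p.2 (v z.2)) j) ^+ 2)); last first.
  by apply/funext => z; rewrite tauE.
apply: measurable_sum => p; apply: measurable_funX; apply: measurable_sum => j.
apply: measurable_funM.
  apply: (measurableT_comp _ measurable_fst).
  exact: (complex_gaussian_family gb).1.
have [e [k E]] := crd_rotJv p.2 j.
rewrite (_ : (fun z : T * T' => _) = (fun z => e * Y k z.2)); last first.
  by apply/funext => z; rewrite E.
apply: measurable_funM => //; apply: (measurableT_comp _ measurable_snd).
exact: gY.1.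
Qed.

Let avgE q t : (\int[P']_w (tau t (v w) ^+ q)%:E = (avg q t)%:E)%E.
Proof. exact: (polyf_ExE gY). Qed.

Let measurable_avg q : measurable_fun setT (avg q).
Proof.
apply/measurable_EFinP.
rewrite (_ : EFin \o _ = fun t => (\int[P']_w (tau t (v w) ^+ q)%:E)%E); last first.
  by apply/funext => t; rewrite avgE.
apply: (measurable_fun_fubini_tonelli_F (fun z => (tau z.1 (v z.2) ^+ q)%:E)) => //.
by move=> z; rewrite lee_fin exprn_ge0.
Qed.

(** Integrated over the [b k] and then over the auxiliary vector, [tau] yields two chi-square
    moments; [N = m] makes them equal, hence the square. *)
Let integral_avg q : (\int[P]_t (avg q t)%:E =
  ((\prod_(i < q) (m * 2 + 2 * i)%:R) ^+ 2)%:E)%E.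
Proof.
under eq_integral do rewrite -avgE.
rewrite (fubini_tonelli (m1 := P) (m2 := P') (fun z => (tau z.1 (v z.2) ^+ q)%:E))//=; last first.
  by move=> z; rewrite lee_fin exprn_ge0.
have gX := complex_gaussian_family gb.
have inner w : (\int[P]_t (tau t (v w) ^+ q)%:E =
    ((\prod_(i < q) (m * 2 + 2 * i)%:R) * vn2 (v w) ^+ q)%:E)%E.
  rewrite (polyf_ExE gX); last first.
    apply: polyfX; apply: (polyf_eq _ (fun t => esym (tauE t (v w)))).
    apply: polyf_sum => p; apply: polyfX; apply: polyf_sum => j.
    apply: (polyf_eq (polyfZ (crd (rotJ p.2 (v w)) j) (@polyf_gen _ _ _ X 1 (p.1, j)))) => t.
    by rewrite mulrC.
  by rewrite Ex_tau big_split/= prodr_const card_ord.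
under eq_integral do rewrite inner.
have vE w : vn2 (v w) = \sum_j Y j w ^+ 2.
  by rewrite vn2_crd; apply: eq_bigr => j _; rewrite crd_v.
have pv : polyf Y 1 (fun w => vn2 (v w) ^+ q).
  apply: polyfX; apply: (polyf_eq _ (fun w => esym (vE w))).
  by apply: polyf_sum => j; apply: polyfX; exact: polyf_gen.
rewrite (polyf_ExE gY); last exact: polyfZ.
rewrite (steinZ (stein_functional_Ex gY))//.
have -> : (fun w => vn2 (v w) ^+ q) = (fun w => (\sum_j Y j w ^+ 2) ^+ q).
  by apply/funext => w; rewrite vE.
rewrite (stein_sumsqr (stein_functional_Ex gY)) Ex1 mulr1 card_prod card_ord card_bool Nm.
by under [X in (_ * X)%:E]eq_bigr do rewrite mulr1; rewrite -expr2.
Qed.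

(* The gaussian average over [v w] sees every direction [u]: projecting onto
   [\sum_k y_k b_k], with [y_k] the coordinates of [u], gives the lower bound. *)
Let tau_le_avg q t (u : 'cV[R[i]]_N) :
  tau t u ^+ q * \prod_(i < q) (2 * i + 1)%:R <= vn2 u ^+ q * avg q t.
Proof.
have [t0|tN0] := eqVneq (tau t u) 0.
  rewrite t0; case: q => [|q].
    by rewrite !expr0 big_ord0 !mul1r /avg Ex1.
  rewrite expr0n/= mul0r mulr_ge0 ?exprn_ge0 ?vn2_ge0//.
  apply: (stein_ge0 (stein_functional_Ex gY)) => // w.
  by rewrite exprn_ge0.
have tp : 0 < tau t u by rewrite lt_def tN0 tau_ge0.
pose y : 'cV[R[i]]_m := \col_k (adj (b t k) *m u) 0 0.
pose sv (z : 'cV[R[i]]_N) : 'cV[R[i]]_m := \col_k (adj (b t k) *m z) 0 0.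
pose g : 'cV[R[i]]_N := \sum_k y k 0 *: b t k.
have gE z : (adj g *m z) 0 0 = (adj y *m sv z) 0 0.
  rewrite !adj_mul_vec.
  have -> : \sum_a conjc (g a 0) * z a 0 =
      \sum_a \sum_k conjc (y k 0) * (conjc (b t k a 0) * z a 0).
    apply: eq_bigr => a _; rewrite /g summxE rmorph_sum mulr_suml.
    by apply: eq_bigr => k _; rewrite mxE rmorphM/= mulrA.
  rewrite exchange_big/=; apply: eq_bigr => k _.
  have -> : sv z k 0 = \sum_a conjc (b t k a 0) * z a 0 by rewrite mxE adj_mul_vec.
  by rewrite mulr_sumr.
have vy : vn2 y = tau t u by apply: eq_bigr => k _; rewrite mxE.
have vsv z : vn2 (sv z) = tau t z by apply: eq_bigr => k _; rewrite mxE.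
have tau2 : tau t u ^+ 2 <= vn2 g * vn2 u.
  have := complex_cauchy_schwarz g u.
  by rewrite gE (_ : sv u = y)// adj_mul_self vy cn2_R.
pose l w := \sum_j crd g j * Y j w.
have lE w : l w = complex.Re ((adj g *m v w) 0 0).
  by rewrite Re_dot; apply: eq_bigr => j _; rewrite crd_v.
have l2 w : l w ^+ 2 <= tau t u * tau t (v w).
  rewrite lE; apply: le_trans (Re_le_cn2 _) _; rewrite gE.
  by apply: le_trans (complex_cauchy_schwarz _ _) _; rewrite vy vsv.
have sl : stein_functional (fun _ : unit => l) (vn2 g) (Ex P').
  apply: (stein_functional_rotate (O := fun=> crd g) _ _ (stein_functional_Ex gY)) => //.
  by move=> [] []; rewrite eqxx vn2_crd; apply: eq_bigr => j _; rewrite expr2.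
have El := stein_gen_even sl tt q; rewrite Ex1 mulr1 big_split/= prodr_const card_ord in El.
have pl : polyf Y 1 l by apply: polyf_sum => j; apply: polyfZ; exact: polyf_gen.
(* The left side is the moment of order 2q of [l], a real linear form of variance [vn2 g]; [l2]
   bounds it from above. *)
have le1 : \prod_(i < q) (2 * i + 1)%:R * vn2 g ^+ q <= tau t u ^+ q * avg q t.
  rewrite -El /avg -(steinZ (stein_functional_Ex gY))//.
  apply: (stein_le (stein_functional_Ex gY)); [exact: polyfX|exact: polyfZ|].
  move=> w; rewrite exprM -exprMn lerXn2r ?nnegrE ?sqr_ge0//.
  by rewrite mulr_ge0.
rewrite -(ler_pM2l (exprn_gt0 q tp)) mulrA -exprD addnn -mul2n exprM.
apply: (@le_trans _ _ ((vn2 g * vn2 u) ^+ q * \prod_(i < q) (2 * i + 1)%:R)).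
  apply: ler_wpM2r; first by apply: prodr_ge0 => i _; rewrite ler0n.
  by rewrite lerXn2r ?nnegrE ?sqr_ge0 ?mulr_ge0 ?vn2_ge0.
have := ler_wpM2l (exprn_ge0 q (vn2_ge0 u)) le1.
rewrite exprMn [in leRHS]mulrCA => le2; apply: le_trans le2.
by rewrite le_eqVlt; apply/orP; left; apply/eqP; ring.
Qed.

Let thr : R := (Lam * m%:R) ^+ m * \prod_(i < m) (2 * i + 1)%:R.

Let Lam_gt0 : 0 < Lam.
Proof. by rewrite /Lam divr_gt0// mulr_gt0// expR_gt0. Qed.

Let prodo_gt0 : 0 < \prod_(i < m) (2 * i + 1)%:R :> R.
Proof. by apply: prodr_gt0 => i _; rewrite ltr0n addn1. Qed.

(** With moments of order q = m, the mean is at most (16 m^2)^m and the threshold at least (Lam m)^m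
    (m/e)^m, so Markov's inequality leaves a ratio of constants to the power m. The event bounds
    [avg], hence all directions [w] at once. *)
Lemma gram_bound_of_second_family : exists2 A : set T, measurable A &
  (forall t, A t -> forall w, tau t w <= Lam * m%:R * vn2 w) /\
  (P (~` A) <= (eta ^+ m)%:E)%E.
Proof.
have mp : 0 < m%:R :> R by rewrite ltr0n.
pose A := [set t | avg m t <= thr].
have mA : measurable A.
  rewrite (_ : A = avg m @^-1` `]-oo, thr]%classic).
    by rewrite -[_ @^-1` _]setTI; apply: (@measurable_avg m).
  by apply/seteqP; split => t; rewrite /A /= in_itv.
have avg_ge0 q t : 0 <= avg q t.
  by apply: (stein_ge0 (stein_functional_Ex gY)) => // w; rewrite exprn_ge0.
exists A => //; split.
  move=> t At w; have nn : 0 <= Lam * m%:R * vn2 w.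
    by rewrite mulr_ge0 ?vn2_ge0// mulr_ge0 ?(ltW Lam_gt0).
  rewrite -(ler_pXn2r m_gt0) ?nnegrE ?nn// -(ler_pM2r prodo_gt0).
  apply: le_trans (tau_le_avg _ _ _) _.
  by rewrite exprMn mulrAC mulrC ler_wpM2r ?exprn_ge0 ?vn2_ge0.
have thr0 : 0 < thr by rewrite mulr_gt0// exprn_gt0// mulr_gt0.
have low t : (~` A) t -> thr <= avg m t.
  by move=> /= /negP; rewrite -ltNge => /ltW.
have := markov_set P (@measurable_avg m) (avg_ge0 m) (measurableC mA) (ltW thr0) low.
rewrite integral_avg; set p := P _ => pE.
have pfin : p \is a fin_num by exact: fin_num_measure (measurableC mA).
rewrite -(fineK pfin) -EFinM lee_fin in pE; rewrite -(fineK pfin) lee_fin.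
rewrite -(ler_pM2l thr0); apply: le_trans pE _.
apply: (@le_trans _ _ (((4 * m%:R) ^+ m) ^+ 2)).
  rewrite lerXn2r ?nnegrE ?exprn_ge0 ?mulr_ge0// ?prod_even_le//.
  by apply: prodr_ge0 => i _; rewrite ler0n.
apply: (@le_trans _ _ ((Lam * m%:R) ^+ m * (m%:R / expR 1) ^+ m * eta ^+ m)).
  rewrite -exprM mulnC exprM -!exprMn le_eqVlt; apply/orP; left; apply/eqP.
  congr (_ ^+ m); rewrite /Lam; field.
  by rewrite !gt_eqF// expR_gt0.
have Lm : 0 < (Lam * m%:R) ^+ m by rewrite exprn_gt0// mulr_gt0.
by rewrite ler_pM2r ?exprn_gt0// /thr ler_pM2l// prod_odd_ge.
Qed.
End second_family.

Lemma gauss_gram_bound : exists2 A : set T, measurable A &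
  (forall t, A t -> forall w, \sum_k cn2 ((adj (b t k) *m w) 0 0) <=
     16 * expR 1 / eta * m%:R * vn2 w) /\
  (P (~` A) <= (eta ^+ m)%:E)%E.
Proof.
have [d' [T' [P' [Y gY]]]] := @gauss_family_exists R ('I_N * bool)%type.
exact: gram_bound_of_second_family gY.
Qed.
End gram_bound.

(** * The Gaussian POVM *)

Section gaussian_povm.
Context {R : realType}.
Local Notation C := R[i].

Lemma adj_comb_dot N m (b : 'I_m -> 'cV[C]_N) (y : 'cV[C]_m) (z : 'cV[C]_N) :
  (adj (\sum_k y k 0 *: b k) *m z) 0 0 =
  (adj y *m (\col_k (adj (b k) *m z) 0 0)) 0 0.
Proof.
rewrite !adj_mul_vec.
under eq_bigr => a _ do rewrite summxE rmorph_sum mulr_suml.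
rewrite exchange_big/=; apply: eq_bigr => k _.
rewrite [in RHS]mxE adj_mul_vec mulr_sumr; apply: eq_bigr => a _.
by rewrite !mxE rmorphM/= mulrA.
Qed.

Lemma gram_mul N m (b : 'I_m -> 'cV[C]_N) (u : 'cV[C]_N) :
  gram b *m u = \sum_k (\col_k (adj (b k) *m u) 0 0) k 0 *: b k.
Proof.
rewrite /gram mulmx_suml; apply: eq_bigr => k _; rewrite [in RHS]mxE.
rewrite /ketbra -mulmxA [X in _ *m X]mx11_scalar mul_mx_scalar.
by [].
Qed.

(** For g the image of u, [vn2 g] is the scalar product of the coefficient vectors [sv u] and
    [sv g], so its square is at most Lam^2 [vn2 g] by Cauchy-Schwarz. *)
Lemma gram_vnorm_le N m (b : 'I_m -> 'cV[C]_N) (Lam : R) (u : 'cV[C]_N) : 0 <= Lam ->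
  (forall w, \sum_k cn2 ((adj (b k) *m w) 0 0) <= Lam * vn2 w) ->
  vnorm u = 1 -> vnorm (gram b *m u) <= Lam.
Proof.
move=> Lam0 bnd u1.
have vu : vn2 u = 1 by rewrite -vnorm_sqr u1 expr1n.
pose sv (z : 'cV[C]_N) : 'cV[C]_m := \col_k (adj (b k) *m z) 0 0.
have vsv z : vn2 (sv z) <= Lam * vn2 z.
  by apply: le_trans (bnd z); apply: ler_sum => k _; rewrite mxE.
set g := gram b *m u.
have gE : g = \sum_k sv u k 0 *: b k by exact: gram_mul.
rewrite -(ler_pXn2r (ltn0Sn 1)) ?nnegrE ?vnorm_ge0// vnorm_sqr.
have [g0|gN0] := eqVneq (vn2 g) 0; first by rewrite g0 sqr_ge0.
have gp : 0 < vn2 g by rewrite lt_def gN0 vn2_ge0.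
rewrite -(ler_pM2r gp) -expr2 -cn2_R -adj_mul_self {1}gE adj_comb_dot.
apply: le_trans (complex_cauchy_schwarz _ _) _; rewrite -/(sv g) -/(sv u) expr2 -mulrA.
have := vsv u; rewrite vu mulr1 => h.
by apply: ler_pM; rewrite ?vn2_ge0.
Qed.

Lemma opnorm_gram_le N m (b : 'I_m -> 'cV[C]_N) (Lam : R) : 0 <= Lam ->
  (forall w, \sum_k cn2 ((adj (b k) *m w) 0 0) <= Lam * vn2 w) ->
  opnorm (gram b) <= Lam.
Proof.
move=> Lam0 bnd; rewrite /opnorm; set S := [set r : R | _].
(* For N = 0 there is no unit vector, and the supremum is 0 by convention. *)
have [->|/set0P S0] := eqVneq S set0; first by rewrite sup0.
apply: ge_sup => // r [u [u1 ->]]; exact: gram_vnorm_le.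
Qed.

(** Allows clearing the denominator [opnorm] in the final comparison. The normalized [b k] has a
    nonzero image, and [bnd] makes the set bounded, so that its supremum dominates the norm of that
    image. *)
Lemma opnorm_gram_gt0 N m (b : 'I_m -> 'cV[C]_N) (Lam : R) k : 0 <= Lam ->
  (forall w, \sum_k cn2 ((adj (b k) *m w) 0 0) <= Lam * vn2 w) ->
  b k != 0 -> 0 < opnorm (gram b).
Proof.
move=> Lam0 bnd bk.
have vb : 0 < vn2 (b k).
  rewrite lt_def vn2_ge0 andbT; apply: contra bk => /eqP v0; apply/eqP.
  apply/matrixP => i j; rewrite (ord1 j) mxE; apply: cn2_eq0.
  move/eqP: v0; rewrite psumr_eq0 => [/allP/(_ i (mem_index_enum i))/= /eqP//|l _].
  exact: cn2_ge0.
pose a := (Num.sqrt (vn2 (b k)))^-1.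
have a0 : 0 < a by rewrite invr_gt0 sqrtr_gt0.
pose u := (a%:C)%C *: b k.
have vu : vn2 u = 1.
  rewrite /vn2; under eq_bigr do rewrite mxE cn2M cn2_R.
  by rewrite -mulr_sumr -/(vn2 _) exprVn sqr_sqrtr ?vn2_ge0// mulVf// gt_eqF.
have u1 : vnorm u = 1.
  by apply/eqP; rewrite -(eqrXn2 (ltn0Sn 1)) ?vnorm_ge0// vnorm_sqr vu expr1n.
have gN0 : gram b *m u != 0.
  apply/eqP => g0.
  have : (adj u *m (gram b *m u)) 0 0 = 0 by rewrite g0 mulmx0 mxE.
  pose y : 'cV[C]_m := \col_k (adj (b k) *m u) 0 0.
  have -> : (adj u *m (gram b *m u)) 0 0 = conjc ((adj (gram b *m u) *m u) 0 0).
    by rewrite -adjE adjM adjK.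
  rewrite gram_mul adj_comb_dot -/y adj_mul_self => /(congr1 (@complex.Re R)).
  rewrite cReJ cReR => y0.
  have : cn2 (y k 0) = 0.
    apply/eqP; move/eqP: y0; rewrite psumr_eq0.
      by move=> /allP/(_ k (mem_index_enum k)).
    by move=> l _; exact: cn2_ge0.
  rewrite mxE /u -scalemxAr mxE adj_mul_self cn2M !cn2_R => /eqP.
  by rewrite mulf_eq0 !sqrf_eq0 !gt_eqF.
apply: (@lt_le_trans _ _ (vnorm (gram b *m u))).
  rewrite lt_def vnorm_ge0 andbT; apply: contra gN0 => /eqP v0.
  have : vn2 (gram b *m u) = 0 by rewrite -vnorm_sqr v0 expr0n.
  move=> v20; apply/eqP/matrixP => i j; rewrite (ord1 j) [RHS]mxE; apply: cn2_eq0.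
  move/eqP: v20; rewrite psumr_eq0 => [/allP/(_ i (mem_index_enum i))/= /eqP//|l _].
  exact: cn2_ge0.
apply: ub_le_sup; last by exists u.
by exists Lam => r [w [w1 ->]]; exact: gram_vnorm_le.
Qed.

Lemma sum_option_ge m (F : option 'I_m -> R) : (forall k, 0 <= F k) ->
  \sum_k F (Some k) <= \sum_k F k.
Proof.
move=> F0; rewrite [leRHS](bigD1 None)//= ler_wpDl//.
rewrite le_eqVlt; apply/orP; left; apply/eqP.
by rewrite [RHS](reindex_omap Some id)//= => [|[]//]; apply: eq_bigl => k; rewrite eqxx.
Qed.

(** In dimension at most 1 density matrices cannot differ. This gives K n >= 2, so that ln (K n) is
    at least ln 2. *)
Lemma density_dim_gt1 n (A B : 'M[C]_n) : density_matrix A -> density_matrix B ->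
  A <> B -> (1 < n)%N.
Proof.
case: n A B => [|[|n]] A B // [_ _ tA] [_ _ tB] AB.
  by move: tA; rewrite /mxtrace big_ord0 => /eqP; rewrite eq_sym oner_eq0.
case: AB; apply/matrixP => i j; rewrite !ord1.
by move: tA tB; rewrite /mxtrace !big_ord1 => -> ->.
Qed.

Lemma tens_ketbra_props n m (D : 'M[C]_n) (e0 : 'cV[C]_m) : adj D = D -> \tr D = 0 ->
  unit_vector e0 ->
  [/\ adj (D *t ketbra e0) = D *t ketbra e0, \tr (D *t ketbra e0) = 0 &
      frob (D *t ketbra e0) = frob D].
Proof.
move=> hD tD e1; split.
- by rewrite adj_tens hD adj_ketbra.
- by rewrite tens_tr tD mul0r.
- apply/eqP; rewrite -(eqrXn2 (ltn0Sn 1)) ?frob_ge0// !frob_sqr.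
  by rewrite fn2_tens fn2_ketbra -vnorm_sqr e1 !expr1n mulr1.
Qed.

Lemma frob_gt0 p q (A : 'M[C]_(p, q)) : A != 0 -> 0 < frob A.
Proof.
move=> A0; rewrite lt_def frob_ge0 andbT; apply: contra A0 => /eqP f0.
by apply/eqP/fn2_eq0; rewrite -frob_sqr f0 expr0n.
Qed.

(** The nonnegative term of the outcome [None] is dropped; the other outcomes differ by a quadratic
    form in [b k] divided by the operator norm. *)
Lemma gauss_povm_l1dist_ge n K m (b : 'I_m -> 'cV[C]_(n * K)) (e0 : 'cV[C]_K)
    (A B : 'M[C]_n) :
  (opnorm (gram b))^-1 *
     \sum_k `|complex.Re ((adj (b k) *m ((A - B) *t ketbra e0) *m b k) 0 0)|
  <= l1dist (gauss_povm b e0 A) (gauss_povm b e0 B).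
Proof.
rewrite /l1dist; set l := opnorm _.
have l0 : 0 <= l.
  rewrite /l /opnorm; set S := [set r : R | _].
  have [->|/set0P[r Sr]] := eqVneq S set0; first by rewrite sup0.
  (* An unbounded set has supremum 0 by convention. *)
  have [Sb|Sb] := pselect (has_ubound S).
    apply: le_trans (ub_le_sup Sb Sr); case: Sr => u [_ ->]; exact: vnorm_ge0.
  by rewrite sup_out// => -[_].
apply: le_trans (sum_option_ge (F := fun k => `|_ k - _ k|) _) => //.
rewrite mulr_sumr; apply: ler_sum => k _; rewrite /gauss_povm outcomeB tensmxBl /=.
rewrite -/l (_ : (l%:C)%C^-1 = (l^-1%:C)%C); last by rewrite -fmorphV.
by rewrite outcomeZ outcome_ketbra normrM [X in _ <= X * _]ger0_norm ?invr_ge0.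
Qed.

Lemma gaussian_povm_distinguishes : exists c1 c2 : R, 0 < c1 /\ 0 < c2 /\
  forall (n K : nat) (sigma1 sigma2 : 'M[R[i]]_n) (e0 : 'cV[R[i]]_K)
      (d : measure_display) (T : measurableType d) (P : probability T R)
      (b : T -> 'I_(K * n) -> 'cV[R[i]]_(n * K)),
    density_matrix sigma1 -> density_matrix sigma2 ->
    sigma1 <> sigma2 ->
    (1 <= K)%N ->
    unit_vector e0 ->
    complex_gaussian_vectors P b ->
    exists E : set T, [/\ measurable E,
      E `<=` [set t | c2 * frob (sigma1 - sigma2) / ln (K * n)%:R <
                      l1dist (gauss_povm (b t) e0 sigma1)
                             (gauss_povm (b t) e0 sigma2)]
      & ((1 - expR (- (c1 * (K * n)%:R)))%:E <= P E)%E].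
Proof.
(* With x = exp(-m/216), the two failure probabilities are at most x^2 and eta^m <= x/217. As x <=
   exp(-1/216) <= 216/217, their sum is at most x, whence the exponent 1/216. *)
pose eta : R := expR (- 216^-1) / 217.
have eta0 : 0 < eta by rewrite divr_gt0 ?expR_gt0.
pose Lam : R := 16 * expR 1 / eta.
have Lam0 : 0 < Lam by rewrite divr_gt0// mulr_gt0// expR_gt0.
pose c' : R := Num.sqrt 2 / 108 / Lam.
have s2 : 0 < Num.sqrt 2 :> R by rewrite sqrtr_gt0.
have c'0 : 0 < c' by rewrite !divr_gt0.
have ln2 : 0 < ln 2 :> R by rewrite ln_gt0// ltr1n.
(* The estimate obtained is by [c' * frob D]; since m >= 2, multiplying it by ln 2 / ln m <= 1 gives
   the stated form. *)
exists 216^-1, (c' * ln 2); split; first by rewrite invr_gt0.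
split; first by rewrite mulr_gt0.
move=> n K sigma1 sigma2 e0 d T P b ds1 ds2 s12 K1 e1 gb.
have n1 := density_dim_gt1 ds1 ds2 s12.
set m := (K * n)%N; have m2 : (2 <= m)%N by rewrite /m; nia.
have m0 : (0 < m)%N by exact: ltnW.
have [hD tD] := density_diff ds1 ds2.
set D := sigma1 - sigma2 in hD tD *.
have D0 : D != 0 by rewrite subr_eq0; exact/eqP.
have fD := frob_gt0 D0.
have [hM tM fM] := tens_ketbra_props hD tD e1.
have [A1 mA1 [A1P PA1]] := gauss_quadratic_lower_tail gb hM tM
  (ltac:(by rewrite fM) : 0 < frob (D *t ketbra e0)).
have [A2 mA2 [A2P PA2]] := gauss_gram_bound gb (mulnC _ _) m0 eta0.
exists (A1 `&` A2); split; first exact: measurableI.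
- move=> t [/A1P h1 /A2P h2] /=.
  apply: lt_le_trans (gauss_povm_l1dist_ge _ _ _ _).
  set S := \sum_k _ in h1 *; rewrite fM in h1.
  have mp : 0 < m%:R :> R by rewrite ltr0n.
  have S0 : 0 < S by apply: lt_trans h1; rewrite !mulr_gt0// divr_gt0.
  have [k bk] : exists k, b t k != 0.
    apply/existsP; apply: contraTT S0; rewrite negb_exists => /forallP b0.
    rewrite -leNgt /S big1// => k _; have := b0 k; rewrite negbK => /eqP ->.
    by rewrite mulmx0 mxE normr0.
  have Lm0 : 0 <= 16 * expR 1 / eta * m%:R by rewrite -/Lam mulr_ge0// ltW.
  have l0 := opnorm_gram_gt0 Lm0 h2 bk.
  have lL := opnorm_gram_le Lm0 h2.
  apply: (@le_lt_trans _ _ (c' * frob D)).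
    have lnm : ln 2 <= ln m%:R :> R by rewrite ler_ln ?posrE ?ltr0n// ler_nat.
    have lnq : ln 2 / ln m%:R <= 1 :> R.
      by rewrite ler_pdivrMr ?mul1r// (lt_le_trans ln2).
    have cf : 0 <= c' * frob D by rewrite mulr_ge0 ?ltW.
    have -> : c' * ln 2 * frob D / ln m%:R = c' * frob D * (ln 2 / ln m%:R).
      by rewrite [c' * ln 2 * _]mulrAC -!mulrA.
    exact: ler_piMr.
  rewrite [ltRHS]mulrC ltr_pdivlMr//; apply: le_lt_trans h1.
  apply: (@le_trans _ _ (c' * frob D * (Lam * m%:R))).
    by rewrite ler_wpM2l// mulr_ge0 ?(ltW fD) ?(ltW c'0).
  rewrite /c' le_eqVlt; apply/orP; left; apply/eqP; rewrite -/m; field.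
  by rewrite gt_eqF.
- rewrite -[A1 `&` A2]setCK; apply: prob_setC_ge; first exact/measurableC/measurableI.
  rewrite setCI; apply: le_trans (measureU2 _ (measurableC mA1) (measurableC mA2)) _.
  apply: le_trans (leeD PA1 PA2) _; rewrite -EFinD lee_fin.
  set x := expR (- (216^-1 * m%:R)).
  have x0 : 0 < x by exact: expR_gt0.
  have e1' : expR (- (m%:R / 108)) = x * x :> R by rewrite -expRD; congr expR; lra.
  have xle : x <= 216 / 217.
    have : x <= expR (- 216^-1) by rewrite ler_expR lerN2 ler_peMr ?invr_ge0// ler1n.
    move=> /le_trans; apply; rewrite expRN -[216 / 217]invf_div lef_pV2 ?posrE ?expR_gt0//.
    by apply: le_trans (expR_ge1Dx _); lra.
  have e2' : eta ^+ m <= x / 217.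
    rewrite /eta expr_div_n -expRM_natl mulrN [m%:R * _]mulrC -/x.
    rewrite ler_pM2l// lef_pV2 ?posrE ?exprn_gt0//.
    by rewrite ler_eXnr// ler1n.
  rewrite e1'; apply: le_trans (lerD (lexx _) e2') _.
  have : x * x <= x * (216 / 217) by rewrite ler_pM2l.
  by lra.
Qed.
End gaussian_povm.

(** * Spectral tools: density matrices, coisometries, polar decomposition *)

Section unitary_matrices.
Context {R : realType}.
Local Notation C := R[i].

Lemma conjC_conjc (x : C) : Num.conj x = conjc x.
Proof. by []. Qed.

Lemma map_conjC p q (A : 'M[C]_(p, q)) : map_mx Num.conj (A^T) = adj A.
Proof. by apply/matrixP => i j; rewrite !mxE conjC_conjc. Qed.

Lemma unitarymx_adj p q (A : 'M[C]_(p, q)) :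
  (A \is spectral.unitarymx) <-> A *m adj A = 1%:M.
Proof.
split; first by move/spectral.unitarymxP; rewrite map_conjC.
by move=> e; apply/spectral.unitarymxP; rewrite map_conjC.
Qed.

Lemma adj_sqrmx p (A : 'M[C]_p) : A *m adj A = 1%:M -> adj A *m A = 1%:M.
Proof. exact: mulmx1C. Qed.

Lemma hermitian_diagonalization p (S : 'M[C]_p) : adj S = S ->
  exists (V : 'M[C]_p) (e : 'I_p -> R), V *m adj V = 1%:M /\
    S = adj V *m diag_mx (\row_i ((e i)%:C)%C) *m V.
Proof.
move=> hS.
have hS' : S \is hermsymmx.
  apply/is_hermitianmxP; rewrite expr0 scale1r -{1}hS.
  by apply/matrixP => i j; rewrite !mxE conjC_conjc.
have := spectral.hermitian_normalmx hS' => /spectral.orthomx_spectralP SE.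
set V := spectral.spectralmx S in SE *.
have VV : V *m adj V = 1%:M by apply/unitarymx_adj; exact: spectral.spectral_unitarymx.
exists V, (fun i => complex.Re (spectral.spectral_diag S 0 i)); split => //.
have -> : adj V = invmx V.
  rewrite -map_conjC spectral.invmx_unitary//; exact: spectral.spectral_unitarymx.
rewrite {1}SE; congr (_ *m diag_mx _ *m _); apply/rowP => i; rewrite [RHS]mxE.
have /mxOverP/(_ 0 i) := spectral.hermitian_spectral_diag_real hS'.
by move=> /RRe_real ->.
Qed.

Lemma fn2_unitary p q (V : 'M[C]_p) (A : 'M[C]_(p, q)) :
  adj V *m V = 1%:M -> fn2 (V *m A) = fn2 A.
Proof.
move=> VV; apply: complexI; rewrite -!fn2_tr adjM -mulmxA (mulmxA (adj V)) VV mul1mx.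
by [].
Qed.

Lemma fn2_unitaryr p q s (V : 'M[C]_(q, s)) (A : 'M[C]_(p, q)) :
  V *m adj V = 1%:M -> fn2 (A *m V) = fn2 A.
Proof.
move=> VV; rewrite -fn2_adj -[RHS]fn2_adj; apply: complexI; rewrite -!fn2_tr !adjK adjM.
by rewrite -mulmxA (mulmxA V) VV mul1mx.
Qed.

Lemma fn2_diag p (e : 'I_p -> R) : fn2 (diag_mx (\row_i ((e i)%:C)%C)) = \sum_i e i ^+ 2.
Proof.
apply: eq_bigr => i _; rewrite (bigD1 i)//= !mxE eqxx mulr1n cn2_R big1 ?addr0// => j ji.
by rewrite !mxE eq_sym (negbTE ji) mulr0n /cn2 /= expr0n addr0.
Qed.

Lemma fn2_conj_diag p (V : 'M[C]_p) (e : 'I_p -> R) : V *m adj V = 1%:M ->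
  fn2 (adj V *m diag_mx (\row_i ((e i)%:C)%C) *m V) = \sum_i e i ^+ 2.
Proof.
move=> VV; rewrite fn2_unitaryr// fn2_unitary ?fn2_diag//.
by rewrite adjK.
Qed.

(** The eigenvalues are nonnegative with sum 1, so each is at most 1 and their squares sum to at
    most 1. *)
Lemma fn2_density p (S : 'M[C]_p) : density_matrix S -> fn2 S <= 1.
Proof.
move=> [hS pS tS]; have [V [e [VV SE]]] := hermitian_diagonalization hS.
have e0 i : 0 <= e i.
  have := pS (col i (adj V)).
  have -> : adj (col i (adj V)) *m S *m col i (adj V) =
      row i V *m S *m col i (adj V).
    congr (_ *m _ *m _); apply/matrixP => a b; rewrite !mxE conjcK//.
  rewrite -row_mul.
  have -> : (row i (V *m S) *m col i (adj V)) 0 0 = (V *m S *m adj V) i i.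
    by rewrite mxE [RHS]mxE; apply: eq_bigr => k _; congr (_ * _); rewrite mxE.
  rewrite SE !mulmxA VV mul1mx -mulmxA VV mulmx1 !mxE eqxx mulr1n.
  by rewrite ler0c.
rewrite SE fn2_conj_diag//.
have : \sum_i e i = 1.
  apply: complexI; transitivity (\tr S); last by rewrite tS.
  rewrite rmorph_sum/= SE mxtrace_mulC mulmxA VV mul1mx.
  by apply: eq_bigr => i _; rewrite !mxE eqxx mulr1n.
move=> e1; rewrite -[leRHS]e1; apply: ler_sum => i _.
rewrite expr2 ler_piMr// -e1 (bigD1 i)//= lerDl; exact: sumr_ge0.
Qed.

Lemma frob_density_diff p (A B : 'M[C]_p) : density_matrix A -> density_matrix B ->
  frob (A - B) ^+ 2 <= 4.
Proof.
move=> /fn2_density a1 /fn2_density b1; rewrite frob_sqr.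
have : fn2 (A - B) <= 2 * fn2 A + 2 * fn2 B.
  rewrite /fn2 !mulr_sumr -big_split/=; apply: ler_sum => i _.
  rewrite !mulr_sumr -big_split/=; apply: ler_sum => j _.
  rewrite !mxE /cn2 cReD cImD cReN cImN.
  set a := complex.Re _; set b := complex.Im _; set c := complex.Re _; set e := complex.Im _.
  have := sqr_ge0 (a + c); have := sqr_ge0 (b + e); nra.
by move=> /le_trans; apply; lra.
Qed.

(** The rows of [S] orthonormalize a basis of the left kernel of the adjoint of [J], which has
    dimension N - r. *)
Lemma coisometry_complement r N (J : 'M[C]_(r, N)) : J *m adj J = 1%:M ->
  exists2 S : 'M[C]_(N - r, N), S *m adj S = 1%:M & S *m adj J = 0.
Proof.
move=> JJ; pose K := kermx (adj J).
have rJ : \rank (adj J) = r.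
  rewrite /adj mxrank_tr mxrank_map; apply: spectral.mxrank_unitary.
  exact/unitarymx_adj.
have rK : \rank K = (N - r)%N by rewrite mxrank_ker rJ.
pose S := spectral.schmidt (row_base K).
have SS : S *m adj S = 1%:M.
  apply/unitarymx_adj; apply: spectral.schmidt_unitarymx; exact: rank_leq_col.
have SJ : S *m adj J = 0.
  apply/sub_kermxP; rewrite spectral.eqmx_schmidt_free ?row_base_free//.
  by rewrite eq_row_base.
by move: S SS SJ; rewrite rK => S SS SJ; exists S.
Qed.

(** The unitary group acts transitively on coisometries: complete [J] and [Q] to unitaries and
    compose one with the inverse of the other. Through this, left invariance of the law absorbs an
    arbitrary coisometry. *)
Lemma coisometry_extend r N (J Q : 'M[C]_(r, N)) :
  J *m adj J = 1%:M -> Q *m adj Q = 1%:M ->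
  exists2 V : 'M[C]_N, unitary V & J *m V = Q.
Proof.
move=> JJ QQ.
have rN : (r <= N)%N.
  rewrite -[r](spectral.mxrank_unitary (M := J)) ?rank_leq_col//.
  exact/unitarymx_adj.
have [S SS SJ] := coisometry_complement JJ.
have [S' SS' SQ] := coisometry_complement QQ.
have adj_col (A : 'M[C]_(r, N)) (B : 'M[C]_(N - r, N)) :
    adj (col_mx A B) = row_mx (adj A) (adj B).
  by rewrite /adj map_col_mx tr_col_mx.
have colE (A : 'M[C]_(r, N)) (B : 'M[C]_(N - r, N)) : A *m adj A = 1%:M ->
    B *m adj B = 1%:M -> B *m adj A = 0 -> col_mx A B *m adj (col_mx A B) = 1%:M.
  move=> AA BB BA; have AB : A *m adj B = 0.
    by rewrite -[LHS]adjK adjM adjK BA /adj map_mx0 trmx0.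
  by rewrite adj_col mul_col_row AA BB BA AB -scalar_mx_block.
(* The dimensions r + (N - r) and N agree only propositionally, so [A] is not square as a typed
   matrix. *)
have sq (A : 'M[C]_(r + (N - r), N)) : A *m adj A = 1%:M -> adj A *m A = 1%:M.
  move=> /unitarymx_adj uA; rewrite -map_conjC -[LHS]mul1mx mulmxA.
  by rewrite spectral.mulmxKtV// subnKC.
pose V := adj (col_mx J S) *m col_mx Q S'.
exists V; last first.
  rewrite /V mulmxA adj_col mul_mx_row JJ.
  have -> : J *m adj S = 0 by rewrite -[LHS]adjK adjM adjK SJ /adj map_mx0 trmx0.
  by rewrite mul_row_col mul1mx mul0mx addr0.
rewrite /unitary /V adjM adjK -mulmxA (mulmxA (col_mx J S)) colE// mul1mx.
by apply: sq; exact: colE.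
Qed.

(** Here 1 + H is the square root of B B^dagger. The eigenvalues 1 + e of B B^dagger are positive
    because e^2 < 1, and their roots s satisfy |s - 1| <= |s^2 - 1| since s + 1 >= 1, so H is no
    larger than the defect. *)
Lemma polar_near_coisometry r N (B : 'M[C]_(r, N)) : fn2 (B *m adj B - 1%:M) < 1 ->
  exists (H : 'M[C]_r) (Q : 'M[C]_(r, N)), [/\ adj H = H,
    fn2 H <= fn2 (B *m adj B - 1%:M), Q *m adj Q = 1%:M & B = (1%:M + H) *m Q].
Proof.
move=> small; set E := B *m adj B - 1%:M in small *.
have hE : adj E = E by rewrite /E adjB adjM adjK adj1.
have [V [e [VV EE]]] := hermitian_diagonalization hE.
have VV' := adj_sqrmx VV.
pose dg (a : 'I_r -> R) := adj V *m diag_mx (\row_i ((a i)%:C)%C) *m V.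
have dgM a a' : dg a *m dg a' = dg (fun i => a i * a' i).
  rewrite /dg !mulmxA -[_ *m V *m adj V]mulmxA VV mulmx1 -[adj V *m _ *m diag_mx _]mulmxA.
  congr (_ *m _ *m _); rewrite mulmx_diag; congr diag_mx; apply/rowP => i.
  by rewrite !mxE rmorphM.
have dg1 : dg (fun=> 1) = 1%:M.
  rewrite /dg (_ : diag_mx _ = 1%:M) ?mulmx1//.
  by apply/matrixP => i j; rewrite !mxE.
have dgB a a' : dg a - dg a' = dg (fun i => a i - a' i).
  rewrite /dg -mulmxBl -mulmxBr; congr (_ *m _ *m _).
  by apply/matrixP => i j; rewrite !mxE -mulrnBl -rmorphB.
have dgD a a' : dg a + dg a' = dg (fun i => a i + a' i).
  rewrite /dg -mulmxDl -mulmxDr; congr (_ *m _ *m _).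
  by apply/matrixP => i j; rewrite !mxE -mulrnDl -rmorphD.
have dgJ a : adj (dg a) = dg a.
  rewrite /dg !adjM adjK mulmxA; congr (_ *m _ *m _).
  apply/matrixP => i j; rewrite !mxE eq_sym; case: eqP => [->|_].
    by rewrite !mulr1n conjc_real.
  by rewrite !mulr0n conjc0.
have Edg : E = dg e by [].
have e1 i : 0 < 1 + e i.
  have : e i ^+ 2 < 1.
    apply: le_lt_trans small; rewrite Edg fn2_conj_diag// (bigD1 i)//= lerDl.
    by apply: sumr_ge0 => j _; exact: sqr_ge0.
  move=> e2; rewrite ltNge; apply/negP => e3.
  have : 0 <= (- 1 - e i) * (1 - e i) by apply: mulr_ge0; lra.
  have -> : (- 1 - e i) * (1 - e i) = e i ^+ 2 - 1 by ring.
  by move=> ?; lra.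
pose s i := Num.sqrt (1 + e i).
have s0 i : 0 < s i by rewrite sqrtr_gt0.
have ss i : s i * s i = 1 + e i by rewrite -expr2 sqr_sqrtr// ltW.
pose H := dg (fun i => s i - 1).
pose Q := dg (fun i => (s i)^-1) *m B.
have AE : 1%:M + H = dg s.
  by rewrite -dg1 dgD; congr dg; apply/funext => i; rewrite addrC subrK.
exists H, Q; split.
- exact: dgJ.
- rewrite Edg /H !fn2_conj_diag//; apply: ler_sum => i _.
  have -> : e i = (s i - 1) * (s i + 1) by rewrite mulrDr mulrBl mulr1 ss; ring.
  rewrite exprMn ler_peMr ?sqr_ge0//; have := s0 i; nra.
- rewrite /Q adjM dgJ -mulmxA (mulmxA B).
  have -> : B *m adj B = dg (fun i => s i * s i).
    rewrite -[LHS](subrK 1%:M) -/E Edg -dg1 dgD; congr dg; apply/funext => i.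
    by rewrite ss addrC.
  rewrite !dgM -dg1; congr dg; apply/funext => i; field.
  by rewrite gt_eqF.
- rewrite AE /Q mulmxA dgM -[LHS]mul1mx; congr (_ *m _).
  by rewrite -dg1; congr dg; apply/funext => i; rewrite divff// gt_eqF.
Qed.

Lemma fn2M_le p q s (A : 'M[C]_(p, q)) (B : 'M[C]_(q, s)) :
  fn2 (A *m B) <= fn2 A * fn2 B.
Proof.
have -> : fn2 A * fn2 B = \sum_i \sum_j vn2 (adj (row i A)) * vn2 (col j B).
  rewrite /fn2 [X in _ * X]exchange_big/= mulr_suml; apply: eq_bigr => i _.
  rewrite mulr_sumr; apply: eq_bigr => j _; congr (_ * _).
    by apply: eq_bigr => k _; rewrite adjE cn2J mxE.
  by apply: eq_bigr => k _; rewrite mxE.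
apply: ler_sum => i _; apply: ler_sum => j _.
apply: le_trans (complex_cauchy_schwarz _ _); rewrite adjK.
rewrite (_ : (A *m B) i j = (row i A *m col j B) 0 0)//.
by rewrite mxE [RHS]mxE; apply: eq_bigr => k _; rewrite !mxE.
Qed.

End unitary_matrices.

(** * Stability of the outcome sum under a small Hermitian perturbation *)

Section perturbation.
Context {R : realType}.
Local Notation C := R[i].

Lemma Re_sesqui_le r (A B : 'M[C]_r) (w : 'cV[C]_r) :
  `|complex.Re ((adj w *m (adj A *m B) *m w) 0 0)| <= vnorm (A *m w) * vnorm (B *m w).
Proof.
have -> : adj w *m (adj A *m B) *m w = adj (A *m w) *m (B *m w).
  by rewrite adjM !mulmxA.
rewrite -(ler_pXn2r (ltn0Sn 1)) ?nnegrE ?normr_ge0 ?mulr_ge0 ?vnorm_ge0//.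
rewrite real_normK ?num_real// exprMn !vnorm_sqr.
exact: le_trans (Re_le_cn2 _) (complex_cauchy_schwarz _ _).
Qed.

Lemma sum_vn2_col p q (A : 'M[C]_(p, q)) : \sum_k vn2 (col k A) = fn2 A.
Proof.
by rewrite /fn2 exchange_big/=; apply: eq_bigr => k _; apply: eq_bigr => i _; rewrite mxE.
Qed.

(** Since W W^dagger = 1, the squared lengths of the images under A of the columns of W sum to the
    squared Frobenius norm of A; Cauchy-Schwarz over k then gives a bound that does not grow with
    N. *)
Lemma sum_Re_sesqui_le r N (A B : 'M[C]_r) (W : 'M[C]_(r, N)) : W *m adj W = 1%:M ->
  \sum_k `|complex.Re ((adj (col k W) *m (adj A *m B) *m col k W) 0 0)|
    <= frob A * frob B.
Proof.
move=> WW.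
apply: (@le_trans _ _ (\sum_k vnorm (A *m col k W) * vnorm (B *m col k W))).
  by apply: ler_sum => k _; exact: Re_sesqui_le.
rewrite -(ler_pXn2r (ltn0Sn 1)) ?nnegrE ?mulr_ge0 ?frob_ge0//; last first.
  by apply: sumr_ge0 => k _; rewrite mulr_ge0 ?vnorm_ge0.
apply: le_trans (sum_cauchy_schwarz _ _) _; rewrite exprMn !frob_sqr.
have E (M : 'M[C]_r) : \sum_k vnorm (M *m col k W) ^+ 2 = fn2 M.
  rewrite -(fn2_unitaryr M WW) -sum_vn2_col; apply: eq_bigr => k _.
  by rewrite vnorm_sqr; congr vn2; rewrite colE mulmxA -colE.
by rewrite !E.
Qed.

Lemma frobM_le p q s (A : 'M[C]_(p, q)) (B : 'M[C]_(q, s)) :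
  frob (A *m B) <= frob A * frob B.
Proof.
rewrite -(ler_pXn2r (ltn0Sn 1)) ?nnegrE ?mulr_ge0 ?frob_ge0// exprMn !frob_sqr.
exact: fn2M_le.
Qed.

(** Expanding (1 + H) D (1 + H) leaves the errors D H, H D and H D H, each contributing at most
    [frob H * frob D] in total, the last one because [frob H <= 1]. *)
Lemma sum_quadratic_perturb r N (D H : 'M[C]_r) (W : 'M[C]_(r, N)) :
  adj D = D -> adj H = H -> W *m adj W = 1%:M -> frob H <= 1 ->
  \sum_k `|complex.Re ((adj ((1%:M + H) *m col k W) *m D *m ((1%:M + H) *m col k W)) 0 0)|
  <= \sum_k `|complex.Re ((adj (col k W) *m D *m col k W) 0 0)| +
     3 * frob H * frob D.
Proof.
move=> hD hH WW H1.
pose q (M : 'M[C]_r) k := complex.Re ((adj (col k W) *m M *m col k W) 0 0).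
have qD M M' k : q (M + M') k = q M k + q M' k.
  by rewrite /q mulmxDr mulmxDl mxE cReD.
have EM : (1%:M + H) *m D *m (1%:M + H) = D + (H *m D + (D *m H + H *m (D *m H))).
  by rewrite mulmxDl mul1mx mulmxDr mulmx1 mulmxDl -!mulmxA !addrA.
have E k : complex.Re ((adj ((1%:M + H) *m col k W) *m D *m ((1%:M + H) *m col k W)) 0 0)
    = q D k + (q (adj H *m D) k + (q (adj D *m H) k + q (adj H *m (D *m H)) k)).
  rewrite -!qD /q adjM adjD adj1 hH hD -EM; congr (complex.Re (fun_of_matrix _ 0 0)).
  by rewrite !mulmxA.
apply: (@le_trans _ _ (\sum_k (`|q D k| + (`|q (adj H *m D) k| +
    (`|q (adj D *m H) k| + `|q (adj H *m (D *m H)) k|))))).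
  apply: ler_sum => k _; rewrite E; apply: le_trans (ler_normD _ _) _; rewrite lerD2l.
  apply: le_trans (ler_normD _ _) _; rewrite lerD2l; exact: ler_normD.
rewrite !big_split/= lerD2l.
have h1 := sum_Re_sesqui_le H D WW; have h2 := sum_Re_sesqui_le D H WW.
have h3 := sum_Re_sesqui_le H (D *m H) WW.
have h4 : frob H * frob (D *m H) <= frob H * frob D.
  rewrite ler_wpM2l ?frob_ge0//; apply: le_trans (frobM_le _ _) _.
  by rewrite ler_piMr ?frob_ge0.
have := le_trans h3 h4; rewrite -/(q _ _) => h5.
by move: h1 h2 h5; rewrite /q; lra.
Qed.
End perturbation.

(** * Second-order statistics of a complex Gaussian matrix *)

Section stein_pairs.
Context {R : realType} {T : Type} {J : finType}.
Variables (h : J -> T -> R) (L : (T -> R) -> R).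
Hypothesis sL : stein_functional h 1 L.

Let dl (i j : J) : R := (i == j)%:R.

Let pg j : polyf h 1 (h j). Proof. exact: polyf_gen. Qed.

Let L2 i j : L (fun t => h i t * h j t) = dl i j * L (fun=> 1).
Proof.
rewrite (stein_ibp sL i (pd_gen h 1 j)) -(steinZ sL); last exact: polyf_cst.
by congr (L _); apply/funext => t; rewrite /dl; case: eqP; rewrite ?mul1r ?mul0r.
Qed.

(** Wick's formula for four factors. *)
Let L4 i j k l : L (fun t => (h i t * h j t) * (h k t * h l t)) =
  (dl i j * dl k l + dl i k * dl j l + dl i l * dl j k) * L (fun=> 1).
Proof.
have pkl k' l' : polyf h 1 (fun t => h k' t * h l' t) by exact: polyfM.
transitivity (L (fun t => h i t * (h j t * (h k t * h l t)))).
  by congr (L _); apply/funext => t; rewrite -mulrA.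
rewrite (stein_ibp sL i (pd_mul (pd_gen h 1 j) (pd_mul (pd_gen h 1 k) (pd_gen h 1 l)))).
transitivity (L (fun t => dl i j * (h k t * h l t) + dl i k * (h j t * h l t) +
    dl i l * (h j t * h k t))).
  congr (L _); apply/funext => t; rewrite /dl.
  by case: (i == j); case: (i == k); case: (i == l) => /=; ring.
rewrite (steinD sL); [|by apply: polyfD; exact: polyfZ|exact: polyfZ].
rewrite (steinD sL); [|exact: polyfZ..].
by rewrite !(steinZ sL)// !L2; ring.
Qed.

(** In the second moment the pairing inside each product is cancelled by the centering. The two
    cross pairings force u t = u t' and u t = v t' respectively; by injectivity each happens for at
    most one t' per t, hence 2 |I|. *)
Lemma stein_pair_sum (I : finType) (u v : I -> J) (e : I -> R) :
  injective u -> injective v -> (forall t, `|e t| = 1) ->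
  L (fun w => (\sum_t e t * (h (u t) w * h (v t) w) -
               \sum_t e t * (u t == v t)%:R) ^+ 2) <= 2 * #|I|%:R * L (fun=> 1).
Proof.
move=> uinj vinj e1; set c := \sum_t e t * (u t == v t)%:R.
pose W w := \sum_t e t * (h (u t) w * h (v t) w).
have pt t : polyf h 1 (fun w => e t * (h (u t) w * h (v t) w)).
  by apply: polyfZ; exact: polyfM.
have pW : polyf h 1 W by exact: polyf_sum.
have LW : L W = c * L (fun=> 1).
  rewrite (stein_sum sL)// mulr_suml; apply: eq_bigr => t _.
  by rewrite (steinZ sL) ?L2 ?mulrA//; exact: polyfM.
have L1 : 0 <= L (fun=> 1) by apply: (stein_ge0 sL) => //; exact: polyf_cst.
have LW2 : L (fun w => W w ^+ 2) <= (c ^+ 2 + 2 * #|I|%:R) * L (fun=> 1).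
  have -> : L (fun w => W w ^+ 2) = \sum_t \sum_t' e t * e t' *
     (dl (u t) (v t) * dl (u t') (v t') + dl (u t) (u t') * dl (v t) (v t') +
      dl (u t) (v t') * dl (v t) (u t')) * L (fun=> 1).
    transitivity (L (fun w => \sum_t \sum_t' e t * e t' *
        ((h (u t) w * h (v t) w) * (h (u t') w * h (v t') w)))).
      congr (L _); apply/funext => w; rewrite expr2 {1}/W mulr_suml.
      by apply: eq_bigr => t _; rewrite mulr_sumr; apply: eq_bigr => t' _; ring.
    have p4 t t' : polyf h 1 (fun w => (h (u t) w * h (v t) w) * (h (u t') w * h (v t') w)).
      by apply: polyfM; exact: polyfM.
    rewrite (stein_sum sL); last by move=> t; apply: polyf_sum => t'; exact: polyfZ.
    apply: eq_bigr => t _; rewrite (stein_sum sL); last by move=> t'; exact: polyfZ.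
    by apply: eq_bigr => t' _; rewrite (steinZ sL)// L4 mulrA.
  under eq_bigr do rewrite -mulr_suml.
  rewrite -mulr_suml ler_wpM2r//.
  have -> : c ^+ 2 = \sum_t \sum_t' e t * e t' * (dl (u t) (v t) * dl (u t') (v t')).
    rewrite expr2 {1}/c mulr_suml; apply: eq_bigr => t _; rewrite mulr_sumr.
    by apply: eq_bigr => t' _; rewrite /dl; ring.
  have -> : 2 * #|I|%:R = \sum_(t : I) (1 + 1 : R).
    by rewrite sumr_const mulr_natr.
  rewrite -big_split/=; apply: ler_sum => t _.
  apply: (@le_trans _ _ (\sum_t' (e t * e t' * (dl (u t) (v t) * dl (u t') (v t')) +
      (dl (u t) (u t') + dl (u t) (v t'))))).
    apply: ler_sum => t' _; rewrite !mulrDr -addrA lerD2l; apply: lerD.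
      apply: le_trans (ler_norm _) _; rewrite !normrM !e1 !mul1r /dl.
      by do 2 (case: eqP => _); rewrite ?normr0 ?normr1 ?mulr0 ?mul0r ?mulr1 ?ler01.
    apply: le_trans (ler_norm _) _; rewrite !normrM !e1 !mul1r /dl.
    by do 2 (case: eqP => _); rewrite ?normr0 ?normr1 ?mulr0 ?mul0r ?mulr1 ?ler01.
  rewrite big_split/= lerD2l big_split/=; apply: lerD.
    rewrite (bigD1 t)//= /dl eqxx big1 ?addr0// => t' tt'.
    by rewrite (inj_eq uinj) eq_sym (negbTE tt').
  have [/existsP[t0 /eqP ut0]|no] := boolP [exists t', u t == v t'].
    rewrite (bigD1 t0)//= /dl ut0 eqxx big1 ?addr0// => t' tt'.
    by rewrite (inj_eq vinj) eq_sym (negbTE tt').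
  rewrite big1 ?ler01// => t' _; rewrite /dl.
  by move: no; rewrite negb_exists => /forallP/(_ t')/negbTE ->.
have -> : (fun w => (\sum_t e t * (h (u t) w * h (v t) w) - c) ^+ 2) =
    (fun w => W w ^+ 2 + (- 2 * c) * W w + c ^+ 2 * 1).
  by apply/funext => w; rewrite /W; ring.
rewrite (stein_comb3 sL); [|exact: polyfX|by []|exact: polyf_cst].
by rewrite LW; move: LW2; rewrite mulrDl; nra.
Qed.
End stein_pairs.

Lemma polyf_subst (R : realType) (T : Type) (I J : finType) (X : I -> T -> R)
    (h : J -> T -> R) (s s' : R) (F : T -> R) :
  (forall j, polyf X s (h j)) -> polyf h s' F -> polyf X s F.
Proof.
move=> ph [D pF]; elim: pF => [c|j|F1 D1 G1 E1 _ p1 _ p2|F1 D1 G1 E1 _ p1 _ p2].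
- exact: polyf_cst.
- exact: ph.
- exact: polyfD.
- exact: polyfM.
Qed.

Section gaussian_matrix.
Context {R : realType} {d : measure_display} {T : measurableType d}.
Variables (P : probability T R) (N r : nat).
Variable Y : 'I_N * ('I_r * bool) -> T -> R.
Hypothesis gY : gauss_family P Y.
Local Notation C := R[i].

(** Indexing [Y] by the column first makes the columns the blocks of [stein_prod_qf]. Complex
    entries have mean square 2, so the mean of G G^dagger is 2N times the identity. *)
Definition gauss_mx w : 'M[C]_(r, N) :=
  \matrix_(a, b) (Y (b, (a, true)) w +i* Y (b, (a, false)) w)%C.

Let sY : stein_functional Y 1 (Ex P). Proof. exact: stein_functional_Ex. Qed.

(** The real 2 x 2 matrix of multiplication by [z], indexed as in [crd]. *)
Let rot (c e : bool) (z : C) : R :=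
  match c, e with
  | true, false => - complex.Im z
  | false, true => complex.Im z
  | _, _ => complex.Re z
  end.

Section rotated.
Variable U : 'M[C]_N.
Hypothesis uU : unitary U.

Let h (p : 'I_N * ('I_r * bool)) w := crd (col p.1 (gauss_mx w *m U)) p.2.

Let O (p q : 'I_N * ('I_r * bool)) : R :=
  if p.2.1 == q.2.1 then rot p.2.2 q.2.2 (U q.1 p.1) else 0.

Let sum_index (F : 'I_N * ('I_r * bool) -> R) :
  \sum_q F q = \sum_b \sum_a (F (b, (a, true)) + F (b, (a, false))).
Proof.
transitivity (\sum_(q : 'I_N * ('I_r * bool)) F (q.1, q.2)); first by apply: eq_bigr => -[].
rewrite -(pair_bigA _ (fun b j => F (b, j)))/=; apply: eq_bigr => b _.
exact: sum_bool2.
Qed.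

Let hE p w : h p w = \sum_q O p q * Y q w.
Proof.
case: p => k [a c]; rewrite sum_index /h /crd /O /=.
under [RHS]eq_bigr => b _.
  rewrite (bigD1 a)//= eqxx big1 ?addr0; last first.
    by move=> a' aa'; rewrite eq_sym (negbTE aa') !mul0r addr0.
  over.
by case: c; rewrite !mxE ?Re_sum ?Im_sum; apply: eq_bigr => b _;
  rewrite mxE ?cReM ?cImM /=; ring.
Qed.

Let OO p q : \sum_i O p i * O q i = if p == q then 1 else 0.
Proof.
case: p q => k [a c] [l [a' c']]; rewrite sum_index /O /= !xpair_eqE.
have [->|aa'] := eqVneq a a'; last first.
  rewrite andbF big1// => b _; rewrite big1// => a2 _.
  have [<-|_] := eqVneq a a2; last by rewrite !mul0r addr0.
  by rewrite eq_sym (negbTE aa') !mulr0 addr0.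
under eq_bigr => b _.
  rewrite (bigD1 a')//= eqxx big1 ?addr0; last first.
    by move=> a2 aa2; rewrite eq_sym (negbTE aa2) !mul0r addr0.
  over.
have E : \sum_b conjc (U b k) * U b l = (k == l)%:R.
  have /matrixP/(_ k l) := uU; rewrite !mxE => <-; apply: eq_bigr => b _.
  by rewrite adjE.
have Er : \sum_b (complex.Re (U b k) * complex.Re (U b l) +
    complex.Im (U b k) * complex.Im (U b l)) = (k == l)%:R.
  move/(congr1 (@complex.Re R)): E; rewrite Re_sum.
  rewrite (_ : complex.Re _ = (k == l)%:R); last by case: (k == l).
  by move=> <-; apply: eq_bigr => b _; rewrite cReM cReJ cImJ; ring.
have Ei : \sum_b (complex.Re (U b k) * complex.Im (U b l) -
    complex.Im (U b k) * complex.Re (U b l)) = 0.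
  move/(congr1 (@complex.Im R)): E; rewrite Im_sum.
  rewrite (_ : complex.Im _ = 0); last by case: (k == l).
  by move=> E0; apply: etrans E0; apply: eq_bigr => b _; rewrite cImM cReJ cImJ; ring.
have Er' : \sum_b (complex.Re (U b k) * complex.Re (U b l) +
    complex.Im (U b k) * complex.Im (U b l)) = if k == l then 1 else 0.
  by rewrite Er; case: (k == l).
case: c c' => [] []; rewrite /= ?andbT ?andbF.
- by apply: etrans Er'; apply: eq_bigr => b _; ring.
- by apply: etrans Ei; apply: eq_bigr => b _; ring.
- rewrite -[RHS]oppr0; apply: etrans (congr1 -%R Ei); rewrite -sumrN.
  by apply: eq_bigr => b _; ring.
- by apply: etrans Er'; apply: eq_bigr => b _; ring.
Qed.

Variable D : 'M[C]_r.
Hypothesis hD : adj D = D.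
Hypothesis tD : \tr D = 0.
Hypothesis fD : 0 < frob D.

(** For a fixed unitary [U] the coordinates of G U are an orthonormal rotation of those of G, so the
    column by column estimate applies, uniformly in [U]. *)
Lemma gauss_mx_rotated_qf :
  (\int[P]_w (\prod_k qf (complex.Re ((adj (col k (gauss_mx w *m U)) *m D *m
      col k (gauss_mx w *m U)) 0 0) / (Num.sqrt 2 * frob D)))%:E <=
   ((1 - 54^-1) ^+ N)%:E)%E.
Proof.
have sh : stein_functional h 1 (Ex P) by apply: stein_functional_rotate hE OO sY.
pose sg := Num.sqrt 2 * frob D.
have sg0 : 0 < sg by rewrite mulr_gt0// sqrtr_gt0.
have sgE : sg ^+ 2 = \sum_j \sum_k qmx D j k ^+ 2.
  by rewrite qmx_fn2 exprMn sqr_sqrtr// frob_sqr.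
have sym j k : qmx D j k = qmx D k j by exact: qmx_sym.
have E w : \prod_k qf (complex.Re ((adj (col k (gauss_mx w *m U)) *m D *m
      col k (gauss_mx w *m U)) 0 0) / sg) =
    \prod_(k <- enum 'I_N) qf ((\sum_j h (k, j) w * \sum_l qmx D j l * h (k, l) w) / sg).
  by rewrite big_enum/=; apply: eq_bigr => k _; rewrite qmxE.
under eq_integral do rewrite E.
have ph : polyf h 1 (fun w => \prod_(k <- enum 'I_N)
    qf ((\sum_j h (k, j) w * \sum_l qmx D j l * h (k, l) w) / sg)).
  exact: polyf_prod_qf.
have pY : polyf Y 1 (fun w => \prod_(k <- enum 'I_N)
    qf ((\sum_j h (k, j) w * \sum_l qmx D j l * h (k, l) w) / sg)).
  apply: polyf_subst ph => p; apply: (polyf_eq _ (fun w => esym (hE p w))).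
  by apply: polyf_sum => q; apply: polyfZ; exact: polyf_gen.
rewrite (polyf_ExE gY pY) lee_fin.
have := stein_prod_qf sh sym (qmx_tr tD) sg0 sgE (enum_uniq 'I_N).
by rewrite (Ex1 P) mulr1 size_enum_ord.
Qed.
End rotated.

(** There are r^2 entries; the real and the imaginary part of each is a signed sum of 2N products of
    Gaussians, of variance at most 4N by [stein_pair_sum]. *)
Lemma gauss_mx_gram_deviation :
  (\int[P]_w (fn2 (gauss_mx w *m adj (gauss_mx w) - ((2 * N%:R)%:C)%C%:M))%:E <=
   (8 * N%:R * r%:R ^+ 2)%:E)%E.
Proof.
pose u (a : 'I_r) (t : 'I_N * bool) := (t.1, (a, t.2)).
(* In imaginary parts a real coordinate meets an imaginary one: [v] flips the boolean and [sgn]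
   records the sign. *)
pose v (a : 'I_r) (t : 'I_N * bool) := (t.1, (a, ~~ t.2)).
pose sgn (t : 'I_N * bool) : R := if t.2 then -1 else 1.
have uinj a : injective (u a) by move=> [b c] [b' c'] [-> ->].
have vinj a : injective (v a) by move=> [b c] [b' c'] [-> /negb_inj ->].
pose fR a a' w := (\sum_t 1 * (Y (u a t) w * Y (u a' t) w) -
                   \sum_t 1 * (u a t == u a' t)%:R).
pose fI a a' w := (\sum_t sgn t * (Y (u a t) w * Y (v a' t) w) -
                   \sum_t sgn t * (u a t == v a' t)%:R).
have E w : fn2 (gauss_mx w *m adj (gauss_mx w) - ((2 * N%:R)%:C)%C%:M) =
    \sum_a \sum_a' (fR a a' w ^+ 2 + fI a a' w ^+ 2).
  apply: eq_bigr => a _; apply: eq_bigr => a' _; rewrite /cn2.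
  congr (_ ^+ 2 + _ ^+ 2).
    rewrite /fR !sum_bool2 !mxE cReD cReN Re_sum; congr (_ - _).
      by apply: eq_bigr => b _; rewrite adjE !mxE cReM cReJ cImJ /u /=; ring.
    rewrite /u /=; have [->|aa'] := eqVneq a a'.
      rewrite mulr1n cReR; transitivity (\sum_(b < N) (2 : R)).
        by rewrite sumr_const card_ord mulr_natr.
      by apply: eq_bigr => b _; rewrite !eqxx !mul1r.
    by rewrite mulr0n big1// => b _; rewrite !xpair_eqE (negbTE aa') !andbF mulr0 addr0.
  rewrite /fI !sum_bool2 !mxE cImD cImN Im_sum; congr (_ - _).
    by apply: eq_bigr => b _; rewrite adjE !mxE cImM cReJ cImJ /u /v /sgn /=; ring.
  rewrite [RHS]big1; first by case: eqP => _; rewrite ?mulr1n ?mulr0n.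
  by move=> b _; rewrite /u /v /= !xpair_eqE !andbF !mulr0 addr0.
under eq_integral do rewrite E.
have pR a a' : polyf Y 1 (fun w => fR a a' w ^+ 2).
  apply: polyfX; apply: polyfD; last exact: polyf_cst.
  by apply: polyf_sum => t; apply: polyfZ; apply: polyfM; exact: polyf_gen.
have pI a a' : polyf Y 1 (fun w => fI a a' w ^+ 2).
  apply: polyfX; apply: polyfD; last exact: polyf_cst.
  by apply: polyf_sum => t; apply: polyfZ; apply: polyfM; exact: polyf_gen.
have pRI a : polyf Y 1 (fun w => \sum_a' (fR a a' w ^+ 2 + fI a a' w ^+ 2)).
  by apply: polyf_sum => a'; exact: polyfD.
rewrite (polyf_ExE gY); last exact: polyf_sum.
rewrite lee_fin (stein_sum sY)//.
have cardN : #|(('I_N * bool)%type : finType)|%:R = N%:R * 2 :> R.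
  by rewrite card_prod card_ord card_bool natrM.
apply: (@le_trans _ _ (\sum_(a < r) \sum_(a' < r) (8 * N%:R))); last first.
  by rewrite !sumr_const !card_ord -mulrnA -[_ *+ (r * r)]mulr_natr natrM expr2.
apply: ler_sum => a _; rewrite (stein_sum sY); last by move=> a'; exact: polyfD.
apply: ler_sum => a' _; rewrite (steinD sY)//.
have sgn1 t : `|sgn t| = 1 by rewrite /sgn; case: t.2; rewrite ?normrN normr1.
have h1 := stein_pair_sum sY (uinj a) (uinj a') (e := fun=> 1) (fun=> normr1 _).
have h2 := stein_pair_sum sY (uinj a) (vinj a') sgn1.
rewrite Ex1 mulr1 cardN in h1; rewrite Ex1 mulr1 cardN in h2.
have := lerD h1 h2; rewrite -/(fR _ _) -/(fI _ _) => /le_trans; apply; lra.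
Qed.
End gaussian_matrix.

(** * Haar-random bases *)

Section mx_continuous_theory.
Context {R : realType} {p : nat}.
Local Notation C := R[i].

(** Entrywise neighbourhoods in the shape of a filter, so that [mx_continuous] becomes convergence
    and its closure properties come from the calculus of limits. *)
Definition mxnear (A : 'M[C]_p) : set_system 'M[C]_p :=
  [set S | exists2 d : R, 0 < d &
    forall B : 'M[C]_p, (forall i j, Normc.normc (B i j - A i j) < d) -> S B].

Global Instance mxnear_filter A : Filter (mxnear A).
Proof.
split; first by exists 1.
- move=> S S' [d d0 dS] [d' d0' dS']; exists (Num.min d d'); first by rewrite lt_min d0.
  move=> B hB; split; [apply: dS|apply: dS'] => i j; have := hB i j; rewrite lt_min;
    by case/andP.
- by move=> S S' SS' [d d0 dS]; exists d => // B hB; apply/SS'/dS.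
Qed.

Lemma mx_continuousP (g : 'M[C]_p -> R) :
  mx_continuous g <-> forall A, g B @[B --> mxnear A] --> g A.
Proof.
split=> [cg A|cg A e e0].
  by apply/cvgrPdist_lt => e e0; have [d d0 dg] := cg A e e0; exists d => // B hB;
    rewrite distrC; exact: dg.
have /cvgrPdist_lt/(_ e e0)[d d0 dg] := cg A.
by exists d => // B hB; rewrite distrC; exact: dg.
Qed.

Lemma mxnear_sum (I : finType) (f : I -> 'M[C]_p -> R) A :
  (forall i, f i B @[B --> mxnear A] --> f i A) ->
  \sum_i f i B @[B --> mxnear A] --> \sum_i f i A.
Proof.
move=> cf; elim: (index_enum I) => [|i s IH].
  by rewrite big_nil; under eq_cvg do rewrite big_nil; exact: cvg_cst.
by rewrite big_cons; under eq_cvg do rewrite big_cons; exact: cvgD.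
Qed.

Lemma mxnear_expR (f : 'M[C]_p -> R) A : f B @[B --> mxnear A] --> f A ->
  expR (f B) @[B --> mxnear A] --> expR (f A).
Proof.
move=> cf; apply: (continuous_cvg _ (f := f) (h := @expR R)) cf.
exact: continuous_expR.
Qed.

Lemma mxnear_Re A i j : complex.Re (B i j) @[B --> mxnear A] --> complex.Re (A i j).
Proof.
apply/cvgrPdist_lt => e e0; exists e => // B hB; rewrite distrC -cReN -cReD.
apply: le_lt_trans (hB i j); rewrite -(ler_pXn2r (ltn0Sn 1)) ?nnegrE//; last first.
  by case: (_ - _) => a b; exact: sqrtr_ge0.
by rewrite real_normK ?num_real// normc_sqr Re_le_cn2.
Qed.

Lemma mxnear_Im A i j : complex.Im (B i j) @[B --> mxnear A] --> complex.Im (A i j).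
Proof.
apply/cvgrPdist_lt => e e0; exists e => // B hB; rewrite distrC -cImN -cImD.
apply: le_lt_trans (hB i j); rewrite -(ler_pXn2r (ltn0Sn 1)) ?nnegrE//; last first.
  by case: (_ - _) => a b; exact: sqrtr_ge0.
by rewrite real_normK ?num_real// normc_sqr /cn2 lerDr sqr_ge0.
Qed.

Lemma mxnear_crd_mulmx q (J : 'M[C]_(q, p)) A k j :
  crd (col k (J *m B)) j @[B --> mxnear A] --> crd (col k (J *m A)) j.
Proof.
pose f (B : 'M[C]_p) := \sum_b (if j.2 then
    complex.Re (J j.1 b) * complex.Re (B b k) - complex.Im (J j.1 b) * complex.Im (B b k)
  else
    complex.Re (J j.1 b) * complex.Im (B b k) + complex.Im (J j.1 b) * complex.Re (B b k)).
have E : (fun B : 'M[C]_p => crd (col k (J *m B)) j) = f.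
  apply/funext => B; rewrite /f /crd; case: j @f => a [] /=; rewrite !mxE ?Re_sum ?Im_sum;
  by apply: eq_bigr => b _; rewrite ?cReM ?cImM.
have -> : crd (col k (J *m A)) j = f A by rewrite -E.
rewrite E; apply: (mxnear_sum (f := fun b (B : 'M[C]_p) => if j.2 then _ else _)) => b; case: j.2.
  by apply: cvgB; apply: cvgMr; [exact: mxnear_Re|exact: mxnear_Im].
by apply: cvgD; apply: cvgMr; [exact: mxnear_Im|exact: mxnear_Re].
Qed.

Lemma mxnear_quadratic q (J : 'M[C]_(q, p)) (D : 'M[C]_q) A k :
  complex.Re ((adj (col k (J *m B)) *m D *m col k (J *m B)) 0 0) @[B --> mxnear A] -->
  complex.Re ((adj (col k (J *m A)) *m D *m col k (J *m A)) 0 0).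
Proof.
rewrite qmxE (_ : (fun B : 'M[C]_p => _) = (fun B : 'M[C]_p => \sum_j crd (col k (J *m B)) j *
   \sum_l qmx D j l * crd (col k (J *m B)) l)).
  apply: (mxnear_sum (f := fun j B => crd (col k (J *m B)) j *
   \sum_l qmx D j l * crd (col k (J *m B)) l)) => j; apply: cvgM; first exact: mxnear_crd_mulmx.
  apply: (mxnear_sum (f := fun l B => qmx D j l * crd (col k (J *m B)) l)) => l.
  by apply: cvgMr; exact: mxnear_crd_mulmx.
by apply/funext => B; rewrite qmxE.
Qed.
End mx_continuous_theory.

Section haar_entries.
Context {R : realType} {d : measure_display} {T : measurableType d}.
Variables (P : probability T R) (p : nat) (U : T -> 'M[R[i]]_p).
Hypothesis hU : haar_unitary P U.

(* Haar unitaries are only tested against bounded functions; [f] is recovered from the bounded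
   function [expR (- expR f)]. *)
Lemma haar_measurable_continuous (f : 'M[R[i]]_p -> R) :
  (forall A, f B @[B --> mxnear A] --> f A) -> measurable_fun setT (fun t => f (U t)).
Proof.
move=> cf; have [_ mU _] := hU.
pose g A := expR (- expR (f A)).
have gE t : f (U t) = ln (- ln (g (U t))) by rewrite expRK opprK expRK.
rewrite (_ : (fun t => f (U t)) = (fun t => ln (- ln (g (U t))))); last first.
  by apply/funext => t; exact: gE.
have mg : measurable_fun setT (fun t => g (U t)).
  apply: mU; last first.
    exists 1 => A; rewrite ger0_norm ?expR_ge0// -expR0 ler_expR oppr_le0.
    exact: expR_ge0.
  apply/mx_continuousP => A; apply: mxnear_expR.
  by apply: cvgN; apply: mxnear_expR; exact: cf.
apply: (measurableT_comp (@measurable_ln R)).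
by apply: measurableT_comp => //; exact: (measurableT_comp (@measurable_ln R) mg).
Qed.

Lemma haar_measurable_Re i j : measurable_fun setT (fun t => complex.Re (U t i j)).
Proof.
by apply: (haar_measurable_continuous (f := fun A => complex.Re (A i j))) => A; exact: mxnear_Re.
Qed.

Lemma haar_measurable_Im i j : measurable_fun setT (fun t => complex.Im (U t i j)).
Proof.
by apply: (haar_measurable_continuous (f := fun A => complex.Im (A i j))) => A; exact: mxnear_Im.
Qed.
End haar_entries.

(** * Entrywise measurability of random matrices *)

Section mx_measurable.
Context {R : realType} {d : measure_display} {T : measurableType d}.
Local Notation C := R[i].

Definition mx_measurable p q (A : T -> 'M[C]_(p, q)) := forall i j,
  measurable_fun setT (fun t => complex.Re (A t i j)) /\
  measurable_fun setT (fun t => complex.Im (A t i j)).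

Lemma mx_measurable_cst p q (A : 'M[C]_(p, q)) : mx_measurable (fun=> A).
Proof. by move=> i j; split; exact: measurable_cst. Qed.

Lemma mx_measurable_adj p q (A : T -> 'M[C]_(p, q)) :
  mx_measurable A -> mx_measurable (fun t => adj (A t)).
Proof.
move=> mA i j; have [mr mi] := mA j i; split.
  by under eq_fun do rewrite adjE cReJ.
by under eq_fun do rewrite adjE cImJ; exact: measurableT_comp.
Qed.

Lemma mx_measurable_col p q (A : T -> 'M[C]_(p, q)) k :
  mx_measurable A -> mx_measurable (fun t => col k (A t)).
Proof.
by move=> mA i j; have [mr mi] := mA i k; split; under eq_fun do rewrite mxE.
Qed.

Lemma mx_measurable_mul p q s (A : T -> 'M[C]_(p, q)) (B : T -> 'M[C]_(q, s)) :
  mx_measurable A -> mx_measurable B -> mx_measurable (fun t => A t *m B t).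
Proof.
move=> mA mB i j; split.
  under eq_fun do rewrite mxE Re_sum; apply: measurable_sum => k.
  have [mr mi] := mA i k; have [nr ni] := mB k j.
  by under eq_fun do rewrite cReM; apply: measurable_funB; exact: measurable_funM.
under eq_fun do rewrite mxE Im_sum; apply: measurable_sum => k.
have [mr mi] := mA i k; have [nr ni] := mB k j.
by under eq_fun do rewrite cImM; apply: measurable_funD; exact: measurable_funM.
Qed.

Lemma measurable_quadratic p q (A : T -> 'M[C]_(p, q)) (D : 'M[C]_p) k :
  mx_measurable A -> measurable_fun setT (fun t =>
    complex.Re ((adj (col k (A t)) *m D *m col k (A t)) 0 0)).
Proof.
move=> mA; have mc := mx_measurable_col k mA.
have m1 := mx_measurable_mul (mx_measurable_adj mc) (mx_measurable_cst D).
by have [] := mx_measurable_mul m1 mc 0 0.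
Qed.
End mx_measurable.

Lemma mx_measurable_comp (R : realType) d1 d2 (T1 : measurableType d1)
    (T2 : measurableType d2) p q (f : T1 -> T2) (A : T2 -> 'M[R[i]]_(p, q)) :
  measurable_fun setT f -> mx_measurable A -> mx_measurable (fun t => A (f t)).
Proof.
move=> mf mA i j; have [mr mi] := mA i j.
by split; [exact: (measurableT_comp mr mf)|exact: (measurableT_comp mi mf)].
Qed.

Lemma haar_mx_measurable (R : realType) d (T : measurableType d) (P : probability T R) p
    (U : T -> 'M[R[i]]_p) : haar_unitary P U -> mx_measurable U.
Proof.
by move=> hU i j; split; [exact: haar_measurable_Re hU _ _|exact: haar_measurable_Im hU _ _].
Qed.

Lemma measurable_qf (R : realType) : measurable_fun setT (@qf R).
Proof.
rewrite /qf; apply: measurable_funB => //; apply: measurable_funM => //.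
apply: measurable_funB; first exact: exprn_measurable.
by apply: measurable_funM => //; exact: exprn_measurable.
Qed.

Lemma integral_cst_probability (R : realType) d (T : measurableType d)
    (P : probability T R) (c : R) : (\int[P]_t c%:E = c%:E)%E.
Proof.
rewrite (integral_cst P measurableT); transitivity (c%:E * 1)%E; last by rewrite mule1.
by congr (_ * _)%E; exact: probability_setT.
Qed.

Lemma fn2_scaleR (R : realType) p q (c : R) (A : 'M[R[i]]_(p, q)) :
  fn2 (c%:C%C *: A) = c ^+ 2 * fn2 A.
Proof.
rewrite /fn2 mulr_sumr; apply: eq_bigr => i _; rewrite mulr_sumr; apply: eq_bigr => j _.
by rewrite mxE /cn2 cReM cImM cReR cImR; ring.
Qed.

(** * Laplace transform of the outcome sum of a Haar basis *)

Section haar_quadratic.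
Context {R : realType} {d : measure_display} {T : measurableType d}.
Local Notation C := R[i].
Variables (P : probability T R) (N r : nat) (U : T -> 'M[C]_N).
Hypothesis hU : haar_unitary P U.
Variables (J : 'M[C]_(r, N)) (D : 'M[C]_r).
Hypothesis JJ : J *m adj J = 1%:M.
Hypothesis hD : adj D = D.
Hypothesis tD : \tr D = 0.
Hypothesis fD : 0 < frob D.

Let F (A : 'M[C]_N) : R :=
  \sum_k `|complex.Re ((adj (col k (J *m A)) *m D *m col k (J *m A)) 0 0)|.
(** For G = sqrt(2N) J V, the quantities |Z_k| / (sqrt 2 frob D) attached to the columns of G A sum
    to 2N F(V A) / (sqrt 2 frob D), which is mu F(V A). *)
Let mu : R := Num.sqrt 2 * N%:R / frob D.
Let phi (A : 'M[C]_N) : R := expR (- (mu * F A)).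

Let F_ge0 A : 0 <= F A.
Proof. exact: sumr_ge0. Qed.

Let mu_ge0 : 0 <= mu.
Proof. by rewrite divr_ge0 ?mulr_ge0 ?sqrtr_ge0// ltW. Qed.

Let phi_le1 A : phi A <= 1.
Proof. by rewrite -expR0 ler_expR oppr_le0 mulr_ge0. Qed.

Let phi_continuous : mx_continuous phi.
Proof.
apply/mx_continuousP => A; apply: mxnear_expR; apply: cvgN; apply: cvgMr.
apply: (mxnear_sum (f := fun k B =>
  `|complex.Re ((adj (col k (J *m B)) *m D *m col k (J *m B)) 0 0)|)) => k.
by apply: cvg_norm; exact: mxnear_quadratic.
Qed.

Let phi_bounded : mx_bounded phi.
Proof. by exists 1 => A; rewrite ger0_norm ?expR_ge0. Qed.

Let th : R := fine (\int[P]_t (phi (U t))%:E)%E.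

Let measurable_F_mul (V : 'M[C]_N) : measurable_fun setT (fun t => F (V *m U t)).
Proof.
apply: measurable_sum => k; apply: measurableT_comp => //.
apply: (measurable_quadratic (A := fun t => J *m (V *m U t))).
apply: mx_measurable_mul; first exact: mx_measurable_cst.
apply: mx_measurable_mul; first exact: mx_measurable_cst.
exact: haar_mx_measurable hU.
Qed.

Let measurable_phi_mul (V : 'M[C]_N) : measurable_fun setT (fun t => phi (V *m U t)).
Proof.
apply: (measurableT_comp (@measurable_expR R)); apply: measurableT_comp => //.
by apply: measurable_funM => //; exact: measurable_F_mul.
Qed.

Let measurable_phi : measurable_fun setT (fun t => phi (U t)).
Proof.
rewrite (_ : (fun t => _) = fun t => phi (1%:M *m U t)); first exact: measurable_phi_mul.
by apply/funext => t; rewrite mul1mx.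
Qed.

Let th_mul V : unitary V -> (\int[P]_t (phi (V *m U t))%:E = th%:E)%E.
Proof.
move=> uV; have [_ _ inv] := hU; rewrite -inv// /th fineK//.
apply: (@integrable_fin_num _ _ _ P setT) => //.
apply: (measurable_bounded_integrable (mu := P) (f := fun t => phi (U t))) => //.
- by apply: (le_lt_trans (probability_le1 _ _)) => //; rewrite ltry.
- exists 1; split; first exact: num_real.
  by move=> x x1 t _ /=; rewrite ger0_norm ?expR_ge0// (le_trans (phi_le1 _))// ltW.
Qed.

Let th_ge0 : 0 <= th.
Proof. by apply: fine_ge0; apply: integral_ge0 => t _; rewrite lee_fin expR_ge0. Qed.

Let q (G : 'M[C]_(r, N)) : R := \prod_k qf (complex.Re ((adj (col k G) *m D *m
      col k G) 0 0) / (Num.sqrt 2 * frob D)).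

Let q_ge0 G : 0 <= q G.
Proof. by apply: prodr_ge0 => k _; exact/ltW/qf_gt0. Qed.

(** The lower bound exp(-|z|) for [qf] turns the product into the exponential of a sum over columns;
    [H] changes that sum by at most 3 eps frob D, which [mu] scales to 3 sqrt 2 N eps. *)
Let perturb_bound (eps : R) (H : 'M[C]_r) (V A : 'M[C]_N) :
  adj H = H -> frob H <= eps -> eps <= 1 -> unitary V -> unitary A ->
  phi (V *m A) * expR (- (3 * Num.sqrt 2 * N%:R * eps)) <=
  q ((Num.sqrt (2 * N%:R))%:C%C *: ((1%:M + H) *m (J *m V)) *m A).
Proof.
move=> hH He e1 uV uA.
have [uV' uA'] := (mulmx1C uV, mulmx1C uA).
set W := J *m (V *m A).
have WW : W *m adj W = 1%:M.
  by rewrite /W !adjM !mulmxA -(mulmxA _ A) uA' mulmx1 -(mulmxA _ V) uV' mulmx1.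
have := sum_quadratic_perturb hD hH WW (le_trans He e1).
set S := \sum_k _; rewrite -/(F (V *m A)) => SF.
apply: (@le_trans _ _ (\prod_k expR (- (2 * N%:R * `|complex.Re ((adj ((1%:M + H) *m col k W)
    *m D *m ((1%:M + H) *m col k W)) 0 0)| / (Num.sqrt 2 * frob D))))); last first.
  apply: ler_prod => k _; rewrite expR_ge0/=.
  have -> : col k ((Num.sqrt (2 * N%:R))%:C%C *: ((1%:M + H) *m (J *m V)) *m A) =
      (Num.sqrt (2 * N%:R))%:C%C *: ((1%:M + H) *m col k W).
    by rewrite /W !colE -!scalemxAl !mulmxA.
  set z := (1%:M + H) *m _.
  have -> : complex.Re ((adj ((Num.sqrt (2 * N%:R))%:C%C *: z) *m D *m
     ((Num.sqrt (2 * N%:R))%:C%C *: z)) 0 0) =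
     2 * N%:R * complex.Re ((adj z *m D *m z) 0 0).
    rewrite adjZR -!scalemxAl -scalemxAr scalerA mxE -rmorphM/= -expr2 sqr_sqrtr ?mulr_ge0//.
    by rewrite cReM cReR cImR mul0r subr0.
  set x := complex.Re _; apply: le_trans (expR_le_qf _).
  rewrite ler_expR lerN2 !normrM normfV normrM (ger0_norm (sqrtr_ge0 _)) (gtr0_norm fD).
  by rewrite !normr_nat.
rewrite -expR_sum -expRD ler_expR sumrN -opprD lerN2 -mulr_suml -mulr_sumr -/S.
have s0 : 0 < Num.sqrt 2 :> R by rewrite sqrtr_gt0.
have s2 : Num.sqrt 2 ^+ 2 = 2 :> R by rewrite sqr_sqrtr.
have -> : 2 * N%:R * S / (Num.sqrt 2 * frob D) = mu * S.
  by rewrite /mu -{1}s2; field; rewrite !gt_eqF.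
apply: (@le_trans _ _ (mu * (F (V *m A) + 3 * eps * frob D))).
  apply: ler_wpM2l => //; apply: le_trans SF _; rewrite lerD2l ler_wpM2r ?frob_ge0//.
  by rewrite ler_wpM2l.
by rewrite mulrDr lerD2l le_eqVlt; apply/orP; left; apply/eqP; rewrite /mu; field; rewrite gt_eqF.
Qed.

Let measurable_q d' (T' : measurableType d') (G : T' -> 'M[C]_(r, N)) :
  mx_measurable G -> measurable_fun setT (fun w => q (G w)).
Proof.
move=> mG; apply: measurable_prod => k _.
apply: (measurableT_comp (@measurable_qf R)); apply: measurable_funM => //.
exact: measurable_quadratic.
Qed.

(** Valid for every [G]. If its Gram deviation exceeds (2N)^2 eps^2, the last term alone dominates
    the left side. Otherwise polar decomposition and unitary extension give G = sqrt(2N) (1 + H) J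
    V, and left invariance identifies the mean of phi(V U) with [th]. *)
Let near_isometry_bound (eps : R) (G : 'M[C]_(r, N)) : 0 < eps -> eps < 1 -> (0 < N)%N ->
  ((th * expR (- (3 * Num.sqrt 2 * N%:R * eps)))%:E <= \int[P]_t (q (G *m U t))%:E +
   (th * expR (- (3 * Num.sqrt 2 * N%:R * eps)) / ((2 * N%:R) ^+ 2 * eps ^+ 2) *
    fn2 (G *m adj G - ((2 * N%:R)%:C)%C%:M))%:E)%E.
Proof.
move=> e0 e1 N0; set kap := expR _; set dl := fn2 _.
have N0' : 0 < 2 * N%:R :> R by rewrite mulr_gt0// ltr0n.
have thk : 0 <= th * kap by rewrite mulr_ge0 ?expR_ge0.
have dl0 : 0 <= dl by exact: fn2_ge0.
have I0 : (0 <= \int[P]_t (q (G *m U t))%:E)%E.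
  by apply: integral_ge0 => t _; rewrite lee_fin.
have [small|big] := leP dl ((2 * N%:R) ^+ 2 * eps ^+ 2); last first.
  rewrite -[leLHS]add0e; apply: leeD => //; rewrite lee_fin -mulrA ler_peMr//.
  by rewrite mulrC ler_pdivlMr ?mul1r ?ltW// mulr_gt0// exprn_gt0.
rewrite -[leLHS]adde0; apply: leeD; last first.
  by rewrite lee_fin mulr_ge0// divr_ge0// mulr_ge0 ?sqr_ge0.
pose a : R := Num.sqrt (2 * N%:R).
have a0 : 0 < a by rewrite sqrtr_gt0.
have a2 : a ^+ 2 = 2 * N%:R by rewrite sqr_sqrtr// ltW.
pose B := (a^-1)%:C%C *: G.
have BE : fn2 (B *m adj B - 1%:M) = dl / (2 * N%:R) ^+ 2.
  have -> : B *m adj B - 1%:M = ((2 * N%:R)^-1)%:C%C *: (G *m adj G - ((2 * N%:R)%:C)%C%:M).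
    rewrite /B adjZR -scalemxAl -scalemxAr scalerA -rmorphM/= -expr2 exprVn a2 scalerBr.
    by rewrite scale_scalar_mx fmorphV mulVf// fmorph_eq0 gt_eqF.
  by rewrite fn2_scaleR -/dl exprVn mulrC.
have Be : fn2 (B *m adj B - 1%:M) <= eps ^+ 2.
  by rewrite BE ler_pdivrMr ?exprn_gt0// mulrC.
have [|H [Q [hH HB QQ BQ]]] := @polar_near_coisometry _ _ _ B.
  by apply: le_lt_trans Be _; rewrite expr_lt1// ltW.
have He : frob H <= eps.
  rewrite -(ler_pXn2r (ltn0Sn 1)) ?nnegrE ?frob_ge0 ?(ltW e0)// frob_sqr.
  exact: le_trans HB Be.
have [V uV JV] := coisometry_extend JJ QQ.
have GE : G = a%:C%C *: ((1%:M + H) *m (J *m V)).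
  by rewrite JV -BQ /B scalerA -rmorphM/= mulfV ?gt_eqF// scale1r.
rewrite EFinM muleC -(th_mul uV) -ge0_integralZl//; first last.
- by rewrite lee_fin expR_ge0.
- by move=> t _; rewrite lee_fin expR_ge0.
- by apply/measurable_EFinP; exact: measurable_phi_mul.
apply: ge0_le_integral => //.
- by move=> t _; rewrite -EFinM lee_fin mulr_ge0 ?expR_ge0.
- apply: measurable_funeM; apply/measurable_EFinP; exact: measurable_phi_mul.
- apply/measurable_EFinP/measurable_q; apply: mx_measurable_mul.
    exact: mx_measurable_cst.
  exact: haar_mx_measurable hU.
move=> t _; rewrite -EFinM lee_fin mulrC GE; have [uU _ _] := hU.
by apply: perturb_bound => //; exact: ltW.
Qed.

(** Averaged over the Gaussian [G], the first term is controlled by [gauss_mx_rotated_qf] for each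
    fixed value of U; the second is at most th kap (8 N r^2) / (4 N^2 eps^2), which the hypothesis
    on N bounds by half of the left side. *)
Let haar_laplace_bound (eps : R) : 0 < eps -> eps < 1 -> (0 < N)%N ->
  4 * r%:R ^+ 2 <= N%:R * eps ^+ 2 ->
  th <= 2 * (1 - 54^-1) ^+ N * expR (3 * Num.sqrt 2 * N%:R * eps).
Proof.
move=> e0 e1 N0 rN.
have [d' [T' [P' [Y gY]]]] := @gauss_family_exists R ('I_N * ('I_r * bool))%type.
pose G := gauss_mx Y.
have mG : mx_measurable G.
  by move=> i j; split; under eq_fun do rewrite mxE/=; exact: gY.1.
pose kap := expR (- (3 * Num.sqrt 2 * N%:R * eps)).
pose c := th * kap / ((2 * N%:R) ^+ 2 * eps ^+ 2).
pose dl w := fn2 (G w *m adj (G w) - ((2 * N%:R)%:C)%C%:M).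
have N0' : 0 < N%:R :> R by rewrite ltr0n.
have thk : 0 <= th * kap by rewrite mulr_ge0 ?expR_ge0.
have c0 : 0 <= c by rewrite divr_ge0// mulr_ge0 ?sqr_ge0.
have mUG : measurable_fun setT (fun x : T * T' => (q (G x.2 *m U x.1))%:E).
  apply/measurable_EFinP; apply: (measurable_q (G := fun x : T * T' => G x.2 *m U x.1)).
  apply: mx_measurable_mul; first exact: (mx_measurable_comp (f := snd)).
  by apply: (mx_measurable_comp (f := fst)) => //; exact: haar_mx_measurable hU.
have qUG0 (x : T * T') : (0 <= (q (G x.2 *m U x.1))%:E)%E by rewrite lee_fin.
have mdl : measurable_fun setT dl.
  rewrite /dl /fn2; apply: measurable_sum => i; apply: measurable_sum => j.
  have [mr mi] := mx_measurable_mul mG (mx_measurable_adj mG) i j.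
  rewrite /cn2; apply: measurable_funD; apply: measurable_funX.
    under eq_fun do rewrite mxE cReD.
    by apply: measurable_funD => //; under eq_fun do rewrite mxE; exact: measurable_cst.
  under eq_fun do rewrite mxE cImD.
  by apply: measurable_funD => //; under eq_fun do rewrite mxE; exact: measurable_cst.
have mI : measurable_fun setT (fun w => (\int[P]_t (q (G w *m U t))%:E)%E).
  exact: (measurable_fun_fubini_tonelli_G (m1 := P) _ mUG qUG0).
have h : ((th * kap)%:E <= ((1 - 54^-1) ^+ N)%:E + (c * (8 * N%:R * r%:R ^+ 2))%:E)%E.
  have -> : ((th * kap)%:E = \int[P']_w (th * kap)%:E)%E.
    by rewrite integral_cst_probability.
  apply: (@le_trans _ _ (\int[P']_w (\int[P]_t (q (G w *m U t))%:E + (c * dl w)%:E))%E).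
    apply: ge0_le_integral => //.
    - by apply: emeasurable_funD => //; apply/measurable_EFinP; exact: measurable_funM.
    - by move=> w _; exact: near_isometry_bound.
  rewrite ge0_integralD//; first last.
  - by apply/measurable_EFinP; exact: measurable_funM.
  - by move=> w _; rewrite lee_fin mulr_ge0// fn2_ge0.
  - by move=> w _; apply: integral_ge0 => t _; rewrite lee_fin.
  apply: leeD.
    rewrite -(fubini_tonelli (m1 := P) (m2 := P') _ mUG qUG0)/=.
    have -> : (((1 - 54^-1) ^+ N)%:E = \int[P]_t ((1 - 54^-1) ^+ N)%:E :> \bar R)%E.
      by rewrite integral_cst_probability.
    apply: ge0_le_integral => //.
    - by move=> t _; apply: integral_ge0 => w _; rewrite lee_fin.
    - exact: (measurable_fun_fubini_tonelli_F (m2 := P') _ mUG qUG0).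
    - by move=> t _; apply: gauss_mx_rotated_qf => //; case: hU.
  under eq_integral do rewrite EFinM.
  rewrite ge0_integralZl//; first last.
  - by move=> w _; rewrite lee_fin fn2_ge0.
  - exact/measurable_EFinP.
  rewrite [leRHS]EFinM; apply: lee_wpmul2l; first by rewrite lee_fin.
  exact: gauss_mx_gram_deviation.
rewrite -EFinD lee_fin in h.
have h2 : c * (8 * N%:R * r%:R ^+ 2) <= th * kap / 2.
  have -> : c * (8 * N%:R * r%:R ^+ 2) = th * kap / 2 * (4 * r%:R ^+ 2 / (N%:R * eps ^+ 2)).
    by rewrite /c; field; rewrite !gt_eqF.
  apply: ler_piMr; first by rewrite divr_ge0.
  by rewrite ler_pdivrMr ?mul1r// mulr_gt0// exprn_gt0.
have h3 : th * kap <= 2 * (1 - 54^-1) ^+ N by lra.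
have kk : kap * expR (3 * Num.sqrt 2 * N%:R * eps) = 1.
  by rewrite -expRD addNr expR0.
apply: (@le_trans _ _ (th * kap * expR (3 * Num.sqrt 2 * N%:R * eps))).
  by rewrite -mulrA kk mulr1.
by apply: ler_wpM2r => //; exact: expR_ge0.
Qed.

(** With x = sqrt 2 N eps, Markov's inequality costs exp x and the perturbation exp(3x). As sqrt 2
    <= 3/2 and eps <= 1/648, 4x <= N/108, half of the available exponent N/54. *)
Lemma haar_quadratic_lower_tail (eps : R) : 0 < eps -> eps <= 648^-1 -> (0 < N)%N ->
  4 * r%:R ^+ 2 <= N%:R * eps ^+ 2 ->
  exists2 A : set T, measurable A &
    (forall t, A t -> eps * frob D <
       \sum_k `|complex.Re ((adj (col k (J *m U t)) *m D *m col k (J *m U t)) 0 0)|) /\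
    (P (~` A) <= (2 * expR (- (N%:R / 108)))%:E)%E.
Proof.
move=> e0 e648 N0 rN.
have e1 : eps < 1 by lra.
pose A := [set t | eps * frob D < F (U t)].
have mF : measurable_fun setT (fun t => F (U t)).
  rewrite (_ : (fun t => _) = fun t => F (1%:M *m U t)); first exact: measurable_F_mul.
  by apply/funext => t; rewrite mul1mx.
have mA : measurable A.
  rewrite (_ : A = (fun t => F (U t)) @^-1` `]eps * frob D, +oo[%classic).
    by rewrite -[_ @^-1` _]setTI; exact: mF.
  by apply/seteqP; split => t /=; rewrite in_itv/= andbT.
exists A => //; split => //.
have N0' : 0 <= N%:R :> R by [].
pose x := Num.sqrt 2 * N%:R * eps.
have low t : (~` A) t -> expR (- x) <= phi (U t).
  move=> /= /negP; rewrite -leNgt => Ft; rewrite ler_expR lerN2.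
  apply: le_trans (ler_wpM2l mu_ge0 Ft) _; rewrite le_eqVlt; apply/orP; left; apply/eqP.
  by rewrite /mu /x; field; rewrite gt_eqF.
have := markov_set P measurable_phi (fun t => expR_ge0 _) (measurableC mA) (expR_ge0 _) low.
have -> : (\int[P]_t (phi (U t))%:E = th%:E)%E.
  rewrite -(th_mul (V := 1%:M)); first by under [RHS]eq_integral do rewrite mul1mx.
  by rewrite /unitary adj1 mulmx1.
set p := P _ => pE.
have pfin : p \is a fin_num by exact: fin_num_measure (measurableC mA).
rewrite -(fineK pfin) -EFinM lee_fin in pE; rewrite -(fineK pfin) lee_fin.
have {}pE := le_trans pE (haar_laplace_bound e0 e1 N0 rN).
have e54 : (1 - 54^-1) ^+ N <= expR (- (N%:R / 54)) :> R.
  rewrite -mulrN expRM_natl lerXn2r ?nnegrE ?expR_ge0//; first by lra.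
  exact: expR_ge1Dx.
have x4 : 4 * x <= N%:R / 108.
  have s32 : Num.sqrt 2 <= 3 / 2 :> R.
    rewrite -(ler_pXn2r (ltn0Sn 1)) ?nnegrE ?sqrtr_ge0 ?sqr_sqrtr//; lra.
  have : x <= 3 / 2 * N%:R * 648^-1.
    apply: ler_pM; [by rewrite mulr_ge0 ?sqrtr_ge0|exact: ltW|exact: ler_wpM2r|by []].
  lra.
apply: (@le_trans _ _ (expR (- x) * fine p * expR x)).
  by rewrite mulrAC -expRD addNr expR0 mul1r.
apply: (@le_trans _ _ (2 * expR (- (N%:R / 54)) * expR (3 * x) * expR x)).
  apply: ler_wpM2r; first exact: expR_ge0.
  rewrite [3 * x](_ : _ = 3 * Num.sqrt 2 * N%:R * eps); last by rewrite /x !mulrA.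
  apply: (le_trans pE); apply: ler_wpM2r; first exact: expR_ge0.
  by apply: ler_wpM2l.
rewrite -!mulrA; apply: ler_wpM2l => //; rewrite -!expRD ler_expR; lra.
Qed.
End haar_quadratic.

Lemma tensmx11 (R : comNzRingType) p q :
  (1%:M : 'M[R]_p) *t (1%:M : 'M[R]_q) = 1%:M.
Proof.
apply/matrixP => i j; case: (mxtens_indexP i) => a b; case: (mxtens_indexP j) => a' b'.
rewrite tensmxE !mxE (can_eq (@mxtens_indexK _ _)) xpair_eqE.
by case: (a == a') (b == b') => -[]; rewrite ?mul0r ?mulr0 ?mulr1.
Qed.

(** * The measurement in a Haar-random basis *)

Section haar_povm.
Context {R : realType}.
Local Notation C := R[i].

(** Tensoring with the identity of size 1 gives [D] the size [n * 1] of the codomain of [J], so that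
    A - B tensored with |e0><e0| is J^dagger D J. *)
Lemma basis_povm_l1dist n m (U : 'M[C]_(n * m)) (e0 : 'cV[C]_m) (A B : 'M[C]_n) :
  let J := (1%:M : 'M[C]_n) *t adj e0 in let D := (A - B) *t (1%:M : 'M[C]_1) in
  l1dist (basis_povm U e0 A) (basis_povm U e0 B) =
  \sum_k `|complex.Re ((adj (col k (J *m U)) *m D *m col k (J *m U)) 0 0)|.
Proof.
move=> J D; apply: eq_bigr => k _.
rewrite /basis_povm outcomeB tensmxBl outcome_ketbra.
have -> : (A - B) *t ketbra e0 = adj J *m D *m J.
  by rewrite /J /D adj_tens adjK adj1 !tensmx_mul mul1mx mulmx1 mulmx1.
by rewrite !colE !adjM !mulmxA.
Qed.

Lemma haar_basis_povm_distinguishes : exists K0 c1 c2 : R, 0 < c1 /\ 0 < c2 /\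
  forall (n m : nat) (sigma1 sigma2 : 'M[R[i]]_n) (K : R)
    (e0 : 'cV[R[i]]_m)
    (d : measure_display) (T : measurableType d) (P : probability T R)
    (U : T -> 'M[R[i]]_(n * m)),
  density_matrix sigma1 -> density_matrix sigma2 ->
  K0 <= K ->
  4 * n%:R * K ^+ 2 <= m%:R * frob (sigma1 - sigma2) ^+ 2 ->
  unit_vector e0 ->
  haar_unitary P U ->
  exists E : set T, [/\ measurable E,
    E `<=` [set t | c2 * frob (sigma1 - sigma2) <
                    l1dist (basis_povm (U t) e0 sigma1)
                           (basis_povm (U t) e0 sigma2)]
    & ((1 - expR (- (c1 * K * n%:R)))%:E <= P E)%E].
Proof.
(* [k] is the inverse of eps, kept opaque. The value 2k for [K0] is what 4 n^2 <= N / k^2 asks for,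
   given N >= (K n)^2. *)
have [k kE] : exists k : R, k = 648 by exists 648.
have k0 : 0 < k by rewrite kE ltr0n.
have k600 : 600 <= k by rewrite kE ler_nat.
have eps0 : 0 < k^-1 by rewrite invr_gt0.
exists (2 * k), 1, k^-1; split=> //; split=> // n m s1 s2 K e0 d T P U ds1 ds2 K0 mf e1 hU.
have [hD tD] := density_diff ds1 ds2.
have n0 : (0 < n)%N.
  case: n s1 ds1 {s2 ds2 mf e0 e1 U hU hD tD} => // s1 [_ _].
  by rewrite /mxtrace big_ord0 => /eqP; rewrite eq_sym oner_eq0.
have n1 : 1 <= n%:R :> R by rewrite ler1n.
have Kgt0 : 0 < K by apply: lt_le_trans K0; rewrite mulr_gt0.
set f := frob _ in mf *.
have f4 : f ^+ 2 <= 4 by exact: frob_density_diff.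
have lhs0 : 0 < 4 * n%:R * K ^+ 2 by rewrite !mulr_gt0 ?exprn_gt0// ltr0n.
have f0 : 0 < f.
  rewrite lt_def frob_ge0 andbT; apply: contraTneq (lt_le_trans lhs0 mf) => ->.
  by rewrite expr0n/= mulr0 ltxx.
have mn : n%:R * K ^+ 2 <= m%:R by have := ler_wpM2l (ler0n R m) f4; lra.
pose x := K * n%:R.
have x0 : 2 * k <= x by apply: le_trans K0 _; rewrite ler_peMr// ltW.
have Nx : x ^+ 2 <= (n * m)%:R.
  have -> : x ^+ 2 = n%:R * (n%:R * K ^+ 2) by rewrite /x; ring.
  by rewrite natrM ler_wpM2l.
have xx : 2 * k * x <= x ^+ 2 by rewrite expr2 ler_wpM2r//; lra.
have xx' : 1200 * x <= 2 * k * x by rewrite ler_wpM2r; lra.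
pose J := (1%:M : 'M[C]_n) *t adj e0.
pose D := (s1 - s2) *t (1%:M : 'M[C]_1).
have JJ : J *m adj J = 1%:M.
  rewrite /J adj_tens adjK adj1 tensmx_mul mul1mx.
  suff -> : adj e0 *m e0 = 1%:M by rewrite tensmx11.
  apply/matrixP => i j; rewrite !ord1 adj_mul_self -vnorm_sqr e1 expr1n mxE eqxx.
  by [].
have fD : frob D = f.
  apply/eqP; rewrite -(eqrXn2 (ltn0Sn 1)) ?frob_ge0// !frob_sqr /D fn2_tens.
  by rewrite [fn2 1%:M](_ : _ = 1) ?mulr1// /fn2 !big_ord1 mxE/= /cn2 /= expr0n addr0 expr1n.
have [|||||||A mA [AP PA]] := @haar_quadratic_lower_tail _ _ _ P _ _ U hU J D JJ _ _ _ k^-1.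
- by rewrite /D adj_tens hD adj1.
- by rewrite /D tens_tr tD mul0r.
- by rewrite fD.
- by [].
- by rewrite kE.
- by rewrite -(ltr0n R); apply: lt_le_trans Nx; rewrite exprn_gt0//; lra.
- rewrite muln1 exprVn ler_pdivlMr ?exprn_gt0//; apply: le_trans Nx.
  rewrite /x exprMn [leLHS]mulrAC; apply: ler_wpM2r; first exact: sqr_ge0.
  have : (2 * k) ^+ 2 <= K ^+ 2 by rewrite ler_pXn2r ?nnegrE ?mulr_ge0 ?(ltW k0) ?(ltW Kgt0).
  by rewrite exprMn (_ : 2 ^+ 2 = 4)//; ring.
exists A; split=> //; first by move=> t /AP; rewrite fD /= basis_povm_l1dist.
rewrite -[A]setCK; apply: prob_setC_ge; first exact: measurableC.
apply: le_trans PA _; rewrite lee_fin mul1r -/x.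
(* The factor 2 is at most e, and N >= x^2 >= 1200 x with x >= 2k leaves room for it in the
   exponent. *)
apply: (@le_trans _ _ (expR 1 * expR (- ((n * m)%:R / 108)))).
  by apply: ler_wpM2r; [exact: expR_ge0|exact: le_trans (expR_ge1Dx _)].
by rewrite -expRD ler_expR; lra.
Qed.
End haar_povm.

Theorem theorem1 (R : realType) :
  (* Part (1) *)
  (exists K0 c1 c2 : R, 0 < c1 /\ 0 < c2 /\
    forall (n m : nat) (sigma1 sigma2 : 'M[R[i]]_n) (K : R)
      (e0 : 'cV[R[i]]_m)
      (d : measure_display) (T : measurableType d) (P : probability T R)
      (U : T -> 'M[R[i]]_(n * m)),
    density_matrix sigma1 -> density_matrix sigma2 ->
    K0 <= K ->
    4 * n%:R * K ^+ 2 <= m%:R * frob (sigma1 - sigma2) ^+ 2 ->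
    unit_vector e0 ->
    haar_unitary P U ->
    exists E : set T, [/\ measurable E,
      E `<=` [set t | c2 * frob (sigma1 - sigma2) <
                      l1dist (basis_povm (U t) e0 sigma1)
                             (basis_povm (U t) e0 sigma2)]
      & ((1 - expR (- (c1 * K * n%:R)))%:E <= P E)%E])
  /\
  (* Part (2) *)
  (exists c1 c2 : R, 0 < c1 /\ 0 < c2 /\
    forall (n K : nat) (sigma1 sigma2 : 'M[R[i]]_n) (e0 : 'cV[R[i]]_K)
      (d : measure_display) (T : measurableType d) (P : probability T R)
      (b : T -> 'I_(K * n) -> 'cV[R[i]]_(n * K)),
    density_matrix sigma1 -> density_matrix sigma2 ->
    sigma1 <> sigma2 ->
    (1 <= K)%N ->
    unit_vector e0 ->
    complex_gaussian_vectors P b ->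
    exists E : set T, [/\ measurable E,
      E `<=` [set t | c2 * frob (sigma1 - sigma2) / ln (K * n)%:R <
                      l1dist (gauss_povm (b t) e0 sigma1)
                             (gauss_povm (b t) e0 sigma2)]
      & ((1 - expR (- (c1 * (K * n)%:R)))%:E <= P E)%E]).
Proof.
by split; [exact: haar_basis_povm_distinguishes|exact: gaussian_povm_distinguishes].
Qed.
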